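(* Let $\Bbbk$ be an uncountable algebraically closed field of characteristic zero, and let $(R,\mathfrak{m},\Bbbk)$ be a one-dimensional, reduced, standard graded Cohen-Macaulay ring with $R_0=\Bbbk$. Assume further that $R$ has a finite integral closure. If $R$ is of graded countable Cohen-Macaulay type, then $R$ is of graded finite Cohen-Macaulay type and is isomorphic to one of the following: (1) $\Bbbk[x]$; (2) $\Bbbk[x,y]/(xy)$; (3) $\Bbbk[x,y]/(xy(x+y))$; (4) $\Bbbk[x,y,z]/{\det}_2\begin{pmatrix} x & y & z\\ y & z & x\end{pmatrix}$.
   Context: A ring $R$ is standard graded if it is Noetherian and, as an abelian group, $R=\bigoplus_{i\geqslant 0}R_i$ with $R_iR_j\subseteq R_{i+j}$ for all $i,j\geqslant 0$, $R_0$ is a field, and $R=R_0[R_1]$. Write $\mathfrak{m}=\bigoplus_{i\geqslant 1}R_i$ for the irrelevant maximal ideal and $\Bbbk=R_0=R/\mathfrak{m}$. All variables have degree one. A standard graded Cohen-Macaulay ring has graded finite (respectively, graded countable) Cohen-Macaulay type if it has only finitely many (respectively, at most countably many) indecomposable graded maximal Cohen-Macaulay modules (finitely generated), up to graded isomorphism and shift in degree. ''Finite integral closure'' means that the integral closure of $R$ in its total quotient ring is a finitely generated $R$-module. For a matrix $M$, ${\det}_2 M$ denotes the ideal generated by the $2\times 2$ minors of $M$. *)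

(* Defs.v *)
From HB Require Import structures.
From mathcomp Require Import all_boot all_order all_algebra.
From mathcomp Require Import finmap.
From mathcomp Require Import boolp classical_sets cardinality.
From mathcomp Require Import mpoly.

Set Implicit Arguments.
Unset Strict Implicit.
Unset Printing Implicit Defensive.
Import GRing.Theory.
Local Open Scope ring_scope.
Local Open Scope quotient_scope.

(* Subsets (ideals, submodules, homogeneous pieces) are boolean predicates, so
   that the closure predicates of ssralg and ring_quotient apply; together with
   the classical [asbool] these are arbitrary subsets.  Ideals of R are
   submodules of the regular module R^o. *)

Section Modules.
Variables (R : comNzRingType) (M : lmodType R).

Definition lspan (s : seq M) : {pred M} :=
  fun x => `[< exists c : 'I_(size s) -> R, x = \sum_(i < size s) c i *: s`_i >].

Definition fin_gen (N : {pred M}) : Prop := exists s : seq M, N =i lspan s.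

(* the submodule (s_0, ..., s_(n-1)) M *)
Definition seq_smul (s : seq R) : {pred M} :=
  fun x => `[< exists v : 'I_(size s) -> M, x = \sum_(i < size s) s`_i *: v i >].

(* s is an M-regular sequence of elements of I; M / sM <> 0 is required, also
   for the empty sequence. *)
Definition regular_seq (I : {pred R}) (s : seq R) : Prop :=
  [/\ {subset s <= I},
      forall i, (i < size s)%N -> forall v : M,
        s`_i *: v \in seq_smul (take i s) -> v \in seq_smul (take i s)
    & exists v : M, v \notin seq_smul s].

Definition depth_eq (I : {pred R}) (n : nat) : Prop :=
  (exists2 s, regular_seq I s & size s = n) /\
  (forall s, regular_seq I s -> (size s <= n)%N).

End Modules.

Section Rings.
Variable R : comNzRingType.

Definition noetherian : Prop :=
  forall I : {pred R^o}, submod_closed I -> fin_gen I.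

Definition reduced : Prop := forall (x : R) (n : nat), x ^+ n = 0 -> x = 0.

Definition prime_chain (n : nat) (p : 'I_n.+1 -> {pred R}) : Prop :=
  (forall i, idealr_closed (p i) /\ prime_idealr_closed (p i)) /\
  (forall i j : 'I_n.+1, (i < j)%N ->
     {subset p i <= p j} /\ ~ {subset p j <= p i}).

Definition krull_dim (n : nat) : Prop :=
  (exists p : 'I_n.+1 -> {pred R}, prime_chain p) /\
  (forall m (p : 'I_m.+1 -> {pred R}), prime_chain p -> (m <= n)%N).

(* In a commutative ring [GRing.lreg] says that s is a nonzerodivisor. *)
Definition total_quotient_ring (Q : comUnitAlgType R) : Prop :=
  [/\ injective (in_alg Q),
      forall s : R, GRing.lreg s -> (s%:A : Q) \is a GRing.unit
    & forall q : Q, exists a s : R, GRing.lreg s /\ q = a%:A / s%:A].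

Definition integral_closure (Q : comUnitAlgType R) : {pred Q} :=
  fun q => `[< integralOver (in_alg Q) q >].
Arguments integral_closure Q q : clear implicits.

(* The total quotient ring is unique up to isomorphism of R-algebras. *)
Definition finite_integral_closure : Prop :=
  exists2 Q : comUnitAlgType R,
    total_quotient_ring Q & fin_gen (integral_closure Q).

End Rings.

Section DirectSum.
Variables (I : choiceType) (V : zmodType) (g : I -> {pred V}).

Definition decomp (f : {fsfun I -> V with 0}) (x : V) : Prop :=
  (forall i, f i \in g i) /\ x = \sum_(i <- finsupp f) f i.

Definition direct_sum : Prop :=
  (forall i, zmod_closed (g i)) /\
  (forall x, exists! f : {fsfun I -> V with 0}, decomp f x).

End DirectSum.

Section StandardGraded.
Variables (k : fieldType) (R : comAlgType k) (gR : nat -> {pred R}).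

(* Standard graded with R_0 = k: the structure map of the k-algebra R
   identifies k with R_0. *)
Definition standard_graded : Prop :=
  [/\ noetherian R,
      direct_sum gR,
      forall i j x y, x \in gR i -> y \in gR j -> x * y \in gR (i + j)%N,
      forall x, x \in gR 0%N <-> exists c : k, x = c%:A
    & forall S : {pred R}, subring_closed S ->
        {subset gR 0%N <= S} -> {subset gR 1%N <= S} -> S =i predT].

Definition irrelevant_ideal : {pred R} :=
  fun x => `[< exists2 f, decomp gR f x & f 0%N = 0 >].

Definition graded_CM_ring : Prop :=
  exists2 n, krull_dim R n & depth_eq R^o irrelevant_ideal n.

Definition is_graded_module (M : lmodType R) (gM : int -> {pred M}) : Prop :=
  direct_sum gM /\
  (forall (i : nat) (j : int) (r : R) (v : M),
     r \in gR i -> v \in gM j -> r *: v \in gM (i%:Z + j)).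

Record graded_module := GradedModule {
  gm_sort :> lmodType R;
  gm_piece : int -> {pred gm_sort};
  gm_axiom : is_graded_module gm_piece
}.
Arguments gm_piece : clear implicits.

(* M is isomorphic to the shift N(d), where N(d)_i = N_(i + d). *)
Definition iso_up_to_shift (M N : graded_module) : Prop :=
  exists (d : int) (f : {linear M -> N}), bijective f /\
    (forall (i : int) (v : M), (f v \in gm_piece N (i + d)) = (v \in gm_piece M i)).

Definition graded_MCM (M : graded_module) : Prop :=
  fin_gen (predT : {pred M}) /\
  (exists2 n, krull_dim R n & depth_eq M irrelevant_ideal n).

Definition graded_submodule (M : graded_module) (N : {pred M}) : Prop :=
  submod_closed N /\
  (forall v f, v \in N -> decomp (gm_piece M) f v -> forall i, f i \in N).

Definition indecomposable (M : graded_module) : Prop :=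
  (exists v : M, v != 0) /\
  (forall N1 N2 : {pred M}, graded_submodule N1 -> graded_submodule N2 ->
     (forall v, v \in N1 -> v \in N2 -> v = 0) ->
     (forall v, exists v1 v2, [/\ v1 \in N1, v2 \in N2 & v = v1 + v2]) ->
     (forall v, v \in N1 -> v = 0) \/ (forall v, v \in N2 -> v = 0)).

Definition graded_finite_CM_type : Prop :=
  exists (n : nat) (F : 'I_n -> graded_module),
    forall M, graded_MCM M -> indecomposable M ->
      exists i, iso_up_to_shift M (F i).

Definition graded_countable_CM_type : Prop :=
  exists F : nat -> graded_module,
    forall M, graded_MCM M -> indecomposable M ->
      exists i, iso_up_to_shift M (F i).

End StandardGraded.

Definition graded_alg_iso (k : fieldType) (A B : comAlgType k)
    (gA : nat -> {pred A}) (gB : nat -> {pred B}) : Prop :=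
  exists f : {lrmorphism A -> B}, bijective f /\
    (forall i x, (f x \in gB i) = (x \in gA i)).

Definition mpoly_piece (k : fieldType) (n d : nat) : {pred {mpoly k[n]}} :=
  fun p => p \is d.-homog.

(* mpoly_quot is k[X_0, ..., X_(n-1)] / (s).  The vanishing constant terms of
   the generators make the ideal proper, which {ideal_quot _} requires. *)
Section PolyQuotient.
Variables (k : fieldType) (n : nat) (s : seq {mpoly k[n]}).
Hypothesis hs : all (fun p => p@_0%MM == 0) s.

Definition gen_ideal of all (fun p => p@_0%MM == 0) s : {pred {mpoly k[n]}} :=
  @lspan _ {mpoly k[n]}^o s.

Lemma gen_ideal_closed : idealr_closed (gen_ideal hs).
Proof.
split.
- by apply/asboolP; exists (fun=> 0); rewrite big1 // => i _; rewrite scale0r.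
- apply/negP => /asboolP[c] /(congr1 (mcoeff 0%MM)) /eqP.
  rewrite mcoeff1 eqxx raddf_sum /= big1 ?oner_eq0 // => i _.
  rewrite [_ *: _]/(_ * _) mcoeff0_is_multiplicative.
  by rewrite (eqP (all_nthP 0 hs i (ltn_ord i))) mulr0.
- move=> a u v /asboolP[c ->] /asboolP[d ->]; apply/asboolP.
  exists (fun i => a * c i + d i).
  rewrite mulr_sumr -big_split /=; apply: eq_bigr => i _.
  by rewrite scalerDl -scalerA.
Qed.

HB.instance Definition _ :=
  isIdealr.Build {mpoly k[n]} (gen_ideal hs) gen_ideal_closed.

Definition mpoly_quot := {ideal_quot (gen_ideal hs)}.

HB.instance Definition _ := GRing.ComNzRing.on mpoly_quot.

Definition quot_pi (p : {mpoly k[n]}) : mpoly_quot := \pi p.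

Fact quot_pi_is_zmod_morphism : zmod_morphism quot_pi.
Proof. by move=> p q; rewrite /quot_pi; exact: raddfB. Qed.

Fact quot_pi_is_monoid_morphism : monoid_morphism quot_pi.
Proof. by split=> [|p q]; rewrite /quot_pi; [exact: rmorph1 | exact: rmorphM]. Qed.

HB.instance Definition _ :=
  GRing.isZmodMorphism.Build _ _ quot_pi quot_pi_is_zmod_morphism.
HB.instance Definition _ :=
  GRing.isMonoidMorphism.Build _ _ quot_pi quot_pi_is_monoid_morphism.

Definition quot_scale (a : k) (x : mpoly_quot) : mpoly_quot := quot_pi a%:MP * x.

Fact quot_scaleA a b x : quot_scale a (quot_scale b x) = quot_scale (a * b) x.
Proof. by rewrite /quot_scale mulrA -rmorphM /= mpolyCM. Qed.

Fact quot_scale1 : left_id 1 quot_scale.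
Proof. by move=> x; rewrite /quot_scale mpolyC1 rmorph1 mul1r. Qed.

Fact quot_scaleDr : right_distributive quot_scale +%R.
Proof. by move=> a x y; rewrite /quot_scale mulrDr. Qed.

Fact quot_scaleDl x : {morph quot_scale^~ x : a b / a + b}.
Proof. by move=> a b; rewrite /quot_scale mpolyCD rmorphD mulrDl. Qed.

HB.instance Definition _ := GRing.Zmodule_isLmodule.Build k mpoly_quot
  quot_scaleA quot_scale1 quot_scaleDr quot_scaleDl.

Fact quot_scaleAl (a : k) (x y : mpoly_quot) : a *: (x * y) = (a *: x) * y.
Proof. exact: mulrA. Qed.

HB.instance Definition _ :=
  GRing.Lmodule_isLalgebra.Build k mpoly_quot quot_scaleAl.
HB.instance Definition _ := GRing.Lalgebra_isComAlgebra.Build k mpoly_quot.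

Definition quot_piece (d : nat) : {pred mpoly_quot} :=
  fun x => `[< exists2 p, p \is d.-homog & x = quot_pi p >].

End PolyQuotient.

Definition incr_pairs (n : nat) : seq {ffun 'I_2 -> 'I_n} :=
  [seq f : {ffun 'I_2 -> 'I_n} <- enum {: {ffun 'I_2 -> 'I_n}} |
     (f ord0 < f ord_max)%N].

Definition minors2 (A : comNzRingType) (m n : nat) (M : 'M[A]_(m, n)) : seq A :=
  [seq \det (mxsub f g M) | f : {ffun 'I_2 -> 'I_m} <- incr_pairs m,
                           g : {ffun 'I_2 -> 'I_n} <- incr_pairs n].

Definition cyclic_mx (k : fieldType) : 'M[{mpoly k[3]}]_(2, 3) :=
  \matrix_(i < 2, j < 3) [:: 'X_0; 'X_1; 'X_2]`_((i + j) %% 3).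

Lemma xy_no_const (k : fieldType) :
  all (fun p : {mpoly k[2]} => p@_0%MM == 0) [:: 'X_0 * 'X_1].
Proof. by rewrite /= rmorphM /= mcoeffX mnm1_eq0 mul0r eqxx. Qed.

Lemma xyxy_no_const (k : fieldType) :
  all (fun p : {mpoly k[2]} => p@_0%MM == 0) [:: 'X_0 * 'X_1 * ('X_0 + 'X_1)].
Proof. by rewrite /= 2!rmorphM /= mcoeffX mnm1_eq0 2!mul0r eqxx. Qed.

Lemma cyclic_minors_no_const (k : fieldType) :
  all (fun p : {mpoly k[3]} => p@_0%MM == 0) (minors2 (cyclic_mx k)).
Proof.
apply/allP => _ /allpairsP[[f g] /= [_ _ ->]].
rewrite -det_map_mx (_ : map_mx _ _ = 0) ?det0 //.
apply/matrixP => i j; rewrite !mxE.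
by case: (_ %% 3)%N => [|[|[|l]]] /=;
  rewrite ?nth_nil ?mcoeffX ?mcoeff0 ?mnm1_eq0.
Qed.

(* Main.v *)
From HB Require Import structures.
From mathcomp Require Import all_boot all_order all_algebra.
From mathcomp Require Import finmap.
From mathcomp Require Import boolp classical_sets cardinality.
From mathcomp Require Import mpoly.
From mathcomp Require Import zify ring.
Require Import Defs.

Set Implicit Arguments.
Unset Strict Implicit.
Unset Printing Implicit Defensive.
Import GRing.Theory Num.Theory.
Local Open Scope ring_scope.

(** The ring [R] is the homogeneous coordinate ring of finitely many points.  By
    the dimension hypothesis a homogeneous prime that does not contain [R_1] is
    minimal, there are finitely many of them, they intersect in zero because [R]
    is reduced, and each quotient is a polynomial ring in one variable.  This
    gives [coordinates_exist]: [R] embeds into a product of [e] copies of [k[X]],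
    and a linear form [l] vanishes at none of the [e] points.  Inverting [l]
    identifies [R[1/l]_0] with [k^e].

    If [e >= 4], project to four of the points and consider the submodules of
    [k[X]^4] of all [f] for which [f(0)] belongs to a given plane in [k^4].  They
    are indecomposable maximal Cohen-Macaulay modules, and the cross ratio of
    the four coordinate functionals on the plane is an invariant, so that there
    are as many of them as elements of [k].  Countable type therefore implies
    [e <= 3] (see [family_uncountable]).

    For [e <= 3] a maximal Cohen-Macaulay module [M] is torsion-free, hence an
    increasing filtration of the [k^e]-module [V = M[1/l]_0].  A [k^e]-linear map
    from [V] to [k^e] is the same as a linear functional on [V], and suitable
    functionals split off direct summands ([chart_split]); an indecomposable
    module is then equal to the summand and determined by the image of the
    filtration in [k^e] ([model_iso]).  If the idempotents of [k^e] act on [M]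
    with degree one, this image begins with a line, determined by the support of
    its vectors, or with a plane, and is everything supported at the same points
    afterwards; in substance this is the classification of three subspaces of a
    vector space ([overring_classification]).  The idempotents do act if [R_1] is
    all of [k^e].  The only other case is that of three collinear points.  Then
    [R] is Gorenstein, and by the argument of Bass a module on which the
    idempotents do not act has a free summand ([free_summand]).

    Finally one, two or three points in general position and three collinear
    points are each unique up to a linear change of coordinates, and the ideals
    of the points are computed by restricting polynomials to the points. *)

(** * Homogeneous components *)

Section Components.
Variables (I : choiceType) (V : zmodType) (g : I -> {pred V}).
Hypothesis hg : direct_sum g.

Definition hcomp (i : I) (x : V) : V :=
  sval (cid (proj2 hg x)) i.

Lemma piece0 i : 0 \in g i.
Proof. by have [/(_ i) []] := hg. Qed.

Lemma pieceB i : {in g i &, forall x y, x - y \in g i}.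
Proof. by have [/(_ i) []] := hg. Qed.

Lemma pieceN i x : x \in g i -> - x \in g i.
Proof. by move=> hx; rewrite -sub0r pieceB ?piece0. Qed.

Lemma pieceD i : {in g i &, forall x y, x + y \in g i}.
Proof. by move=> x y hx hy; rewrite -[y]opprK pieceB ?pieceN. Qed.

Lemma piece_sum i (J : Type) (s : seq J) (P : pred J) (F : J -> V) :
  (forall j, P j -> F j \in g i) -> \sum_(j <- s | P j) F j \in g i.
Proof.
move=> h; elim/big_ind: _ => //; [exact: piece0 | by move=> *; exact: pieceD].
Qed.

Lemma hcomp_in i x : hcomp i x \in g i.
Proof. by rewrite /hcomp; case: cid => f /= [] []. Qed.

Lemma hcomp_sum x : exists s : seq I, [/\ uniq s,
  x = \sum_(i <- s) hcomp i x & forall i, i \notin s -> hcomp i x = 0].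
Proof.
rewrite /hcomp; case: cid => f /= [[h ->] _].
by exists (finsupp f); split=> // i /fsfun_dflt.
Qed.

Lemma hcomp_uniq (F : I -> V) (s : seq I) :
  uniq s -> (forall i, F i \in g i) -> (forall i, i \notin s -> F i = 0) ->
  forall i, hcomp i (\sum_(i <- s) F i) = F i.
Proof.
move=> us hF Fs i; rewrite /hcomp; case: cid => f /= [[hf e] hu].
pose f' : {fsfun I -> V with 0} := [fsfun i in [fset i | i in s]%fset => F i].
have f'E j : f' j = F j.
  rewrite fsfunE; case: ifPn => // hj; rewrite Fs //.
  by apply: contra hj => hj; rewrite !inE.
suff -> : f = f' by rewrite f'E.
apply: hu; split=> [j|]; first by rewrite f'E.
rewrite [RHS](eq_bigr F) => [|j _]; last by rewrite f'E.
have sub : {subset finsupp f' <= s}.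
  move=> j; apply: contraTT => /Fs hj; rewrite mem_finsupp f'E hj eqxx //.
rewrite (bigID (mem (finsupp f'))) /= [X in _ + X]big1 ?addr0 => [|j].
  rewrite -big_filter; apply: perm_big; apply: uniq_perm.
  - exact: filter_uniq.
  - exact: fset_uniq.
  - move=> j; rewrite mem_filter; case hj: (j \in finsupp f') => //=.
    by rewrite sub.
by rewrite mem_finsupp negbK f'E => /eqP.
Qed.

Lemma hcomp_wide x : exists s0 : seq I, forall s, uniq s -> {subset s0 <= s} ->
  x = \sum_(i <- s) hcomp i x.
Proof.
have [s0 [us0 e h]] := hcomp_sum x; exists s0 => s us sub.
rewrite {1}e [RHS](bigID (mem s0) predT) /= [X in _ + X]big1 ?addr0 => [|j /h //].
rewrite -[RHS]big_filter; apply: perm_big; apply: uniq_perm => //.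
  exact: filter_uniq.
by move=> j; rewrite mem_filter; case hj: (j \in s0) => //=; rewrite sub.
Qed.

Lemma hcompB i : {morph hcomp i : x y / x - y}.
Proof.
move=> x y; have [s1 [u1 e1 h1]] := hcomp_sum x.
have [s2 [u2 e2 h2]] := hcomp_sum y.
have [s1' e1'] := hcomp_wide x; have [s2' e2'] := hcomp_wide y.
pose s := undup (s1 ++ s2 ++ s1' ++ s2').
have us : uniq s by exact: undup_uniq.
have ex : x = \sum_(j <- s) hcomp j x.
  by apply: (e1' s us) => j hj; rewrite mem_undup !mem_cat hj !orbT.
have ey : y = \sum_(j <- s) hcomp j y.
  by apply: (e2' s us) => j hj; rewrite mem_undup !mem_cat hj !orbT.
rewrite {1}ex {1}ey -sumrB (hcomp_uniq (F := fun j => hcomp j x - hcomp j y)) //.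
  by move=> j; rewrite pieceB ?hcomp_in.
move=> j; rewrite mem_undup !mem_cat !negb_or => /and4P[/h1-> /h2-> _ _].
by rewrite subrr.
Qed.

Lemma hcomp0 i : hcomp i 0 = 0.
Proof. by have := hcompB i 0 0; rewrite !subrr. Qed.

Lemma hcompN i : {morph hcomp i : x / - x}.
Proof. by move=> x; rewrite -sub0r hcompB hcomp0 sub0r. Qed.

Lemma hcompD i : {morph hcomp i : x y / x + y}.
Proof. by move=> x y; rewrite -{1}[y]opprK hcompB hcompN opprK. Qed.

Lemma hcomp_bigsum i (J : Type) (s : seq J) (P : pred J) (F : J -> V) :
  hcomp i (\sum_(j <- s | P j) F j) = \sum_(j <- s | P j) hcomp i (F j).
Proof. exact: (big_morph _ (hcompD i) (hcomp0 i)). Qed.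

Lemma hcomp_piece i j x : x \in g i -> hcomp j x = if j == i then x else 0.
Proof.
move=> hx; have := @hcomp_uniq (fun j => if j == i then x else 0) [:: i].
rewrite big_seq1 eqxx; apply=> // l; first by case: eqP => [->|]; rewrite ?piece0.
by rewrite inE => /negbTE ->.
Qed.

Lemma hcomp_id i x : x \in g i -> hcomp i x = x.
Proof. by move=> /hcomp_piece ->; rewrite eqxx. Qed.

Lemma hcomp_idem i j x : hcomp j (hcomp i x) = if j == i then hcomp i x else 0.
Proof. by apply: hcomp_piece; exact: hcomp_in. Qed.

Lemma hcomp_eq0 x : (forall i, hcomp i x = 0) -> x = 0.
Proof. by move=> h; have [s [_ -> _]] := hcomp_sum x; rewrite big1. Qed.

Lemma hcomp_inj x y : (forall i, hcomp i x = hcomp i y) -> x = y.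
Proof.
by move=> h; apply/subr0_eq/hcomp_eq0 => i; rewrite hcompB h subrr.
Qed.

Lemma hcomp_single i x : (forall j, j != i -> hcomp j x = 0) -> x = hcomp i x.
Proof.
move=> h; apply: hcomp_inj => j; rewrite hcomp_idem.
by case: eqP => [->//|/eqP /h].
Qed.

Lemma pieceP i x : reflect (forall j, j != i -> hcomp j x = 0) (x \in g i).
Proof.
apply: (iffP idP) => [/hcomp_piece h j|/hcomp_single ->]; last exact: hcomp_in.
by rewrite h => /negbTE ->.
Qed.

Lemma hcomp_ind (P : V -> Prop) x :
  P 0 -> (forall u v, P u -> P v -> P (u + v)) ->
  (forall i, P (hcomp i x)) -> P x.
Proof.
by move=> P0 PD Pi; have [s [_ -> _]] := hcomp_sum x; elim/big_ind: _.
Qed.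

Lemma decompE f x : decomp g f x -> forall i, f i = hcomp i x.
Proof.
move=> [hf ->] i; symmetry; apply: hcomp_uniq => // j.
exact: fsfun_dflt.
Qed.

Lemma hcomp_decomp x : exists2 f, decomp g f x & forall i, f i = hcomp i x.
Proof. by rewrite /hcomp; case: cid => f /= [hf _]; exists f. Qed.

(** With [T] the multiplication by a homogeneous element, this reduces products
    to their components. *)
Lemma hcomp_shift (T : V -> V) (sigma : I -> I) :
  {morph T : x y / x + y} -> injective sigma ->
  (forall i x, x \in g i -> T x \in g (sigma i)) ->
  forall i x, hcomp (sigma i) (T x) = T (hcomp i x).
Proof.
move=> TD sinj Tg i x; have T0 : T 0 = 0.
  by apply: (addrI (T 0)); rewrite -TD !addr0.
apply: (hcomp_ind (P := fun x => hcomp (sigma i) (T x) = T (hcomp i x))).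
- by rewrite T0 !hcomp0 T0.
- by move=> u v; rewrite TD !hcompD TD => -> ->.
move=> j; rewrite (hcomp_piece (i := sigma j)) ?Tg ?hcomp_in //.
by rewrite hcomp_idem (inj_eq sinj); case: ifP; rewrite ?T0.
Qed.

Lemma hcomp_shift0 (T : V -> V) (sigma : I -> I) :
  {morph T : x y / x + y} ->
  (forall i x, x \in g i -> T x \in g (sigma i)) ->
  forall j x, (forall i, sigma i != j) -> hcomp j (T x) = 0.
Proof.
move=> TD Tg j x hj; have T0 : T 0 = 0.
  by apply: (addrI (T 0)); rewrite -TD !addr0.
apply: (hcomp_ind (P := fun x => hcomp j (T x) = 0)).
- by rewrite T0 hcomp0.
- by move=> u v; rewrite TD !hcompD => -> ->; rewrite addr0.
move=> i; rewrite (hcomp_piece (i := sigma i)) ?Tg ?hcomp_in //.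
by rewrite eq_sym (negbTE (hj i)).
Qed.

End Components.

(** * Graded rings and their homogeneous primes *)

Section GradedRing.
Variables (k : fieldType) (R : comAlgType k) (gR : nat -> {pred R}).
Hypothesis R_std : standard_graded gR.

Lemma std_direct : direct_sum gR. Proof. by case: R_std. Qed.
Lemma std_noetherian : noetherian R. Proof. by case: R_std. Qed.

Lemma std_mul i j x y : x \in gR i -> y \in gR j -> x * y \in gR (i + j)%N.
Proof. by case: R_std => _ _ h _ _; exact: h. Qed.

Lemma std_deg0 x : x \in gR 0%N <-> exists c : k, x = c%:A.
Proof. by case: R_std. Qed.

Local Notation pr := (hcomp std_direct).

Lemma scalar_deg0 (c : k) : (c%:A : R) \in gR 0%N.
Proof. by apply/std_deg0; exists c. Qed.

Lemma one_deg0 : 1 \in gR 0%N.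
Proof. by rewrite -(scale1r 1) scalar_deg0. Qed.

Lemma std_scale i (c : k) x : x \in gR i -> c *: x \in gR i.
Proof.
by move=> hx; rewrite -[x]mul1r scalerAl; apply: (std_mul (scalar_deg0 c)).
Qed.

Lemma std_exp i x n : x \in gR i -> x ^+ n \in gR (i * n)%N.
Proof.
move=> hx; elim: n => [|n IH]; first by rewrite expr0 muln0 one_deg0.
by rewrite exprS mulnS std_mul.
Qed.

Lemma std_exp1 x n : x \in gR 1%N -> x ^+ n \in gR n.
Proof. by move=> hx; rewrite -[n in gR n]mul1n std_exp. Qed.

Lemma std_prod n (F : 'I_n -> R) : (forall i, F i \in gR 1%N) ->
  forall P : pred 'I_n, \prod_(i | P i) F i \in gR #|P|.
Proof.
move=> hF P; rewrite -big_enum -sum1_card -[X in gR X]big_enum /=.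
elim: (enum P) => [|i s IH]; first by rewrite !big_nil one_deg0.
by rewrite !big_cons std_mul.
Qed.

(** Generation in degree one, as an induction principle. *)
Lemma std_ind (P : R -> Prop) :
  (forall c : k, P c%:A) -> (forall y, y \in gR 1%N -> P y) ->
  (forall u v, P u -> P v -> P (u + v)) ->
  (forall u v, P u -> P v -> P (u * v)) -> forall x, P x.
Proof.
move=> Pc P1 PD PM x; have [_ _ _ _ gen] := R_std.
have := gen (fun x => `[< P x >]) _ _ _ x.
move=> H; suff : x \in (fun x => `[< P x >]) by move=> /asboolP.
rewrite H //.
- have P1' : P 1 by rewrite -[1]scale1r.
  have PN u : P u -> P (- u).
    by move=> /(PM _ _ (Pc (-1))); rewrite scaleN1r mulN1r.
  split; first exact/asboolP.
    by move=> u v /asboolP hu /asboolP hv; apply/asboolP/PD => //; apply: PN.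
  by move=> u v /asboolP hu /asboolP hv; apply/asboolP/PM.
- by move=> y /std_deg0 [c ->]; apply/asboolP.
- by move=> y /P1 hy; apply/asboolP.
Qed.

Lemma hcompMl d r n x : r \in gR d -> pr (d + n)%N (r * x) = r * pr n x.
Proof.
move=> hr; apply: (hcomp_shift std_direct (T := fun x => r * x) (sigma := addn d)).
- by move=> u v; rewrite mulrDr.
- exact: addnI.
- by move=> i u; exact: std_mul.
Qed.

Lemma hcompMl_lt d r n x : r \in gR d -> (n < d)%N -> pr n (r * x) = 0.
Proof.
move=> hr hn; apply: (hcomp_shift0 std_direct (T := fun x => r * x) (sigma := addn d)).
- by move=> u v; rewrite mulrDr.
- by move=> i u; exact: std_mul.
- by move=> i; apply/eqP => e; move: hn; rewrite -e ltnNge leq_addr.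
Qed.

Lemma hcompM n x y : pr n (x * y) = \sum_(i < n.+1) pr i x * pr (n - i)%N y.
Proof.
pose Q x := pr n (x * y) = \sum_(i < n.+1) pr i x * pr (n - i)%N y.
rewrite -/(Q x); apply: (@hcomp_ind _ _ _ std_direct Q x); rewrite /Q {Q}.
- by rewrite mul0r hcomp0 big1 // => i _; rewrite hcomp0 mul0r.
- move=> u v hu hv; rewrite mulrDl hcompD hu hv -big_split /=.
  by apply: eq_bigr => i _; rewrite hcompD mulrDl.
move=> d; have hd := hcomp_in std_direct d x; have [le|lt] := leqP d n.
  rewrite (bigD1 (inord d)) //= inordK ?ltnS // big1 => [|i hi].
    rewrite addr0 hcomp_idem eqxx -{1}(subnKC le) hcompMl //.
  rewrite hcomp_idem; case: eqP => [e|]; last by rewrite mul0r.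
  by move: hi; rewrite -e inord_val eqxx.
rewrite (hcompMl_lt _ hd lt) big1 // => i _; rewrite hcomp_idem.
case: eqP => [e|]; last by rewrite mul0r.
by move: (ltn_ord i) lt; rewrite e ltnS leqNgt => /negbTE ->.
Qed.

Lemma hcomp_bounded x : exists N, forall n, (N <= n)%N -> pr n x = 0.
Proof.
have [s [_ _ h]] := hcomp_sum std_direct x.
exists (\max_(i <- s) i).+1 => n hn; apply: h; apply/negP => hs.
by move: hn; rewrite ltnNge leq_bigmax_seq.
Qed.

Lemma hcomp_sum_lt x N : (forall n, (N <= n)%N -> pr n x = 0) ->
  x = \sum_(i < N) pr i x.
Proof.
move=> h; apply: (hcomp_inj (hg := std_direct)) => n; rewrite hcomp_bigsum.
have [le|lt] := leqP N n.
  rewrite h // big1 // => i _; rewrite hcomp_idem; case: eqP => // e.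
  by move: (ltn_ord i); rewrite -e ltnNge le.
rewrite (bigD1 (Ordinal lt)) //= hcomp_idem eqxx big1 ?addr0 // => i hi.
rewrite hcomp_idem; case: eqP => // e; case/eqP: hi; exact: val_inj.
Qed.

Definition ord_ge (N : nat) (x : R) := forall n, (n < N)%N -> pr n x = 0.

Lemma ord_geM m n x y : ord_ge m x -> ord_ge n y -> ord_ge (m + n) (x * y).
Proof.
move=> hx hy d hd; rewrite hcompM big1 // => i _.
have [lt|le] := ltnP i m; first by rewrite hx // mul0r.
by rewrite hy ?mulr0 //; have := ltn_ord i; lia.
Qed.

Lemma ord_ge_exp n x : ord_ge 1 x -> ord_ge n (x ^+ n).
Proof.
move=> hx; elim: n => [|n IH]; first by [].
by rewrite exprS -add1n; exact: ord_geM.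
Qed.

Lemma irrelevantP x : reflect (pr 0%N x = 0) (x \in irrelevant_ideal gR).
Proof.
apply: (iffP idP) => [/asboolP [f hf f0]|h]; first by rewrite -(decompE _ hf).
apply/asboolP; have [f hf e] := hcomp_decomp std_direct x.
by exists f; rewrite // e.
Qed.

(** ** Graded ideals *)

Definition is_ideal (I : {pred R}) := submod_closed (I : {pred R^o}).

Lemma ideal0 I : is_ideal I -> 0 \in I. Proof. by case. Qed.

Lemma idealMD I : is_ideal I -> forall a u v, u \in I -> v \in I -> a * u + v \in I.
Proof. by case=> _ h a u v hu hv; exact: (h a u v). Qed.

Lemma idealD I : is_ideal I -> forall u v, u \in I -> v \in I -> u + v \in I.
Proof. by move=> h u v hu hv; rewrite -[u]mul1r idealMD. Qed.

Lemma idealM I : is_ideal I -> forall a u, u \in I -> a * u \in I.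
Proof. by move=> h a u hu; rewrite -[_ * _]addr0 idealMD ?ideal0. Qed.

Lemma idealMr I : is_ideal I -> forall a u, u \in I -> u * a \in I.
Proof. by move=> h a u hu; rewrite mulrC idealM. Qed.

Lemma idealN I : is_ideal I -> forall u, u \in I -> - u \in I.
Proof. by move=> h u hu; rewrite -mulN1r idealM. Qed.

Lemma idealB I : is_ideal I -> forall u v, u \in I -> v \in I -> u - v \in I.
Proof. by move=> h u v hu hv; rewrite idealD ?idealN. Qed.

Lemma idealZ I : is_ideal I -> forall (c : k) u, u \in I -> c *: u \in I.
Proof. by move=> h c u hu; rewrite -[u]mul1r scalerAl idealM. Qed.

Lemma ideal_sum I : is_ideal I -> forall J (s : seq J) (P : pred J) (F : J -> R),
  (forall j, P j -> F j \in I) -> \sum_(j <- s | P j) F j \in I.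
Proof.
move=> h J s P F hF; elim/big_ind: _ => //; [exact: ideal0 | exact: idealD].
Qed.

(** Otherwise a strictly increasing sequence of ideals could be chosen in the
    family; but the finitely many generators of its union already occur at a
    finite stage. *)
Lemma noetherian_max (Q : {pred R} -> Prop) :
  (forall I, Q I -> is_ideal I) -> (exists I, Q I) ->
  exists I, Q I /\ forall J, Q J -> {subset I <= J} -> {subset J <= I}.
Proof.
move=> Qid [I0 QI0]; apply: contrapT => hno.
have next (I : {I | Q I}) :
    exists J : {I | Q I}, {subset sval I <= sval J} /\ ~ {subset sval J <= sval I}.
  apply: contrapT => h; apply: hno; exists (sval I); split; first exact: svalP.
  move=> J QJ IJ; apply: contrapT => JI.
  by apply: h; exists (exist _ J QJ).
pose nx I := sval (cid (next I)).
pose f n := iter n nx (exist _ I0 QI0).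
have fS n : {subset sval (f n) <= sval (f n.+1)} /\
            ~ {subset sval (f n.+1) <= sval (f n)}.
  exact: (svalP (cid (next (f n)))).
have fle m n : (m <= n)%N -> {subset sval (f m) <= sval (f n)}.
  elim: n => [|n IH]; first by rewrite leqn0 => /eqP ->.
  rewrite leq_eqVlt => /orP [/eqP -> //|/IH h] x /h; exact: (fS n).1.
have fid n : is_ideal (sval (f n)) by apply: Qid; exact: svalP.
pose U : {pred R} := fun x => `[< exists n, x \in sval (f n) >].
have Uid : is_ideal U.
  split; first by apply/asboolP; exists 0%N; exact: ideal0.
  move=> a u v /asboolP [m hm] /asboolP [n hn]; apply/asboolP.
  exists (maxn m n); apply: idealMD => //.
    by apply: fle hm; exact: leq_maxl.
  by apply: fle hn; exact: leq_maxr.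
have [s hs] := std_noetherian Uid.
have gen (i : 'I_(size s)) : exists n, s`_i \in sval (f n).
  suff : s`_i \in U by move=> /asboolP.
  rewrite hs; apply/asboolP.
  exists (fun j => (j == i)%:R); rewrite (bigD1 i) //= eqxx scale1r.
  by rewrite big1 ?addr0 // => j /negbTE ->; rewrite scale0r.
pose N := \max_(i < size s) sval (cid (gen i)).
case: (fS N) => _; apply=> x hx.
have : x \in U by apply/asboolP; exists N.+1.
rewrite hs => /asboolP [c ->]; apply: ideal_sum => // i _.
apply: (idealM (fid N)); apply: fle (svalP (cid (gen i))).
exact: leq_bigmax.
Qed.

Definition gideal (I : {pred R}) :=
  is_ideal I /\ forall x n, x \in I -> pr n x \in I.

Definition adjoin (I : {pred R}) (a : R) : {pred R} :=
  fun x => `[< exists u b, u \in I /\ x = u + b * a >].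

Lemma adjoin_gideal I a d : gideal I -> a \in gR d -> gideal (adjoin I a).
Proof.
move=> [hI hc] ha; split.
  split; first by apply/asboolP; exists 0, 0; rewrite mul0r addr0 ideal0.
  move=> r _ _ /asboolP [u [b [hu ->]]] /asboolP [v [c [hv ->]]].
  apply/asboolP; exists (r * u + v), (r * b + c); split; first exact: idealMD.
  rewrite -[_ *: _]/(r * (u + b * a)) mulrDr mulrDl mulrA -!addrA.
  by congr (_ + _); rewrite addrCA.
move=> x n /asboolP [u [b [hu ->]]]; apply/asboolP.
rewrite hcompD mulrC; have [le|lt] := leqP d n.
  exists (pr n u), (pr (n - d)%N b); split; first exact: hc.
  by rewrite -{2}(subnKC le) hcompMl // mulrC.
by exists (pr n u), 0; rewrite mul0r (hcompMl_lt _ ha lt); split => //; exact: hc.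
Qed.

Lemma sub_adjoin I a : {subset I <= adjoin I a}.
Proof.
by move=> x hx; apply/asboolP; exists x, 0; rewrite mul0r addr0.
Qed.

Lemma mem_adjoin I a : gideal I -> a \in adjoin I a.
Proof.
by move=> hI; apply/asboolP; exists 0, 1; rewrite mul1r add0r ideal0 //; case: hI.
Qed.

(** ** Homogeneous primes *)

Definition gprime (P : {pred R}) :=
  [/\ gideal P, 1 \notin P & prime_idealr_closed P].

Lemma gprime_ideal P : gprime P -> is_ideal P.
Proof. by case=> [[]]. Qed.

Lemma gprimeM P : gprime P -> forall u v, u * v \in P -> u \in P \/ v \in P.
Proof. by case=> _ _ h u v /h /orP. Qed.

Lemma gprime_exp P : gprime P -> forall n u, u ^+ n \in P -> u \in P.
Proof.
move=> hP; elim=> [|n IH] u; first by rewrite expr0; case: hP => _ /negbTE ->.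
by rewrite exprS => /(gprimeM hP) [|/IH].
Qed.

Lemma gprime_idealr P : gprime P -> idealr_closed P.
Proof.
by move=> hP; have [[hI _] h1 _] := hP; split; [exact: ideal0| |exact: idealMD].
Qed.

(** If neither [u] nor [v] is in [P], the product of their lowest components
    outside [P] is, modulo [P], a component of [u * v]. *)
Lemma gprime_homogeneous P : gideal P -> 1 \notin P ->
  (forall i j a b, a \in gR i -> b \in gR j -> a * b \in P -> a \in P \/ b \in P) ->
  gprime P.
Proof.
move=> [hI hc] h1 hP; split=> // u v huv; apply/negPn/negP; rewrite negb_or.
move=> /andP [hu hv].
have out x : x \notin P -> exists i, pr i x \notin P.
  move=> hx; apply: contrapT => h; move/negP: hx; apply.
  apply: (@hcomp_ind _ _ _ std_direct (fun x => x \in P) x).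
  - exact: ideal0.
  - exact: idealD.
  - by move=> i; apply/negPn/negP => hi; apply: h; exists i.
case: (ex_minnP (out u hu)) => i hi mini.
case: (ex_minnP (out v hv)) => j hj minj.
have : pr (i + j)%N (u * v) \in P by exact: hc.
have ltij : (i < (i + j).+1)%N by rewrite ltnS leq_addr.
rewrite hcompM (bigD1 (Ordinal ltij)) //= addKn => /(idealB hI).
move=> /(_ (\sum_(l < (i + j).+1 | l != Ordinal ltij) pr l u * pr (i + j - l)%N v)).
rewrite addrK => H; case: (hP _ _ _ _ (hcomp_in std_direct i u) (hcomp_in std_direct j v)).
- apply: H; apply: ideal_sum => // l hl; have [lt|le] := ltnP l i.
    apply: idealMr => //; apply/negPn/negP => /mini.
    by rewrite leqNgt lt.
  apply: idealM => //; apply/negPn/negP => /minj.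
  have : (l : nat) != i by apply: contra hl => /eqP e; apply/eqP/val_inj.
  by have := ltn_ord l; lia.
- by rewrite (negbTE hi).
- by rewrite (negbTE hj).
Qed.

(** Take a graded ideal maximal among those that contain no power of [f]. *)
Lemma gprime_avoid I f d : gideal I -> f \in gR d ->
  (forall n, f ^+ n \notin I) ->
  exists P, [/\ gprime P, {subset I <= P} & f \notin P].
Proof.
move=> hI hf hn.
pose Q (J : {pred R}) :=
  [/\ gideal J, {subset I <= J} & forall n, f ^+ n \notin J].
have [P [[hP IP nP] Pmax]] : exists P, Q P /\
    forall J, Q J -> {subset P <= J} -> {subset J <= P}.
  by apply: noetherian_max => [J [[]]|] //; exists I; split.
exists P; split=> //; last by have := nP 1%N.
apply: gprime_homogeneous => //; first by have := nP 0%N.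
have pow i a : a \in gR i -> a \notin P -> exists n, f ^+ n \in adjoin P a.
  move=> ha naP; apply: contrapT => h; move/negP: (naP); apply.
  apply: (Pmax (adjoin P a)); last exact: mem_adjoin.
    split; [exact: adjoin_gideal ha| |].
      by move=> x /IP; exact: sub_adjoin.
    by move=> n; apply/negP => hfn; apply: h; exists n.
  exact: sub_adjoin.
move=> i j a b ha hb hab; apply: contrapT => /not_orP [/negP na /negP nb].
have [m /asboolP [u [r [hu em]]]] := pow _ _ ha na.
have [n /asboolP [v [s [hv en]]]] := pow _ _ hb nb.
have hPi := hP.1.
have /negP := nP (m + n)%N; apply; rewrite exprD em en mulrDl.
apply: (idealD hPi); first exact: idealMr.
rewrite mulrDr; apply: (idealD hPi); first exact: idealM.
by rewrite mulrACA; apply: idealM.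
Qed.

Lemma gideal_irrelevant : gideal (irrelevant_ideal gR).
Proof.
split.
  split; first by apply/irrelevantP; rewrite hcomp0.
  move=> a u v /irrelevantP hu /irrelevantP hv; apply/irrelevantP.
  rewrite hcompD hv addr0 -[_ *: _]/(a * u) hcompM big_ord1 /= hu mulr0 //.
move=> x n /irrelevantP hx; apply/irrelevantP; rewrite hcomp_idem.
by case: eqP => // <-.
Qed.

Lemma gprime_irrelevant : gprime (irrelevant_ideal gR).
Proof.
apply: gprime_homogeneous; first exact: gideal_irrelevant.
  apply/negP => /irrelevantP; rewrite hcomp_id ?one_deg0 //.
  by move=> /eqP; rewrite oner_eq0.
move=> i j a b ha hb; case: i ha => [|i] ha; last first.
  by left; apply/irrelevantP; rewrite (hcomp_piece _ _ ha).
case: j hb => [|j] hb; last first.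
  by right; apply/irrelevantP; rewrite (hcomp_piece _ _ hb).
move/std_deg0: ha => [c ->]; have [->|nc] := eqVneq c 0.
  by move=> _; left; rewrite scale0r ideal0 //; case: gideal_irrelevant.
move=> h; right; have := idealZ gideal_irrelevant.1 c^-1 h.
by rewrite -scalerAl mul1r scalerA mulVf // scale1r.
Qed.

End GradedRing.

(** * The points of a reduced graded ring of dimension one *)

Section Points.
Variables (k : closedFieldType) (R : comAlgType k) (gR : nat -> {pred R}).
Hypothesis R_std : standard_graded gR.
Hypothesis R_dim1 : krull_dim R 1.
Hypothesis R_red : reduced R.
Hypothesis k_inf : forall s : seq k, exists c, c \notin s.
Local Notation pr := (hcomp (std_direct R_std)).

(** The points of [Proj R]. *)
Definition relevant (P : {pred R}) :=
  gprime R_std P /\ exists2 y, y \in gR 1%N & y \notin P.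

Lemma sub_deg1 (I : {pred R}) : is_ideal I -> {subset gR 1%N <= I} ->
  forall n x, (0 < n)%N -> x \in gR n -> x \in I.
Proof.
move=> hI h1 n x n0 hx.
suff : x - pr 0%N x \in I by rewrite (hcomp_piece _ _ hx); case: n n0 hx => // n; rewrite subr0.
elim/(std_ind R_std): x {hx n n0} => [c|y hy|u v hu hv|u v hu hv].
- by rewrite hcomp_id ?scalar_deg0 // subrr ideal0.
- by rewrite (hcomp_piece _ _ hy) subr0 h1.
- by rewrite hcompD opprD addrACA idealD.
rewrite hcompM big_ord1 /= -[u * v](subrK (pr 0%N u * v)) -mulrBl -addrA -mulrBr.
by apply: (idealD hI); [exact: idealMr | exact: idealM].
Qed.

(** Otherwise [Q], [Q'] and the irrelevant ideal would form a chain of length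
    two. *)
Lemma relevant_max Q Q' : gprime R_std Q -> relevant Q' -> {subset Q <= Q'} ->
  {subset Q' <= Q}.
Proof.
move=> hQ [hQ' [y hy nyQ']] sub; apply: contrapT => nsub.
have hm := gprime_irrelevant R_std.
have Q'm : {subset Q' <= irrelevant_ideal gR}.
  move=> x hx; apply/(irrelevantP R_std); have [[hI hc] n1 _] := hQ'.
  have := hc x 0%N hx; have /(std_deg0 R_std) [c ->] := hcomp_in (std_direct R_std) 0%N x.
  have [->|nc] := eqVneq c 0; first by rewrite scale0r.
  move=> /(idealZ hI c^-1); rewrite scalerA mulVf // scale1r => h.
  by rewrite h in n1.
have mQ' : ~ {subset irrelevant_ideal gR <= Q'}.
  move=> /(_ y) h; move/negP: nyQ'; apply; apply: h; apply/(irrelevantP R_std).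
  by rewrite (hcomp_piece _ _ hy).
have [_ /(_ 2 (fun i => nth Q [:: Q; Q'; irrelevant_ideal gR] i))] := R_dim1.
suff H : prime_chain (fun i : 'I_3 => nth Q [:: Q; Q'; irrelevant_ideal gR] i).
  by move=> /(_ H).
split.
  have pc P : gprime R_std P -> idealr_closed P /\ prime_idealr_closed P.
    by move=> hP; split; [exact: (gprime_idealr hP) | case: hP].
  by case=> [[|[|[|//]]] /= _]; exact: pc.
case=> [[|[|[|//]]] /= _] [[|[|[|//]]] /= _] //= _; split=> //.
- by move=> x /sub /Q'm.
- by move=> h; apply: mQ' => x /h /sub.
Qed.

(** Noetherian induction: for an ideal [J] without this property and [y] of
    degree one outside [J], the larger ideal [J + (y)] has it, and replacing
    elements of high degree modulo [J] by multiples of [y] as often as the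
    nilpotency of [y] requires carries it over to [J]. *)
Lemma nilpotent_deg1 J : gideal R_std J ->
  (forall y, y \in gR 1%N -> exists n, y ^+ n \in J) ->
  exists N, forall n x, (N <= n)%N -> x \in gR n -> x \in J.
Proof.
move=> hJ0 nil0; apply: contrapT => no0.
pose Q (J : {pred R}) := [/\ gideal R_std J,
  forall y, y \in gR 1%N -> exists n, y ^+ n \in J
  & ~ exists N, forall n x, (N <= n)%N -> x \in gR n -> x \in J].
have [I [[hI nilI noI] Imax]] : exists I, Q I /\
    forall J, Q J -> {subset I <= J} -> {subset J <= I}.
  by apply: (noetherian_max R_std) => [I [[]]|] //; exists J; split.
have [h1|/existsNP [y /not_implyP [hy /negP nyI]]] :=
    pselect (forall y, y \in gR 1%N -> y \in I).
  apply: noI; exists 1%N => n x n0 hx.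
  exact: (sub_deg1 hI.1 h1 n0 hx).
have hA := adjoin_gideal hI hy.
have [N hN] : exists N, forall n x, (N <= n)%N -> x \in gR n -> x \in adjoin I y.
  apply: contrapT => noA; move/negP: nyI; apply.
  apply: (Imax (adjoin I y)); last exact: (mem_adjoin y hI).
    split=> // z /nilI [n hn]; exists n; exact: sub_adjoin.
  exact: sub_adjoin.
have [s hs] := nilI y hy; apply: noI; exists (N + s).+1 => n x hn hx.
have step t : (t <= s)%N -> exists2 x', x' \in gR (n - t)%N & x - y ^+ t * x' \in I.
  elim: t => [|t IH] ht.
    by exists x; rewrite ?subn0 // expr0 mul1r subrr ideal0 //; case: hI.
  have [x' hx' hxx'] := IH (ltnW ht).
  have /asboolP [u [b [hu ex']]] : x' \in adjoin I y.
    by apply: hN hx'; lia.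
  have nt : (n - t = 1 + (n - t.+1))%N by lia.
  exists (pr (n - t.+1)%N b); first exact: hcomp_in.
  have -> : x - y ^+ t.+1 * pr (n - t.+1)%N b =
            (x - y ^+ t * x') + y ^+ t * pr (n - t)%N u.
    rewrite -[x' in RHS](hcomp_id (std_direct R_std) hx') [in RHS]ex' hcompD [b * y]mulrC.
    rewrite [in pr _ (y * b)]nt (hcompMl R_std _ _ hy) exprSr.
    by rewrite mulrDr mulrA opprD -!addrA; congr (_ + _); rewrite addrC addrAC subrK.
  by apply: (idealD hI.1) => //; apply: (idealM hI.1); exact: hI.2.
have [x' _ hx'] := step s (leqnn s).
by rewrite -[x](subrK (y ^+ s * x')) (idealD hI.1) ?(idealMr hI.1).
Qed.

(** The components of degree [N] of finitely many generators of the ideal of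
    all elements without components of lower degree. *)
Lemma finite_span N : exists q (s : 'I_q -> R),
  (forall i, s i \in gR N) /\
  forall x, x \in gR N -> exists c : 'I_q -> k, x = \sum_i c i *: s i.
Proof.
pose I : {pred R} := fun x => `[< ord_ge R_std N x >].
have hI : is_ideal I.
  split; first by apply/asboolP => n _; rewrite hcomp0.
  move=> a u v /asboolP hu /asboolP hv; apply/asboolP => n hn.
  rewrite hcompD hv // addr0.
  by apply: (ord_geM (m := 0%N) _ hu hn) => m; rewrite ltn0.
have [t ht] := std_noetherian R_std hI.
exists (size t), (fun i => pr N t`_i); split=> [i|x hx]; first exact: hcomp_in.
have : x \in I.
  apply/asboolP => n hn; rewrite (hcomp_piece _ _ hx).
  by case: eqP => // e; rewrite e ltnn in hn.
rewrite ht => /asboolP [c ex].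
have cP (i : 'I_(size t)) : exists a : k, pr 0%N (c i) = a%:A.
  by apply/(std_deg0 R_std); exact: hcomp_in.
exists (fun i => sval (cid (cP i))).
rewrite -[LHS](hcomp_id (std_direct R_std) hx) ex hcomp_bigsum.
apply: eq_bigr => i _; case: cid => a /= ea.
rewrite -[c i *: _]/(c i * _) hcompM big_ord_recl /= subn0 ea big1 ?addr0.
  by rewrite -scalerAl mul1r.
move=> j _; suff /asboolP h : t`_i \in I.
  by rewrite h ?mulr0 // /bump /=; have := ltn_ord j; lia.
rewrite ht; apply/asboolP; exists (fun j => (j == i)%:R).
by rewrite (bigD1 i) //= eqxx scale1r big1 ?addr0 // => l /negbTE ->; rewrite scale0r.
Qed.

(** The quotient by a relevant prime [P] is a polynomial ring in one variable.
    If no [y - c x] were in [P], dimension one would make all of [R_1]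
    nilpotent modulo [P + (x)], so that multiplication by [x] maps
    [(R/P)_N] onto [(R/P)_(N+1)] for large [N].  An eigenvalue [c] of the
    endomorphism [x^-1 y] of the finite-dimensional space [(R/P)_N] then
    satisfies [(y - c x) v = 0] in [R/P] for some nonzero [v]. *)
Lemma relevant_line P x y : relevant P -> x \in gR 1%N -> x \notin P ->
  y \in gR 1%N -> exists c : k, y - c *: x \in P.
Proof.
move=> hP hx nx hy; have hPp := hP.1; have hPg : gideal R_std P by case: hPp.
have hPi := hPg.1.
apply: contrapT => hno; have hA := adjoin_gideal hPg hx.
have nil z : z \in gR 1%N -> exists n, z ^+ n \in adjoin P x.
  move=> hz; apply: contrapT => h.
  have h' n : z ^+ n \notin adjoin P x by apply/negP => hn; apply: h; exists n.
  have [P' [hP' sub nz]] := gprime_avoid hA hz h'.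
  move/negP: nx; apply; apply: (relevant_max hPp (Q' := P')).
  - by split=> //; exists z.
  - by move=> u /(sub_adjoin x) /sub.
  - by apply: sub; exact: (mem_adjoin x hPg).
have [N hN] := nilpotent_deg1 hA nil.
have div z : z \in gR N.+1 -> exists2 w, w \in gR N & z - x * w \in P.
  move=> hz; have /asboolP [u [b [hu ez]]] := hN _ _ (leqnSn N) hz.
  exists (pr N b); first exact: hcomp_in.
  rewrite -[z](hcomp_id (std_direct R_std) hz) ez hcompD [b * x]mulrC -add1n.
  by rewrite (hcompMl R_std _ _ hx) addrK; exact: hPg.2.
(* a spanning family of (R/P)_N of minimal length is a basis *)
pose spans q := exists s : 'I_q -> R, (forall i, s i \in gR N) /\
  forall z, z \in gR N -> exists c : 'I_q -> k, z - \sum_i c i *: s i \in P.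
have : exists q, `[< spans q >].
  have [q [s [hs sp]]] := finite_span N; exists q; apply/asboolP; exists s.
  by split=> // z /sp [c ->]; exists c; rewrite subrr ideal0.
case/ex_minnP => q /asboolP [s [hs sp]] qmin.
case: q s hs sp qmin => [|q] s hs sp qmin.
  have [c] := sp _ (std_exp1 R_std N hx); rewrite big_ord0 subr0.
  by move=> /(gprime_exp hPp); apply/negP.
have mx (i : 'I_q.+1) : exists a : 'I_q.+1 -> k,
    y * s i - x * \sum_j a j *: s j \in P.
  have hys : y * s i \in gR N.+1 by rewrite -add1n (std_mul R_std).
  have [w hw hzw] := div _ hys; have [a ha] := sp w hw; exists a.
  rewrite -[_ - _](subrKA (x * w)) idealD // -mulrBr; exact: idealM.
pose A : 'M[k]_q.+1 := \matrix_(i, j) sval (cid (mx i)) j.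
have [c rc] : exists c, root (char_poly A) c.
  by apply/closed_rootP; rewrite size_char_poly.
move: rc; rewrite -eigenvalue_root_char => /eigenvalueP [u eu nu].
pose v := \sum_i u 0 i *: s i.
have hv : (y - c *: x) * v \in P.
  have -> : (y - c *: x) * v =
      \sum_i u 0 i *: (y * s i - x * \sum_j A i j *: s j).
    rewrite mulrBl; under [in RHS]eq_bigr do rewrite scalerBr.
    rewrite sumrB; congr (_ - _).
      by rewrite mulr_sumr; apply: eq_bigr => i _; rewrite scalerAr.
    under eq_bigr do rewrite scalerAr scaler_sumr.
    rewrite -mulr_sumr exchange_big /= -scalerAl scalerAr; congr (_ * _).
    rewrite scaler_sumr; apply: eq_bigr => j _.
    under [in RHS]eq_bigr do rewrite scalerA.
    rewrite -scaler_suml scalerA; congr (_ *: _).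
    by have := congr1 (fun M : 'rV[k]_q.+1 => M 0 j) eu; rewrite !mxE => ->.
  apply: ideal_sum => // i _; apply: idealZ => //.
  have := svalP (cid (mx i)); congr (_ \in P); congr (_ - x * _).
  by apply: eq_bigr => j _; rewrite mxE.
case: (gprimeM hPp hv) => [h|vP]; first by apply: hno; exists c.
have [i0 ui0] : exists i0, u 0 i0 != 0.
  apply: contrapT => h; move/negP: nu; apply; apply/eqP/rowP => i.
  rewrite mxE; apply/eqP/negPn/negP => hi; by apply: h; exists i.
have : (q.+1 <= q)%N; last by rewrite ltnn.
apply: qmin; apply/asboolP; exists (fun j => s (lift i0 j)); split=> // z hz.
have [a ha] := sp z hz; pose b := a i0 / u 0 i0.
exists (fun j => a (lift i0 j) - b * u 0 (lift i0 j)).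
have := idealD hPi ha (idealZ hPi b vP); congr (_ \in P).
rewrite /v scaler_sumr (bigD1_ord i0) //= [X in _ + X](bigD1_ord i0) //=.
under [in RHS]eq_bigr do rewrite scalerBl -scalerA.
by rewrite sumrB scalerA divfK //; ring.
Qed.

Let zero_ideal : {pred R} := fun x => x == 0.

Let zero_gideal : gideal R_std zero_ideal.
Proof.
split; last by move=> x n /eqP ->; rewrite hcomp0 unfold_in.
split; first by rewrite unfold_in.
by move=> a u v /eqP -> /eqP ->; rewrite scaler0 addr0 unfold_in.
Qed.

(** If no finite list covered the relevant primes over the zero ideal, consider
    a maximal graded ideal with that defect: it is prime by maximality, but then
    no relevant prime other than itself contains it. *)
Lemma relevant_finite : exists n (Ps : nat -> {pred R}),
  forall Q, relevant Q -> exists2 i, (i < n)%N & Ps i =i Q.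
Proof.
pose fin (I : {pred R}) := exists n (Ps : nat -> {pred R}),
  forall Q, relevant Q -> {subset I <= Q} -> exists2 i, (i < n)%N & Ps i =i Q.
suff [n [Ps h]] : fin (zero_ideal).
  exists n, Ps => Q hQ; apply: h => // x /eqP ->.
  by apply: ideal0; exact: gprime_ideal hQ.1.
apply: contrapT => nfin.
have [I [[hI nI] Imax]] : exists I, (gideal R_std I /\ ~ fin I) /\
    forall J, gideal R_std J /\ ~ fin J -> {subset I <= J} -> {subset J <= I}.
  by apply: (noetherian_max R_std) => [I [[]]|] //; exists (zero_ideal).
apply: nI.
case h1: (1 \in I).
  exists 0%N, (fun _ => zero_ideal) => Q [hQ _] /(_ 1 h1) hQ1.
  by case: hQ => _; rewrite hQ1.
have [hP|nP] := pselect (gprime R_std I).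
  exists 1%N, (fun _ => I) => Q hQ IQ; exists 0%N => // x.
  by apply/idP/idP; [exact: IQ | exact: (relevant_max hP hQ IQ)].
have [i [j [a [b [ha hb hab nab]]]]] : exists i j a b,
    [/\ a \in gR i, b \in gR j, a * b \in I & ~ (a \in I \/ b \in I)].
  apply: contrapT => h; apply: nP; apply: gprime_homogeneous => //.
    by rewrite h1.
  move=> i j a b ha hb hab; apply: contrapT => nab.
  by apply: h; exists i, j, a, b.
have adj d c : c \in gR d -> c \notin I -> fin (adjoin I c).
  move=> hc nc; apply: contrapT => nf; move/negP: nc; apply.
  apply: (Imax (adjoin I c)); last exact: (mem_adjoin c hI).
    by split=> //; exact: (adjoin_gideal hI hc).
  exact: sub_adjoin.
case/not_orP: nab => /negP na /negP nb.
have [m [Ps hPs]] := adj _ _ ha na; have [n [Qs hQs]] := adj _ _ hb nb.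
exists (m + n)%N, (fun i => if (i < m)%N then Ps i else Qs (i - m)%N) => Q hQ IQ.
have hQi := gprime_ideal hQ.1.
have sub c : c \in Q -> {subset adjoin I c <= Q}.
  move=> hc x /asboolP [u [r [hu ->]]].
  by apply: (idealD hQi); [exact: IQ | exact: (idealM hQi)].
case: (gprimeM hQ.1 (IQ _ hab)) => [/sub/(hPs Q hQ) | /sub/(hQs Q hQ)] [l hl el].
  by exists l; [exact: ltn_addr | rewrite hl].
exists (m + l)%N; first by rewrite ltn_add2l.
by rewrite ltnNge leq_addr /= addKn.
Qed.

(** In a covering list of minimal length all members are relevant, and no two
    are comparable. *)
Lemma relevant_list : exists e (P : 'I_e -> {pred R}),
  [/\ forall i, relevant (P i),
      forall i j, i != j -> ~ {subset P i <= P j}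
    & forall Q, relevant Q -> exists i, P i =i Q].
Proof.
pose cov e := exists P : 'I_e -> {pred R},
  forall Q, relevant Q -> exists i, P i =i Q.
have : exists e, `[< cov e >].
  have [n [Ps h]] := relevant_finite; exists n; apply/asboolP.
  exists (fun i => Ps i) => Q /h [i hi ei]; by exists (Ordinal hi).
case/ex_minnP => e /asboolP [P hP] emin; exists e, P.
have drop (i : 'I_e) : (forall Q, relevant Q -> exists2 j, j != i & P j =i Q) -> False.
  case: e P hP emin i => [|e] P hP emin i h; first by case: i h.
  have : (e.+1 <= e)%N; last by rewrite ltnn.
  apply: emin; apply/asboolP; exists (fun j => P (lift i j)) => Q /h [j nj ej].
  by have := nj; rewrite eq_sym => /unlift_some [l el _]; exists l; rewrite -el.
have rel i : relevant (P i).
  apply: contrapT => ni; apply: (drop i) => Q hQ; have [j ej] := hP Q hQ.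
  exists j => //; apply/eqP => eji; apply: ni; rewrite -eji.
  suff -> : P j = Q by [].
  by apply: funext => x; exact: ej.
split=> // i j nij sub; apply: (drop j) => Q hQ; have [l el] := hP Q hQ.
have [elj|nlj] := eqVneq l j; last by exists l.
exists i => // x; rewrite -el elj.
apply/idP/idP; first exact: sub.
exact: (relevant_max (rel i).1 (rel j) sub).
Qed.

(** Some component of positive degree is nonzero.  It is not nilpotent since
    [R] is reduced, so that a homogeneous prime avoids it, which is then
    relevant. *)
Lemma relevant_separates x : x != 0 -> (forall c : k, x != c%:A) ->
  exists2 P, relevant P & x \notin P.
Proof.
move=> nx0 nxc.
have [n n0 nxn] : exists2 n, (0 < n)%N & pr n x != 0.
  apply: contrapT => h; have := hcomp_in (std_direct R_std) 0%N x.
  move=> /(std_deg0 R_std) [c ec]; have /eqP := nxc c; apply; rewrite -ec.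
  apply: hcomp_single => j nj; apply/eqP/negPn/negP => hj; apply: h.
  by exists j; rewrite ?lt0n.
have zid := zero_gideal.
have hn := hcomp_in (std_direct R_std) n x.
have [|P [hP _ nP]] := gprime_avoid zid hn.
  by move=> m; apply: contra nxn => /eqP /R_red ->.
exists P; last by apply: contra nP; case: hP => [[_ +] _ _]; exact.
split=> //; apply: contrapT => h; move/negP: nP; apply.
apply: (sub_deg1 (gprime_ideal hP) _ n0 hn) => y hy.
by apply/negPn/negP => ny; apply: h; exists y.
Qed.

(** Otherwise [R] would be the field [k], of dimension zero. *)
Lemma relevant_exists : exists P, relevant P.
Proof.
apply: contrapT => h.
have triv (x : R) : exists c : k, x = c%:A.
  have [->|nx] := eqVneq x 0; first by exists 0; rewrite scale0r.
  apply: contrapT => hx; have [||P hP _] := @relevant_separates x; last by apply: h; exists P.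
    by [].
  by move=> c; apply/eqP => ex; apply: hx; exists c.
have [[p [hp1 hp2]] _] := R_dim1.
have [_ nsub] := hp2 ord0 ord_max isT; apply: nsub => x hx.
have [[h0 h1 hD] _] := hp1 ord_max; have [[h0' _ _] _] := hp1 ord0.
have [c ex] := triv x; have [c0|nc] := eqVneq c 0.
  by rewrite ex c0 scale0r.
move/negP: h1; case; have := hD (c^-1)%:A x 0 hx h0.
by rewrite addr0 ex -scalerAl mul1r scalerA mulVf // scale1r.
Qed.

(** [k] being infinite, a vector space is not a finite union of proper
    subspaces. *)
Lemma linear_form_avoiding n (P : nat -> {pred R}) :
  (forall i, (i < n)%N -> relevant (P i)) ->
  exists2 l, l \in gR 1%N & forall i, (i < n)%N -> l \notin P i.
Proof.
elim: n => [|n IH] hP.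
  by exists 0 => //; exact: piece0 (std_direct R_std) _.
have [|l hl nl] := IH; first by move=> i hi; apply: hP; exact: ltnW.
have [_ [y hy ny]] := hP n (ltnSn n).
have bad i : exists c0 : k, (i <= n)%N ->
    forall c, l + c *: y \in P i -> c = c0.
  have [[le [c0 hc0]]|h] := pselect ((i <= n)%N /\ exists c, l + c *: y \in P i); last first.
    by exists 0 => le c hc; case: h; split=> //; exists c.
  exists c0 => _ c hc; have hPi := gprime_ideal (hP i le).1.
  apply/eqP; rewrite -subr_eq0; apply/negPn/negP => ncc.
  have := idealZ hPi (c - c0)^-1 (idealB hPi hc hc0).
  rewrite opprD addrACA subrr add0r -scalerBl scalerA mulVf // scale1r => hyi.
  have hli : l \in P i by rewrite -[l](addrK (c *: y)) idealB ?idealZ.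
  move: le; rewrite leq_eqVlt => /orP [/eqP ei|lt].
    by rewrite -ei hyi in ny.
  by have := nl i lt; rewrite hli.
have [c hc] := k_inf [seq sval (cid (bad i)) | i <- iota 0 n.+1].
exists (l + c *: y).
  by apply: (pieceD (std_direct R_std)) => //; exact: std_scale.
move=> i hi; apply: contra hc => hc; apply/mapP; exists i.
  by rewrite mem_iota.
exact: (svalP (cid (bad i)) _ _ hc).
Qed.

(** By [relevant_line] every form of degree [d] is congruent to a scalar multiple
    of [l ^+ d]; these scalars are the coefficients of [rho r]. *)
Lemma relevant_hom P l : relevant P -> l \in gR 1%N -> l \notin P ->
  exists rho : {rmorphism R -> {poly k}},
    [/\ rho l = 'X, forall c : k, rho c%:A = c%:P,
        forall d r, r \in gR d -> exists c, rho r = c *: 'X^d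
      & forall r, (rho r == 0) = (r \in P)].
Proof.
move=> hP hl nl; have [hPg _ _] := hP.1; have hPi := hPg.1.
have ex r d : exists c, pr d r - c *: l ^+ d \in P.
  elim/(std_ind R_std): r d => [c|y hy|u v hu hv|u v hu hv] d.
  - have := hcomp_piece (std_direct R_std) d (scalar_deg0 R_std c).
    case: d => [|d] ->; last by exists 0; rewrite scale0r subrr ideal0.
    by exists c; rewrite eqxx expr0 subrr ideal0.
  - have := hcomp_piece (std_direct R_std) d hy; case: eqP => [->|_] ->.
      have [c hc] := relevant_line hP hl nl hy; exists c.
      by rewrite expr1.
    by exists 0; rewrite scale0r subrr ideal0.
  - have [a ha] := hu d; have [b hb] := hv d; exists (a + b).
    by rewrite hcompD scalerDl opprD addrACA idealD.
  exists (\sum_(i < d.+1) sval (cid (hu i)) * sval (cid (hv (d - i)%N))).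
  rewrite hcompM scaler_suml -sumrB; apply: ideal_sum => // i _.
  case: cid => a /= ha; case: cid => b /= hb.
  have -> : (a * b) *: l ^+ d = (a *: l ^+ i) * (b *: l ^+ (d - i)).
    rewrite -scalerAl -scalerAr scalerA -exprD subnKC //.
    by have := ltn_ord i; rewrite ltnS.
  rewrite -[pr i u * pr (d - i)%N v](subrK (a *: l ^+ i * pr (d - i)%N v)).
  rewrite -mulrBl -addrA -mulrBr.
  by apply: (idealD hPi); [exact: (idealMr hPi) | exact: (idealM hPi)].
have uniq r d c c' : pr d r - c *: l ^+ d \in P -> pr d r - c' *: l ^+ d \in P -> c = c'.
  move=> hc hc'; apply/eqP; rewrite -subr_eq0; apply/negPn/negP => nc.
  have e : pr d r - c' *: l ^+ d - (pr d r - c *: l ^+ d) = (c - c') *: l ^+ d.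
    by rewrite scalerBl; ring.
  have := idealZ hPi (c - c')^-1 (idealB hPi hc' hc).
  rewrite e scalerA mulVf // scale1r.
  by move=> /(gprime_exp hP.1); apply/negP.
pose cf r d := sval (cid (ex r d)).
have cfP r d : pr d r - cf r d *: l ^+ d \in P by exact: (svalP (cid (ex r d))).
have cfE r d c : pr d r - c *: l ^+ d \in P -> cf r d = c.
  by move=> h; apply: uniq h.
have bd r : exists N, forall n, (N <= n)%N -> cf r n = 0.
  have [N hN] := hcomp_bounded R_std r; exists N => n hn; apply: cfE.
  by rewrite hN // scale0r subrr ideal0.
pose f r := \poly_(d < sval (cid (bd r))) cf r d.
have fE r d : (f r)`_d = cf r d.
  rewrite coef_poly; case: ltnP => // h; symmetry.
  exact: (svalP (cid (bd r))).
have fB : zmod_morphism f.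
  move=> u v; apply/polyP => d; rewrite coefB !fE; apply: cfE.
  by rewrite hcompB scalerBl opprD addrACA -opprD idealB.
have fC c : f c%:A = c%:P.
  apply/polyP => d; rewrite fE coefC; apply: cfE.
  rewrite (hcomp_piece _ _ (scalar_deg0 R_std c)).
  by case: eqP => [->|_]; rewrite ?expr0 ?scale0r subrr ideal0.
have fM : monoid_morphism f.
  split; first by rewrite -[1]scale1r fC.
  move=> u v; apply/polyP => d; rewrite fE coefM; apply: cfE.
  rewrite hcompM scaler_suml -sumrB; apply: ideal_sum => // i _.
  rewrite !fE.
  have -> : (cf u i * cf v (d - i)%N) *: l ^+ d =
            (cf u i *: l ^+ i) * (cf v (d - i)%N *: l ^+ (d - i)).
    rewrite -scalerAl -scalerAr scalerA -exprD subnKC //.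
    by have := ltn_ord i; rewrite ltnS.
  rewrite -[pr i u * pr (d - i)%N v](subrK (cf u i *: l ^+ i * pr (d - i)%N v)).
  rewrite -mulrBl -addrA -mulrBr.
  by apply: (idealD hPi); [exact: (idealMr hPi) | exact: (idealM hPi)].
pose rho : {rmorphism R -> {poly k}} := HB.pack f
  (GRing.isZmodMorphism.Build _ _ f fB) (GRing.isMonoidMorphism.Build _ _ f fM).
have rhoE r d : (rho r)`_d = cf r d by exact: fE.
exists rho; split=> [|//|d r hr|r].
- apply/polyP => d; rewrite rhoE coefX; apply: cfE.
  rewrite (hcomp_piece _ _ hl); case: eqP => [->|_].
    by rewrite expr1 scale1r subrr ideal0.
  by rewrite scale0r subrr ideal0.
- exists (cf r d); apply/polyP => n; rewrite rhoE coefZ coefXn.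
  have [->|ne] := eqVneq n d; first by rewrite mulr1.
  rewrite mulr0; apply: cfE.
  by rewrite (hcomp_piece _ _ hr) (negbTE ne) scale0r subrr ideal0.
apply/eqP/idP => [h|h].
  apply: (@hcomp_ind _ _ _ (std_direct R_std) (fun x => x \in P) r).
  - exact: ideal0.
  - exact: idealD.
  by move=> d; have := cfP r d; rewrite -rhoE h coef0 scale0r subr0.
apply/polyP => d; rewrite rhoE coef0; apply: cfE.
by rewrite scale0r subr0; exact: hPg.2.
Qed.

(** Coordinates on [R]: it is embedded as a graded subring into a finite
    product of copies of [k[X]], one for each point of [Proj R].  The points
    are distinct already on [R_1], and the linear form [l] vanishes at none of
    them. *)
Record coordinates e (rho : 'I_e -> {rmorphism R -> {poly k}}) (l : R) : Prop := {
  coord_l1 : l \in gR 1%N;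
  coord_l : forall i, rho i l = 'X;
  coordC : forall i (c : k), rho i c%:A = c%:P;
  coord_homog : forall i d r, r \in gR d -> exists c, rho i r = c *: 'X^d;
  coord_inj : forall r, (forall i, rho i r = 0) -> r = 0;
  coord_sep : forall i j, i != j -> exists2 y, y \in gR 1%N & rho i y != rho j y
}.

Theorem coordinates_exist : exists e (rho : 'I_e -> {rmorphism R -> {poly k}}) l,
  (0 < e)%N /\ coordinates rho l.
Proof.
have [e [P [hrel hinc hcov]]] := relevant_list.
have [Q /hcov [i0 _]] := relevant_exists.
have e0 : (0 < e)%N by case: e i0 {P hrel hinc hcov} => [[]|].
pose P' n : {pred R} := P (insubd i0 n).
have [l hl nl'] : exists2 l, l \in gR 1%N & forall i, (i < e)%N -> l \notin P' i.
  by apply: linear_form_avoiding => i _; exact: hrel.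
have nl i : l \notin P i.
  by have := nl' i (ltn_ord i); rewrite /P' valKd.
have hom i := cid (relevant_hom (hrel i) hl (nl i)).
pose rho i := sval (hom i).
have H i := svalP (hom i); rewrite -/(rho _) in H.
exists e, rho, l; split=> //; split.
- exact: hl.
- by move=> i; case: (H i).
- by move=> i; case: (H i).
- by move=> i; case: (H i).
- move=> r hr; apply/eqP/negPn/negP => nr.
  have [c|Q' hQ' nQ'] := relevant_separates nr.
    apply/eqP => ec; have := hr i0; rewrite ec; case: (H i0) => _ -> _ _.
    move=> /eqP; rewrite polyC_eq0 => /eqP c0.
    by rewrite ec c0 scale0r eqxx in nr.
  have [j ej] := hcov _ hQ'; case: (H j) => _ _ _ hj.
  by move/negP: nQ'; apply; rewrite -ej -hj; apply/eqP; exact: hr.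
move=> i j nij; apply: contrapT => h.
have eq1 y : y \in gR 1%N -> rho i y = rho j y.
  by move=> hy; apply/eqP/negPn/negP => ny; apply: h; exists y.
have eqr r : rho i r = rho j r.
  elim/(std_ind R_std): r => [c|y hy|u v hu hv|u v hu hv].
  - case: (H i) => _ hi _ _; case: (H j) => _ hj _ _. by rewrite hi hj.
  - exact: eq1.
  - by rewrite !rmorphD hu hv.
  - by rewrite !rmorphM hu hv.
apply: (hinc i j nij) => r; case: (H i) => _ _ _ <-; case: (H j) => _ _ _ <-.
by rewrite eqr.
Qed.

End Points.

(** * Working with coordinates *)

Section Coordinates.
Variables (k : closedFieldType) (R : comAlgType k) (gR : nat -> {pred R}).
Hypothesis R_std : standard_graded gR.
Variables (e : nat) (rho : 'I_e -> {rmorphism R -> {poly k}}) (l : R).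
Hypothesis Hrho : coordinates gR rho l.

(** Evaluation at the [i]-th point, in the affine chart where [l] is [1]. *)
Definition ev (i : 'I_e) (r : R) : k := (rho i r).[1].

Lemma evD i u v : ev i (u + v) = ev i u + ev i v.
Proof. by rewrite /ev rmorphD hornerD. Qed.
Lemma evM i u v : ev i (u * v) = ev i u * ev i v.
Proof. by rewrite /ev rmorphM hornerM. Qed.
Lemma evN i u : ev i (- u) = - ev i u.
Proof. by rewrite /ev rmorphN hornerN. Qed.
Lemma ev0 i : ev i 0 = 0.
Proof. by rewrite /ev rmorph0 horner0. Qed.
Lemma ev1 i : ev i 1 = 1.
Proof. by rewrite /ev rmorph1 hornerC. Qed.
Lemma evC i (c : k) : ev i c%:A = c.
Proof. by rewrite /ev (coordC Hrho) hornerC. Qed.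
Lemma evZ i (c : k) u : ev i (c *: u) = c * ev i u.
Proof. by rewrite -[u in LHS]mul1r scalerAl evM evC. Qed.
Lemma ev_l i : ev i l = 1.
Proof. by rewrite /ev (coord_l Hrho) hornerX. Qed.
Lemma evX i u n : ev i (u ^+ n) = ev i u ^+ n.
Proof. by rewrite /ev rmorphXn horner_exp. Qed.
Lemma ev_lX i n : ev i (l ^+ n) = 1.
Proof. by rewrite evX ev_l expr1n. Qed.
Lemma ev_sum i (J : Type) (s : seq J) (P : pred J) (F : J -> R) :
  ev i (\sum_(j <- s | P j) F j) = \sum_(j <- s | P j) ev i (F j).
Proof. exact: (big_morph _ (evD i) (ev0 i)). Qed.
Lemma ev_prod i (J : Type) (s : seq J) (P : pred J) (F : J -> R) :
  ev i (\prod_(j <- s | P j) F j) = \prod_(j <- s | P j) ev i (F j).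
Proof. exact: (big_morph _ (evM i) (ev1 i)). Qed.
Definition evE := (evD, evN, evM, evZ, evC, ev0, ev1, ev_lX, ev_l).

Lemma rho_homog i d r : r \in gR d -> rho i r = ev i r *: 'X^d.
Proof.
move=> /(coord_homog Hrho i) [c er].
by rewrite /ev er hornerZ hornerXn expr1n mulr1.
Qed.

Lemma lX_deg n : l ^+ n \in gR n.
Proof. exact: (std_exp1 R_std n (coord_l1 Hrho)). Qed.

Lemma mul_lX_deg d n x : x \in gR d -> l ^+ n * x \in gR (n + d)%N.
Proof. by move=> hx; rewrite (std_mul R_std) ?lX_deg. Qed.

Lemma ev_inj d r s : r \in gR d -> s \in gR d ->
  (forall i, ev i r = ev i s) -> r = s.
Proof.
move=> hr hs h; apply/subr0_eq/(coord_inj Hrho) => i.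
by rewrite rmorphB (rho_homog i hr) (rho_homog i hs) h subrr.
Qed.

(** The [i]-th form is a product of linear forms, each of which vanishes at one
    of the other points. *)
Lemma separators n (sigma : 'I_n -> 'I_e) : injective sigma ->
  exists r : 'I_n -> R, (forall i, r i \in gR n.-1) /\
    forall i j, ev (sigma j) (r i) = (j == i)%:R.
Proof.
move=> sinj.
have sep i j : exists f, j != i ->
    [/\ f \in gR 1%N, ev (sigma i) f = 1 & ev (sigma j) f = 0].
  have [->|nji] := eqVneq j i; first by exists 0.
  have [|y hy ny] := @coord_sep _ _ _ _ _ _ Hrho (sigma i) (sigma j).
    by rewrite (inj_eq sinj) eq_sym.
  pose c := ev (sigma i) y - ev (sigma j) y.
  have nc : c != 0.
    rewrite subr_eq0; apply: contra ny => /eqP h.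
    by rewrite (rho_homog _ hy) (rho_homog (sigma j) hy) h.
  exists (c^-1 *: (y - ev (sigma j) y *: l)) => _; split.
  - apply: (std_scale R_std _); apply: (pieceB (std_direct R_std)) => //.
    exact: (std_scale R_std _ (coord_l1 Hrho)).
  - by rewrite !evE mulr1 mulVf.
  - by rewrite !evE mulr1 subrr mulr0.
pose f i j := sval (cid (sep i j)).
have fP i j : j != i ->
    [/\ f i j \in gR 1%N, ev (sigma i) (f i j) = 1 & ev (sigma j) (f i j) = 0].
  exact: (svalP (cid (sep i j))).
exists (fun i => \prod_(j | j != i) f i j); split=> [i|i j].
  have -> : n.-1 = #|[pred j | j != i]|.
    have := cardC (pred1 i); rewrite card1 card_ord add1n => en.
    by rewrite -[n in LHS]en /=; apply: eq_card => j; rewrite !inE.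
  have -> : \prod_(j | j != i) f i j = \prod_(j | j != i) (if j == i then l else f i j).
    by apply: eq_bigr => j /negbTE ->.
  apply: (std_prod R_std) => j; case: eqVneq => [_|/fP [] //].
  exact: coord_l1 Hrho.
rewrite ev_prod; case: eqVneq => [->|nji].
  by rewrite big1 // => l' /fP [].
by rewrite (bigD1 j) //=; have [_ _ ->] := fP _ _ nji; rewrite mul0r.
Qed.

End Coordinates.

(** * Graded modules *)

Local Notation piece M := (@gm_piece _ _ _ M).

Section GradedModules.
Variables (k : closedFieldType) (R : comAlgType k) (gR : nat -> {pred R}).
Hypothesis R_std : standard_graded gR.
Variable M : graded_module gR.

Lemma gm_direct : direct_sum (piece M).
Proof. by case: (gm_axiom M). Qed.

Local Notation co := (hcomp gm_direct).

Lemma gm_scale d j r v : r \in gR d -> v \in piece M j ->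
  r *: v \in piece M (d%:Z + j).
Proof. by case: (gm_axiom M) => _; apply. Qed.

Lemma co_scale d n r v : r \in gR d -> co (d%:Z + n) (r *: v) = r *: co n v.
Proof.
move=> hr; apply: (hcomp_shift gm_direct (T := fun v => r *: v) (sigma := +%R d%:Z)).
- by move=> u w; rewrite scalerDr.
- exact: addrI.
- by move=> i u; exact: gm_scale.
Qed.

Lemma gm_scaleC j (c : k) v : v \in piece M j ->
  (c%:A : R) *: v \in piece M j.
Proof.
by move=> hv; rewrite -[j]add0r; apply: (gm_scale (scalar_deg0 R_std c)).
Qed.

Lemma co_bounded v : exists N : nat, forall i : int, (N < `|i|)%N -> co i v = 0.
Proof.
have [s [_ _ h]] := hcomp_sum gm_direct v.
exists (\max_(i <- s) `|i|)%N => i hi; apply: h; apply/negP => hs.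
by move: hi; rewrite ltnNge leq_bigmax_seq.
Qed.

Lemma graded_submodule_by_components (Z : int -> M -> Prop) :
  (forall n, Z n 0) -> (forall n u v, Z n u -> Z n v -> Z n (u + v)) ->
  (forall n d r v, r \in gR d -> v \in piece M n -> Z n v ->
     Z (d%:Z + n) (r *: v)) ->
  graded_submodule (fun v : M => `[< forall n, Z n (co n v) >]).
Proof.
move=> Z0 ZD ZM; split.
  split; first by apply/asboolP => n; rewrite hcomp0.
  move=> a u v /asboolP hu /asboolP hv; apply/asboolP => n.
  rewrite hcompD; apply: (ZD) => //.
  have [N hN] := hcomp_bounded R_std a; rewrite (hcomp_sum_lt hN) scaler_suml.
  rewrite hcomp_bigsum; apply: (big_ind (Z n)) => // [u' w'|d _]; first exact: ZD.
  have hd := hcomp_in (std_direct R_std) d a.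
  rewrite -[n](addrNK d%:Z) addrC (co_scale _ _ hd).
  by apply: ZM => //; exact: hcomp_in.
move=> v f /asboolP hv hf i; apply/asboolP => n.
rewrite (decompE gm_direct hf) hcomp_idem; case: eqP => [->|] //.
Qed.

Variable l : R.
Hypothesis l1 : l \in gR 1%N.
Hypothesis l_inj : forall v : M, l *: v = 0 -> v = 0.

Lemma lX_inj n (v : M) : l ^+ n *: v = 0 -> v = 0.
Proof.
elim: n => [|n IH]; first by rewrite expr0 scale1r.
by rewrite exprS -scalerA => /l_inj.
Qed.

Lemma lX_inj2 n (u v : M) : l ^+ n *: u = l ^+ n *: v -> u = v.
Proof.
by move=> h; apply/subr0_eq/(lX_inj (n := n)); rewrite scalerBr h subrr.
Qed.

(** No nonzero homogeneous element vanishes in [M / (l - 1) M], since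
    [(l - 1) m] has a lowest and a highest component. *)
Lemma homogeneous_dehomogenize n x m : x \in piece M n ->
  x = l *: m - m -> x = 0.
Proof.
move=> hx ex.
(* in degrees other than n, the components of l * m and of m agree *)
have step i : i != n -> l *: co (i - 1) m = co i m.
  move=> ni; apply/subr0_eq.
  have ei : 1%:Z + (i - 1) = i by rewrite addrC subrK.
  rewrite -(co_scale _ _ l1) ei -hcompB -ex.
  by rewrite (hcomp_piece _ _ hx) (negbTE ni).
have step' i (a : nat) : (forall b : nat, (0 < b <= a)%N -> i + b%:Z != n) ->
    l ^+ a *: co i m = co (i + a%:Z) m.
  elim: a => [|a IH] h; first by rewrite expr0 scale1r addr0.
  rewrite exprS -scalerA IH => [|b hb]; last by apply: h; lia.
  by rewrite -(step (i + a.+1%:Z)) ?h //; [congr (_ *: co _ m); lia | lia].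
have [N hN] := co_bounded m.
suff m0 : m = 0 by rewrite ex m0 scaler0 subrr.
apply: (hcomp_eq0 (hg := gm_direct)) => i; have [lt|ge] := boolP ((i : int) < n).
  pose a := (N + `|i|).+1; have -> : i = (i - a%:Z) + a%:Z by rewrite subrK.
  rewrite -step' => [|b hb]; last by lia.
  by rewrite hN ?scaler0 //; lia.
pose a := (N + `|i|).+1; apply: (lX_inj (n := a)).
rewrite step' => [|b hb]; last by lia.
by rewrite hN //; lia.
Qed.

(** Linear functionals on the localization [M[1/l]] in degree zero. *)
Record functional (F : M -> k) : Prop := {
  functionalD : forall x y, F (x + y) = F x + F y;
  functionalZ : forall (c : k) x, F ((c%:A : R) *: x) = c * F x;
  functional_l : forall x, F (l *: x) = F x
}.

(** Extension by Zorn's lemma: take a maximal subspace without [v] that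
    contains [U] and [(l - 1) M]. *)
Lemma functional_exists n (U : M -> Prop) v :
  U 0 -> (forall x y, U x -> U y -> U (x + y)) ->
  (forall (c : k) x, U x -> U ((c%:A : R) *: x)) ->
  (forall x, U x -> x \in piece M n) -> v \in piece M n -> ~ U v ->
  exists F : M -> k, [/\ functional F, F v = 1 & forall x, U x -> F x = 0].
Proof.
move=> U0 UD UZ Un vn nUv.
pose sub (A : set M) := [/\ A 0, forall x y, A x -> A y -> A (x + y)
  & forall (c : k) x, A x -> A ((c%:A : R) *: x)].
pose U' : set M := fun x => exists u m, U u /\ x = u + (l *: m - m).
have subU' : sub U'.
  split.
  - by exists 0, 0; rewrite scaler0 subrr addr0.
  - move=> _ _ [u [m [hu ->]]] [w [p [hw ->]]]; exists (u + w), (m + p).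
    split; first exact: UD.
    by rewrite scalerDr opprD addrACA; congr (_ + _); rewrite addrACA.
  - move=> c _ [u [m [hu ->]]]; exists ((c%:A : R) *: u), ((c%:A : R) *: m).
    split; first exact: UZ.
    by rewrite scalerDr scalerBr !scalerA [l * _]mulrC.
have nU'v : ~ U' v.
  move=> [u [m [hu ev]]]; apply: nUv.
  suff -> : v = u by [].
  apply/subr0_eq/(homogeneous_dehomogenize (m := m) (n := n)).
    by apply: (pieceB gm_direct) => //; exact: Un.
  by rewrite ev addrC addKr.
pose P (A : set M) := (forall x, ~ A x) \/ [/\ sub A, forall x, U' x -> A x & ~ A v].
have [A [PA Amax]] : exists A, P A /\ forall B, (A `<` B)%classic -> ~ P B.
  apply: Zorn_bigcup => F FP Ftot.
  have [[X [FX [x Xx]]]|hno] := pselect (exists X, F X /\ exists x, X x); last first.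
    by left => x [X FX Xx]; apply: hno; exists X; split=> //; exists x.
  have good Y y : F Y -> Y y -> [/\ sub Y, forall x, U' x -> Y x & ~ Y v].
    by move=> FY Yy; case: (FP Y FY) => // /(_ y).
  right; split.
  - split; first by have [[X0 _ _] _ _] := good _ _ FX Xx; exists X.
      move=> y z [Y FY Yy] [Z FZ Zz]; have [YZ|ZY] := Ftot Y Z FY FZ.
        have [[_ ZD _] _ _] := good _ _ FZ Zz; exists Z => //.
        by apply: ZD => //; exact: YZ.
      have [[_ YD _] _ _] := good _ _ FY Yy; exists Y => //.
      by apply: YD => //; exact: ZY.
    move=> c y [Y FY Yy]; have [[_ _ YZ] _ _] := good _ _ FY Yy.
    by exists Y => //; exact: YZ.
  - by move=> y hy; have [_ XU _] := good _ _ FX Xx; exists X => //; exact: XU.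
  - by move=> [Y FY Yv]; have [_ _] := good _ _ FY Yv.
have [[A0 AD AZ] AU nAv] : [/\ sub A, forall x, U' x -> A x & ~ A v].
  case: PA => // hA; have [] := Amax U'; last by right; split.
  by split=> [x /hA //|/(_ 0)]; have [h _ _] := subU' => /(_ h) /hA.
have AN x : A x -> A (- x).
  by move=> /(AZ (-1)); rewrite !scaleN1r.
have dec x : exists c : k, A (x - (c%:A : R) *: v).
  have [hx|nx] := pselect (A x); first by exists 0; rewrite !scale0r subr0.
  pose B : set M := fun y => exists c : k, A (y - (c%:A : R) *: x).
  have BA y : A y -> B y by move=> hy; exists 0; rewrite !scale0r subr0.
  have Bx : B x by exists 1; rewrite !scale1r subrr.
  have [c hc] : B v.
    apply: contrapT => nBv; apply: (Amax B).
      by split=> [y /BA //|/(_ x Bx)].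
    right; split=> [|y /AU /BA //|//]; split; first exact: BA.
      move=> y z [c hc] [d hd]; exists (c + d).
      by rewrite !scalerDl opprD addrACA; exact: AD.
    move=> a y [c /(AZ a)]; rewrite scalerBr scalerA => hc; exists (a * c).
    by rewrite -scalerA -[c *: 1]mul1r scalerAl.
  have nc : c != 0.
    by apply/eqP => c0; apply: nAv; rewrite c0 !scale0r subr0 in hc.
  exists c^-1; have := AN _ (AZ c^-1 _ hc).
  rewrite scalerBr opprB scalerA -scalerAl mul1r scalerA mulVf // !scale1r.
  by [].
have uniq x (c d : k) : A (x - (c%:A : R) *: v) -> A (x - (d%:A : R) *: v) -> c = d.
  move=> hc hd; apply/eqP; rewrite -subr_eq0; apply/negPn/negP => ncd.
  have ecd : x - (d%:A : R) *: v - (x - (c%:A : R) *: v) = ((c - d)%:A : R) *: v.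
    by rewrite [in RHS]scalerBl [in RHS]scalerBl opprB addrC addrA subrK.
  apply: nAv; have := AZ (c - d)^-1 _ (AD _ _ hd (AN _ hc)).
  by rewrite ecd scalerA -scalerAl mul1r scalerA mulVf // !scale1r.
pose F x := sval (cid (dec x)).
have FP x : A (x - ((F x)%:A : R) *: v) by exact: (svalP (cid (dec x))).
have FE x c : A (x - (c%:A : R) *: v) -> F x = c by exact: uniq.
exists F; split.
- split=> [x y|c x|x]; apply: FE.
  + by rewrite !scalerDl opprD addrACA; apply: AD.
  + rewrite -scalerA -[F x *: 1]mul1r scalerAl -scalerA -scalerBr.
    exact: AZ.
  + rewrite -[l *: x](subrK x) -addrA; apply: AD => //.
    by apply: AU; exists 0, x; rewrite add0r.
- by apply: FE; rewrite !scale1r subrr.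
- move=> x hx; apply: FE; rewrite !scale0r subr0; apply: AU.
  by exists x, 0; rewrite scaler0 subrr addr0.
Qed.

End GradedModules.

(** * Models of graded modules *)

Section Models.
Variables (k : closedFieldType) (R : comAlgType k) (gR : nat -> {pred R}).
Hypothesis R_std : standard_graded gR.
Variables (e : nat) (rho : 'I_e -> {rmorphism R -> {poly k}}) (l : R).
Hypothesis Hrho : coordinates gR rho l.
Local Notation ev := (ev rho).

(** The [k^e]-linear maps from [M[1/l]_0] to [k^e], evaluated at the elements of [M]:
    linearity over [R] is with respect to evaluation at the points. *)
Record chart (M : graded_module gR) (psi : M -> 'I_e -> k) : Prop := {
  chartD : forall u v i, psi (u + v) i = psi u i + psi v i;
  chartZ : forall r v i, psi (r *: v) i = ev i r * psi v i
}.

Lemma chart0 (M : graded_module gR) psi (H : @chart M psi) i : psi 0 i = 0.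
Proof. by rewrite -(scale0r (0 : M)) (chartZ H) ev0 mul0r. Qed.

Lemma chartB (M : graded_module gR) psi (H : @chart M psi) u v i :
  psi (u - v) i = psi u i - psi v i.
Proof.
by rewrite (chartD H) -scaleN1r (chartZ H) evN ev1 mulN1r.
Qed.

(** After inverting [l] and passing to degree zero, a graded module of rank at
    most one at each point is a filtered subspace of [k^e]; [T d] is the step
    of the filtration that comes from degree [d], up to a shift of degrees. *)
Definition model (T : nat -> ('I_e -> k) -> Prop) (M : graded_module gR) :=
  exists (j : int) (psi : M -> 'I_e -> k),
  [/\ chart psi,
      forall n v, v \in piece M n -> (forall i, psi v i = 0) -> v = 0,
      forall n v, v \in piece M n -> v != 0 ->
        exists d : nat, n = j + d%:Z /\ T d (psi v)
    & forall d c, T d c -> exists2 v, v \in piece M (j + d%:Z) & psi v =1 c].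

Section Transfer.
Variables (M M' : graded_module gR) (psi : M -> 'I_e -> k)
  (psi' : M' -> 'I_e -> k) (delta : int).
Hypotheses (H : chart psi) (H' : chart psi').
Local Notation co := (hcomp (gm_direct M)).
Local Notation co' := (hcomp (gm_direct M')).

(* the graph of the isomorphism to be constructed *)
Let G v v' := forall n i, psi (co n v) i = psi' (co' (n + delta) v') i.

Let G_ex : (forall n v, v \in piece M n ->
    exists2 v', v' \in piece M' (n + delta) & psi' v' =1 psi v) ->
  forall v, exists v', G v v'.
Proof.
move=> h v; apply: (@hcomp_ind _ _ _ (gm_direct M) (fun v => exists v', G v v')).
- by exists 0 => n i; rewrite !hcomp0 (chart0 H) (chart0 H').
- move=> u w [u' hu] [w' hw]; exists (u' + w') => n i.
  by rewrite !hcompD (chartD H) (chartD H') hu hw.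
move=> n; have [v' hv' ev'] := h _ _ (hcomp_in (gm_direct M) n v).
exists v' => m i; rewrite hcomp_idem (hcomp_piece _ _ hv') (inj_eq (addIr _)).
by case: ifP; rewrite ?ev' ?(chart0 H) ?(chart0 H').
Qed.

Let G_uniq : (forall n v, v \in piece M' n -> (forall i, psi' v i = 0) -> v = 0) ->
  forall v v' v'', G v v' -> G v v'' -> v' = v''.
Proof.
move=> h v v' v'' h1 h2; apply: (hcomp_inj (hg := gm_direct M')) => n.
apply/subr0_eq/(h n).
  by apply: (pieceB (gm_direct M')); exact: hcomp_in.
move=> i; rewrite (chartB H'); have := h1 (n - delta) i; rewrite h2 addrNK => ->.
by rewrite subrr.
Qed.

Let G_linear a u v u' v' : G u u' -> G v v' -> G (a *: u + v) (a *: u' + v').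
Proof.
move=> hu hv n i; rewrite !hcompD (chartD H) (chartD H') hv; congr (_ + _).
pose Q a := psi (co n (a *: u)) i = psi' (co' (n + delta) (a *: u')) i.
apply: (@hcomp_ind _ _ _ (std_direct R_std) Q a).
- by rewrite /Q !scale0r !hcomp0 (chart0 H) (chart0 H').
- move=> b c hb hc; rewrite /Q !scalerDl !hcompD (chartD H) (chartD H').
  by rewrite hb hc.
move=> d; have hd := hcomp_in (std_direct R_std) d a; rewrite /Q.
have -> : n = d%:Z + (n - d%:Z) by rewrite addrC subrK.
rewrite -addrA !(co_scale _ _ hd) (chartZ H) (chartZ H').
by rewrite hu.
Qed.

Lemma chart_graph :
  (forall n v, v \in piece M n ->
    exists2 v', v' \in piece M' (n + delta) & psi' v' =1 psi v) ->
  (forall n v, v \in piece M' n -> (forall i, psi' v i = 0) -> v = 0) ->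
  exists f : {linear M -> M'}, forall v n i,
    psi (co n v) i = psi' (co' (n + delta) (f v)) i.
Proof.
move=> ex inj; pose f v := sval (cid (G_ex ex v)).
have fG v : G v (f v) by exact: (svalP (cid (G_ex ex v))).
have flin : linear f by move=> a u v; apply: (G_uniq inj (fG _)); exact: G_linear.
pose g : {linear M -> M'} := HB.pack f (GRing.isLinear.Build _ _ _ _ f flin).
by exists g => v n i; exact: fG.
Qed.

End Transfer.

Lemma model_iso T (M M' : graded_module gR) :
  model T M -> model T M' -> iso_up_to_shift M M'.
Proof.
move=> [j [psi [H inj hT Tsurj]]] [j' [psi' [H' inj' hT' Tsurj']]].
have ex n v : v \in piece M n ->
    exists2 v', v' \in piece M' (n + (j' - j)) & psi' v' =1 psi v.
  move=> hv; have [->|nv] := eqVneq v 0.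
    exists 0 => [|i]; first exact: piece0 (gm_direct M') _.
    by rewrite (chart0 H) (chart0 H').
  have [d [-> /Tsurj' [v' hv' ev']]] := hT _ _ hv nv.
  by exists v' => //; rewrite addrC addrA subrK.
have ex' n v : v \in piece M' n ->
    exists2 v', v' \in piece M (n + (j - j')) & psi v' =1 psi' v.
  move=> hv; have [->|nv] := eqVneq v 0.
    exists 0 => [|i]; first exact: piece0 (gm_direct M) _.
    by rewrite (chart0 H) (chart0 H').
  have [d [-> /Tsurj [v' hv' ev']]] := hT' _ _ hv nv.
  by exists v' => //; rewrite addrC addrA subrK.
have [f hf] := chart_graph H H' ex inj'.
have [g hg] := chart_graph H' H ex' inj.
have z1 : j' - j + (j - j') = 0 by rewrite addrA subrK subrr.
have z2 : j - j' + (j' - j) = 0 by rewrite addrA subrK subrr.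
exists (j' - j), f; split.
  exists g => v.
    apply: (hcomp_inj (hg := gm_direct M)) => n; apply/subr0_eq/(inj n).
      by apply: (pieceB (gm_direct M)); exact: hcomp_in.
    by move=> i; rewrite (chartB H) (hf v) hg -addrA z1 addr0 subrr.
  apply: (hcomp_inj (hg := gm_direct M')) => n; apply/subr0_eq/(inj' n).
    by apply: (pieceB (gm_direct M')); exact: hcomp_in.
  by move=> i; rewrite (chartB H') (hg v) hf -addrA z2 addr0 subrr.
move=> n v; apply/(pieceP (gm_direct M'))/(pieceP (gm_direct M)) => h m nm.
  apply: (inj m); first exact: hcomp_in.
  by move=> i; rewrite hf h ?(chart0 H') // (inj_eq (addIr _)).
apply: (inj' m); first exact: hcomp_in.
move=> i; have := hf v (m - (j' - j)) i; rewrite subrK => <-.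
rewrite h ?(chart0 H) //; apply: contra nm => /eqP <-.
by rewrite subrK.
Qed.

(** Modules with the same model are isomorphic up to a shift, so that one module
    for each model that occurs makes a complete list. *)
Lemma finite_type_of_models (A : finType) (T : A -> nat -> ('I_e -> k) -> Prop) :
  (forall M : graded_module gR, graded_MCM M -> indecomposable M ->
     exists a, model (T a) M) -> graded_finite_CM_type gR.
Proof.
move=> h; have [[M0 [hM0 iM0]]|no] :=
    pselect (exists M : graded_module gR, graded_MCM M /\ indecomposable M); last first.
  exists 0%N, (fun i : 'I_0 => False_rect _ (notF (ltn_ord i))) => M hM iM.
  by case: no; exists M.
have ch a : exists M', (exists M, model (T a) M) -> model (T a) M'.
  have [[M hM]|nM] := pselect (exists M, model (T a) M); first by exists M.
  by exists M0.
exists #|A|, (fun i => sval (cid (ch (enum_val i)))) => M hM iM.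
have [a ha] := h M hM iM; exists (enum_rank a); rewrite enum_rankK.
case: cid => M' /= hM'; apply: (model_iso ha); apply: hM'; by exists M.
Qed.

(** * Splitting off direct summands *)

(** [N] is a complement of the submodule of those elements whose components are
    killed by the chart. *)
Lemma chart_split (M : graded_module gR) (psi : M -> 'I_e -> k) (N : {pred M}) :
  chart psi -> indecomposable M -> graded_submodule N ->
  (exists2 v, v \in N & v != 0) ->
  (forall n v, v \in N -> v \in piece M n -> (forall i, psi v i = 0) -> v = 0) ->
  (forall n v, v \in piece M n ->
    exists x, [/\ x \in N, x \in piece M n & psi x =1 psi v]) ->
  (forall n v, v \in piece M n -> (forall i, psi v i = 0) -> v = 0) /\
  (forall v, v \in N).
Proof.
move=> H [_ ind] hN [v0 hv0 nv0] injN surjN.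
pose K : {pred M} := fun v => `[< forall n, forall i, psi (hcomp (gm_direct M) n v) i = 0 >].
have hK : graded_submodule K.
  apply: (graded_submodule_by_components R_std (Z := fun _ v => forall i, psi v i = 0)).
  - by move=> _ i; rewrite (chart0 H).
  - by move=> _ u v hu hv i; rewrite (chartD H) hu hv addr0.
  - by move=> _ d r v _ _ hv i; rewrite (chartZ H) hv mulr0.
have [||hNz|hKz] := ind N K hN hK.
- move=> v hv /asboolP hKv; apply: (hcomp_eq0 (hg := gm_direct M)) => n.
  apply: (injN n) => //; last exact: hcomp_in.
  have [f hf <-] := hcomp_decomp (gm_direct M) v.
  by case: hN => _ /(_ v f hv hf).
- move=> v; pose Q v := exists v1 v2, [/\ v1 \in N, v2 \in K & v = v1 + v2].
  have [[N0 NL] _] := hN; have [[K0 KL] _] := hK.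
  apply: (@hcomp_ind _ _ _ (gm_direct M) Q v).
  + by exists 0, 0; rewrite addr0.
  + move=> u w [u1 [u2 [h1 h2 ->]]] [w1 [w2 [h3 h4 ->]]].
    exists (u1 + w1), (u2 + w2); split; last by rewrite addrACA.
      by rewrite -[u1]scale1r NL.
    by rewrite -[u2]scale1r KL.
  move=> n; have hn := hcomp_in (gm_direct M) n v.
  have [x [xN xn ex]] := surjN _ _ hn.
  exists x, (hcomp (gm_direct M) n v - x); split=> //; last by rewrite addrC subrK.
  apply/asboolP => m i; rewrite hcompB !(hcomp_piece _ _ hn) (hcomp_piece _ _ xn).
  by case: ifP => _; rewrite ?subr0 ?(chart0 H) // (chartB H) ex subrr.
- by case/eqP: nv0; exact: hNz.
have KE n v : v \in piece M n -> (forall i, psi v i = 0) -> v = 0.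
  move=> hv hp; apply: hKz; apply/asboolP => m i; rewrite (hcomp_piece _ _ hv).
  by case: ifP => _; rewrite ?hp ?(chart0 H).
split=> // v; apply: (@hcomp_ind _ _ _ (gm_direct M) (fun v => v \in N)).
- by case: hN => [[]].
- by move=> u w hu hw; have [[_ NL] _] := hN; rewrite -[u]scale1r NL.
move=> n; have hn := hcomp_in (gm_direct M) n v.
have [x [xN xn ex]] := surjN _ _ hn.
suff -> : hcomp (gm_direct M) n v = x by [].
apply/subr0_eq/(KE n); first exact: (pieceB (gm_direct M)).
by move=> i; rewrite (chartB H) ex subrr.
Qed.

End Models.

(** * Indecomposable modules over at most three points *)

Section Splitting.
Variables (k : closedFieldType) (R : comAlgType k) (gR : nat -> {pred R}).
Hypothesis R_std : standard_graded gR.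
Variables (e : nat) (rho : 'I_e -> {rmorphism R -> {poly k}}) (l : R).
Hypothesis Hrho : coordinates gR rho l.
Local Notation ev := (ev rho).
Local Notation sc c v := ((c%:A : R) *: v).

Variables (D : nat) (r : 'I_e -> R).
Hypothesis r_deg : forall i, r i \in gR D.
Hypothesis r_ev : forall i j, ev j (r i) = (j == i)%:R.

Let l1 := coord_l1 Hrho.

Lemma r_mul d s i : s \in gR d -> r i * s = ev i s *: (l ^+ d * r i).
Proof.
move=> hs; apply: (ev_inj Hrho (d := (D + d)%N)).
- by rewrite (std_mul R_std).
- by apply: (std_scale R_std _); rewrite addnC; exact: (mul_lX_deg R_std Hrho).
move=> j; rewrite !(evE Hrho) r_ev; case: eqP => [->|_]; last by rewrite mul0r !mulr0.
by rewrite !mul1r mulr1.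
Qed.

Lemma r_orth i j : r j * r i = (j == i)%:R *: (l ^+ D * r i).
Proof.
by rewrite (r_mul _ (r_deg i)) r_ev; case: eqP => [->|_]; rewrite ?scale0r.
Qed.

Lemma r_sum : \sum_i r i = l ^+ D.
Proof.
apply: (ev_inj Hrho (d := D)).
- by apply: (piece_sum (std_direct R_std)) => i _.
- exact: (lX_deg R_std Hrho).
move=> j; rewrite ev_sum (evE Hrho) (bigD1 j) //= r_ev eqxx big1 ?addr0 //.
by move=> i nij; rewrite r_ev eq_sym (negbTE nij).
Qed.

Lemma ev_surj d (c : 'I_e -> k) : (D <= d)%N ->
  exists2 s, s \in gR d & forall i, ev i s = c i.
Proof.
move=> Dd; exists (\sum_i c i *: (l ^+ (d - D) * r i)).
  apply: (piece_sum (std_direct R_std)) => i _; apply: (std_scale R_std _).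
  by rewrite -[d in gR d](subnK Dd); exact: (mul_lX_deg R_std Hrho).
move=> j; rewrite ev_sum (bigD1 j) //= !(evE Hrho) r_ev eqxx mul1r mulr1.
rewrite big1 ?addr0 // => i nij.
by rewrite !(evE Hrho) r_ev eq_sym (negbTE nij) !mulr0.
Qed.

Section Module.
Variable M : graded_module gR.
Hypothesis l_inj : forall v : M, l *: v = 0 -> v = 0.
Hypothesis M_ind : indecomposable M.
Local Notation co := (hcomp (gm_direct M)).

Lemma scD (c d : k) (v : M) : sc (c + d) v = sc c v + sc d v.
Proof. by rewrite scalerDl scalerDl. Qed.
Lemma sc0 (v : M) : sc 0 v = 0.
Proof. by rewrite !scale0r. Qed.
Lemma scE (c : k) (s : R) (v : M) : (c *: s) *: v = sc c (s *: v).
Proof. by rewrite scalerA -scalerAl mul1r. Qed.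
Lemma scA (c d : k) (v : M) : sc c (sc d v) = sc (c * d) v.
Proof. by rewrite scalerA -scalerAl mul1r scalerA. Qed.
Lemma scC (c : k) (s : R) (v : M) : s *: sc c v = sc c (s *: v).
Proof. by rewrite !scalerA mulrC. Qed.

Lemma functionalX F n (v : M) : functional l F -> F (l ^+ n *: v) = F v.
Proof.
move=> hF; elim: n => [|n IH]; first by rewrite expr0 scale1r.
by rewrite exprS -scalerA (functional_l hF).
Qed.

Lemma functional0 (F : M -> k) : functional l F -> F 0 = 0.
Proof. by move=> hF; rewrite -(sc0 0) (functionalZ hF) mul0r. Qed.

Lemma functionalB (F : M -> k) : functional l F -> forall u v, F (u - v) = F u - F v.
Proof.
move=> hF u v; rewrite (functionalD hF); congr (_ + _).
have := functionalZ hF (-1) v; rewrite scaleN1r scaleN1r => ->.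
by rewrite mulN1r.
Qed.

Lemma functional_sum (F : M -> k) : functional l F ->
  forall (J : Type) (s : seq J) (P : pred J) (f : J -> M),
  F (\sum_(a <- s | P a) f a) = \sum_(a <- s | P a) F (f a).
Proof.
by move=> hF J s P f; exact: (big_morph F (functionalD hF) (functional0 hF)).
Qed.

(** Homomorphisms from [M[1/l]_0] to [k^e] that are linear over [k^e]
    correspond to linear functionals, by the trace form of [k^e]. *)
Lemma functional_chart F : functional l F ->
  chart rho (fun (v : M) i => F (r i *: v)).
Proof.
move=> hF; split=> [u v i|s v i]; first by rewrite scalerDr (functionalD hF).
pose Q s := F (r i *: (s *: v)) = ev i s * F (r i *: v).
apply: (@hcomp_ind _ _ _ (std_direct R_std) Q s); rewrite /Q.
- by rewrite scale0r scaler0 (functional0 hF) ev0 mul0r.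
- move=> a b ha hb; rewrite scalerDl scalerDr (functionalD hF) ha hb.
  by rewrite evD mulrDl.
move=> d; have hd := hcomp_in (std_direct R_std) d s.
rewrite scalerA (r_mul _ hd) scE (functionalZ hF) -scalerA.
by rewrite (functionalX _ _ hF).
Qed.

Lemma r_scale_eq0 (v : M) : (forall i, r i *: v = 0) -> v = 0.
Proof.
move=> h; apply: (lX_inj l_inj (n := D)); rewrite -r_sum scaler_suml big1 //.
Qed.

(** ** A free summand *)

(** The ring with [k] in degree zero and [k^e] in all positive degrees acts on
    [M]: for an idempotent of [k^e], multiplied by [l], there is room one degree
    higher. *)
Definition overring_closed := forall n (v : M) i, v \in piece M n ->
  exists2 w, w \in piece M (n + 1) & l ^+ D *: w = (l * r i) *: v.

Definition ring_model d (c : 'I_e -> k) := exists2 s, s \in gR d & forall i, ev i s = c i.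

(** Let [R_1] be the kernel of a functional [tau] on [k^e] whose coefficients
    do not vanish.  Then [R] is Gorenstein: [s] belongs to [R_d] if and only if
    [tau] vanishes on [s * R_(1 - d)].  If the idempotents do not act on [M] in
    degree one, say on [v] of degree [n], some functional [F] kills [M_(n+1)]
    but not [r i v].  The chart associated with [F] by means of [tau] instead
    of the trace form then maps [M] into [R] and [v] to a unit, so that [R v]
    is a free summand. *)
Lemma free_summand (tau : 'I_e -> k) : D = 2%N -> (forall i, tau i != 0) ->
  (forall c : 'I_e -> k, \sum_i tau i * c i = 0 <-> ring_model 1 c) ->
  ~ overring_closed -> model rho ring_model M.
Proof.
move=> D2 ntau htau; rewrite /overring_closed.
move=> /existsNP [n /existsNP [v /existsNP [i0 /not_implyP [hv nw]]]].
pose U (x : M) := exists2 w, w \in piece M (n + 1) & x = l *: w.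
have hrv : r i0 *: v \in piece M (2%:Z + n).
  by have := gm_scale (r_deg i0) hv; rewrite D2.
have [||||||F [hF Fv FU]] := functional_exists l1 l_inj (n := 2%:Z + n)
    (U := U) (v := r i0 *: v).
- by exists 0; [exact: piece0 (gm_direct M) _ | rewrite scaler0].
- move=> _ _ [x hx ->] [y hy ->]; exists (x + y); last by rewrite scalerDr.
  exact: (pieceD (gm_direct M)).
- move=> c _ [x hx ->]; exists (sc c x); last by rewrite scC.
  exact: (gm_scaleC R_std).
- move=> _ [x hx ->]; rewrite (_ : 2%:Z + n = 1%:Z + (n + 1)); last by lia.
  exact: gm_scale.
- by [].
- move=> [w hw ew]; apply: nw; exists w => //.
  by rewrite -scalerA ew D2 expr2 scalerA.
have F1 x : x \in piece M (n + 1) -> F x = 0.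
  by move=> hx; rewrite -(functional_l hF) FU //; exists x.
have hchart := functional_chart hF.
pose psi (x : M) i := (tau i)^-1 * F (r i *: x).
have H : chart rho psi.
  split=> [x y i|s x i]; rewrite /psi.
    by rewrite (chartD hchart) mulrDr.
  by rewrite (chartZ hchart) mulrCA.
have tauE (x : M) : \sum_i tau i * psi x i = F x.
  rewrite -[F x](functionalX D) // -r_sum scaler_suml (functional_sum hF).
  by apply: eq_bigr => i _; rewrite /psi mulVKf.
have const x : x \in piece M n -> forall i, psi x i = psi x i0.
  move=> hx i; have [->//|nii] := eqVneq i i0.
  (* a vector in the kernel of tau, hence the value of a linear form y; the
     vanishing of F on y * x compares the two coordinates of x *)
  pose c j := (j == i)%:R / tau i - (j == i0)%:R / tau i0.
  have [y hy ey] : ring_model 1 c.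
    apply/htau; under eq_bigr do rewrite mulrBr.
    rewrite sumrB (bigD1 i) //= big1 => [|j /negbTE ->]; last by rewrite mul0r mulr0.
    rewrite (bigD1 i0) //= [X in _ + _ - (_ + X)]big1 => [|j /negbTE ->];
      last by rewrite mul0r mulr0.
    by rewrite !eqxx !mulrA !mulr1 !mulfV // !addr0 subrr.
  have hyx : y *: x \in piece M (n + 1) by rewrite addrC; apply: gm_scale.
  have := F1 _ hyx; rewrite -tauE.
  under eq_bigr do rewrite (chartZ H) ey /c.
  under eq_bigr do rewrite mulrBl mulrBr.
  rewrite sumrB (bigD1 i) //= big1 => [|j /negbTE ->]; last by rewrite !mul0r mulr0.
  rewrite (bigD1 i0) //= [X in _ + _ - (_ + X)]big1 => [|j /negbTE ->];
    last by rewrite !mul0r mulr0.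
  rewrite !eqxx !addr0 !mul1r !mulrA !mulfV // !mul1r.
  by move/subr0_eq.
have a0 : psi v i0 != 0 by rewrite /psi Fv mulr1 invr_eq0.
have low (m : int) x : m < n -> x \in piece M m -> forall i, psi x i = 0.
  move=> hm hx i.
  have [d ed] : exists d : nat, n + 1 = d%:Z + m by exists (absz (n + 1 - m)%R); lia.
  have [|s hs es] := @ev_surj d (fun j => (j == i)%:R); first by rewrite D2; lia.
  have := F1 (s *: x); rewrite ed gm_scale // => /(_ isT).
  rewrite -tauE (bigD1 i) //= big1 => [|j /negbTE nj].
    rewrite (chartZ H) es eqxx mul1r addr0 => /eqP.
    by rewrite mulf_eq0 (negbTE (ntau i)) => /eqP.
  by rewrite (chartZ H) es nj mul0r mulr0.
pose Z (m : int) (x : M) := x = 0 \/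
  exists d s, [/\ m = n + d%:Z, s \in gR d & x = s *: v].
pose N : {pred M} := fun x => `[< forall m, Z m (co m x) >].
have hN : graded_submodule N.
  apply: (graded_submodule_by_components R_std (Z := Z)).
  - by move=> m; left.
  - move=> m x y [->|[d [s [em hs ->]]]]; first by rewrite add0r.
    move=> [->|[d' [s' [em' hs' ->]]]]; first by rewrite addr0; right; exists d, s.
    have edd : d' = d by lia.
    right; exists d, (s + s'); rewrite scalerDl; split=> //.
    by apply: (pieceD (std_direct R_std)) => //; rewrite -edd.
  - move=> m d s x hs _ [->|[d' [s' [-> hs' ->]]]]; first by left; rewrite scaler0.
    right; exists (d + d')%N, (s * s'); split; first by lia.
      exact: (std_mul R_std).
    by rewrite scalerA.
have NP m x : x \in piece M m -> Z m x -> x \in N.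
  move=> hx hZ; apply/asboolP => m'; rewrite (hcomp_piece _ _ hx).
  by case: eqP => [->//|_]; left.
have NZ m x : x \in piece M m -> x \in N -> Z m x.
  by move=> hx /asboolP /(_ m); rewrite hcomp_id.
have vi i : psi v i = psi v i0 by exact: const.
have [|||inj Nall] := chart_split R_std H M_ind hN.
- exists v; last by apply: contra a0 => /eqP ->; rewrite (chart0 H).
  apply: (NP n) => //; right; exists 0%N, 1; rewrite addr0 scale1r; split=> //.
  exact: one_deg0 R_std.
- move=> m x xN hx h; case: (NZ _ _ hx xN) => [//|[d [s [em hs ex]]]].
  have s0 : s = 0; last by rewrite ex s0 scale0r.
  apply: (ev_inj Hrho hs (piece0 (std_direct R_std) d)) => i; rewrite ev0.
  have := h i; rewrite ex (chartZ H) vi => /eqP.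
  by rewrite mulf_eq0 (negbTE a0) orbF => /eqP.
- move=> /= m x hx; have [lt|ge] := boolP ((m : int) < n).
    exists 0; split; first by case: hN => [[]].
      exact: piece0 (gm_direct M) _.
    by move=> i; rewrite (chart0 H) (low m).
  have [d ed] : exists d : nat, m = n + d%:Z by exists (absz (m - n)%R); lia.
  suff [s hs es] : ring_model d (fun i => psi x i / psi v i0).
    exists (s *: v); have hsv : s *: v \in piece M m by rewrite ed addrC; exact: gm_scale.
    split=> // [|i]; first by apply: (NP m) => //; right; exists d, s.
    by rewrite (chartZ H) es vi divfK.
  case: d ed => [|[|d]] ed; last by apply: ev_surj; rewrite D2.
    exists (psi x i0 / psi v i0)%:A; first exact: scalar_deg0 R_std _.
    by move=> i; rewrite (evC Hrho) const // -[n]addr0 -ed.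
  apply/htau; under eq_bigr do rewrite mulrA.
  by rewrite -mulr_suml tauE F1 ?mul0r // -ed.
exists n, (fun x i => psi x i / psi v i0); split.
- split=> [x y i|s x i]; first by rewrite (chartD H) mulrDl.
  by rewrite (chartZ H) -mulrA.
- move=> m x hx h; apply: (inj m) => // i.
  by have /eqP := h i; rewrite mulf_eq0 invr_eq0 (negbTE a0) orbF => /eqP.
- move=> m x hx nx; case: (NZ _ _ hx (Nall x)) => [x0|[d [s [em hs ex]]]].
    by rewrite x0 eqxx in nx.
  exists d; split=> //; exists s => // i.
  by rewrite ex (chartZ H) vi mulfK.
- move=> d c [s hs es]; exists (s *: v); first by rewrite addrC gm_scale.
  by move=> i; rewrite (chartZ H) vi mulfK.
Qed.

End Module.
End Splitting.

Lemma two_of_three e (A : {set 'I_e}) p q :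
  (e <= 3)%N -> p \in A -> q \in A -> q != p -> (#|A| <= e.-1)%N ->
  exists t, [/\ A = [set p; q], t \notin A, t != p, t != q
    & forall i, [\/ i = p, i = q | i = t]].
Proof.
move=> e3 hp hq nqp cA.
have pq : [set p; q] \subset A.
  by apply/fintype.subsetP => i; rewrite finset.in_set2 => /orP [] /eqP ->.
have cpq : #|[set p; q]| = 2%N by rewrite cards2 eq_sym nqp.
have ge2 := subset_leq_card pq; rewrite cpq in ge2.
have ee : e = 3%N by lia.
have eA : A = [set p; q].
  by apply/esym/eqP; rewrite eqEcard pq cpq (leq_trans cA) // ee.
have [t et] : exists t, ~: [set p; q] = [set t].
  apply/cards1P; have := cardsC [set p; q]; rewrite cpq card_ord => h.
  by apply/eqP; lia.
have mem i : (i \notin [set p; q]) = (i == t) by rewrite -finset.in_setC et finset.in_set1.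
have nt : t \notin [set p; q] by rewrite mem.
have [ntp ntq] : t != p /\ t != q.
  by move: nt; rewrite finset.in_set2 negb_or => /andP.
exists t; split=> // [|i]; first by rewrite eA.
have := mem i; rewrite finset.in_set2 negb_or.
case: eqVneq => [->|_]; first by constructor 1.
case: eqVneq => [->|_]; first by constructor 2.
by move=> /esym/eqP ->; constructor 3.
Qed.

Section Classification.
Variables (k : closedFieldType) (R : comAlgType k) (gR : nat -> {pred R}).
Hypothesis R_std : standard_graded gR.
Variables (e : nat) (rho : 'I_e -> {rmorphism R -> {poly k}}) (l : R).
Hypothesis Hrho : coordinates gR rho l.
Local Notation ev := (ev rho).
Local Notation sc c v := ((c%:A : R) *: v).
Variables (D : nat) (r : 'I_e -> R).
Hypothesis r_deg : forall i, r i \in gR D.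
Hypothesis r_ev : forall i j, ev j (r i) = (j == i)%:R.

Let l1 := coord_l1 Hrho.
Let rs_orth := r_orth R_std Hrho r_deg r_ev.

Section Module.
Variable M : graded_module gR.
Hypothesis l_inj : forall v : M, l *: v = 0 -> v = 0.
Hypothesis M_ind : indecomposable M.
Hypothesis M_over : overring_closed l D r M.
Local Notation co := (hcomp (gm_direct M)).

Lemma r_orth_scale i i' (v : M) :
  r i' *: (r i *: v) = if i' == i then l ^+ D *: (r i *: v) else 0.
Proof.
rewrite scalerA rs_orth; case: eqP => _; last by rewrite scale0r scale0r.
by rewrite scale1r scalerA.
Qed.

Lemma overring_lift j d (u : 'I_e -> M) (c : 'I_e -> k) :
  (forall i, u i \in piece M j) ->
  exists2 x, x \in piece M (j + d.+1%:Z) &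
    forall i, r i *: x = sc (c i) (l ^+ d.+1 *: (r i *: u i)).
Proof.
move=> hu.
have hl i : l ^+ d *: u i \in piece M (d%:Z + j).
  by apply: gm_scale => //; exact: (lX_deg R_std Hrho).
have ex i := M_over i (hl i).
pose w i := s2val (cid2 (ex i)).
have wd i : w i \in piece M (d%:Z + j + 1) := s2valP (cid2 (ex i)).
have wE i : l ^+ D *: w i = (l * r i) *: (l ^+ d *: u i) := s2valP' (cid2 (ex i)).
have rw i i' : r i' *: w i = if i' == i then l ^+ d.+1 *: (r i *: u i) else 0.
  apply: (lX_inj2 l_inj (n := D)).
  rewrite scalerA mulrC -scalerA wE -!scalerA [r i *: (l ^+ d *: _)]scalerA.
  rewrite [r i * _]mulrC -scalerA.
  have -> : r i' *: (l *: (l ^+ d *: (r i *: u i))) =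
            l ^+ d.+1 *: (r i' *: (r i *: u i)).
    by rewrite !scalerA exprS; congr (_ *: _); ring.
  rewrite r_orth_scale; case: eqP => _; last by rewrite !scaler0.
  by rewrite !scalerA; congr (_ *: _); ring.
exists (\sum_i sc (c i) (w i)) => [|i'].
  apply: (piece_sum (gm_direct M)) => i _; apply: (gm_scaleC R_std).
  by rewrite (_ : j + d.+1%:Z = d%:Z + j + 1) //; lia.
rewrite scaler_sumr (bigD1 i') //= big1 ?addr0 => [|i ni].
  by rewrite scC rw eqxx.
by rewrite scC rw eq_sym (negbTE ni) scaler0.
Qed.

Definition step_model (I : {set 'I_e}) (T0 : ('I_e -> k) -> Prop)
  (d : nat) (c : 'I_e -> k) :=
  if d is 0%N then T0 c else forall i, i \notin I -> c i = 0.

(** The functional [F] is a chart of [M] with values supported on [I].  The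
    [u i], of the lowest degree [j], are chosen so that their [i]-th components
    are a basis dual to it; the elements whose components are multiples of
    these form the summand. *)
Lemma lowest_degree_summand j (I : {set 'I_e}) (u : 'I_e -> M) F T0 i0 :
  let psi (x : M) i := if i \in I then F (r i *: x) else 0 in
  (forall n v, n < j -> v \in piece M n -> v = 0) ->
  i0 \in I -> (forall i, u i \in piece M j) ->
  functional l F -> (forall i, i \in I -> F (r i *: u i) = 1) ->
  (forall m, m \in piece M j -> exists2 x, x \in piece M j &
     forall i, r i *: x = sc (psi m i) (r i *: u i)) ->
  (forall x, x \in piece M j -> T0 (psi x)) ->
  (forall c, T0 c -> exists2 x, x \in piece M j & psi x =1 c) ->
  model rho (step_model I T0) M.
Proof.
move=> psi hj hi0 hu hF Fu hW T0i T0s.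
have H : chart rho psi.
  have hc := functional_chart R_std Hrho r_deg r_ev hF.
  split=> [x y i|s x i]; rewrite /psi; case: ifP => _; rewrite ?addr0 ?mulr0 //.
    exact: (chartD hc).
  exact: (chartZ hc).
pose Z (n : int) (x : M) := forall d : nat, n = j + d%:Z ->
  forall i, r i *: x = sc (psi x i) (l ^+ d *: (r i *: u i)).
pose N : {pred M} := fun x => `[< forall m, Z m (co m x) >].
have deg (n : int) v : v \in piece M n -> v != 0 -> exists d : nat, n = j + d%:Z.
  move=> hv nv; have [lt|ge] := boolP (n < j).
    by case/eqP: nv; exact: (hj n).
  by exists (absz (n - j)%R); lia.
have hN : graded_submodule N.
  apply: (graded_submodule_by_components R_std (Z := Z)).
  - by move=> n d _ i; rewrite (chart0 H) sc0 scaler0.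
  - move=> n x y hx hy d ed i.
    by rewrite scalerDr (hx d) // (hy d) // (chartD H) scD.
  move=> n d s x hs xn hx d' ed' i.
  have [->|nx] := eqVneq x 0; first by rewrite !scaler0 (chart0 H) sc0.
  have [d0 ed0] := deg _ _ xn nx.
  have -> : d' = (d + d0)%N by move: ed'; rewrite ed0; lia.
  rewrite scalerA (r_mul R_std Hrho r_deg r_ev i hs) scE -scalerA (hx d0) //.
  by rewrite (chartZ H) -scA scC exprD -scalerA.
have psiE i (x : M) (c : k) d :
    r i *: x = sc c (l ^+ d *: (r i *: u i)) -> psi x i = if i \in I then c else 0.
  move=> ex; rewrite /psi; case: ifP => // hi.
  by rewrite ex (functionalZ hF) (functionalX _ _ hF) Fu // mulr1.
have NP m x : x \in piece M m -> Z m x -> x \in N.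
  move=> hx hZ; apply/asboolP => m'; rewrite (hcomp_piece _ _ hx).
  case: eqP => [->//|_] d _ i; by rewrite (chart0 H) sc0 scaler0.
have NZ m x : x \in piece M m -> x \in N -> Z m x.
  by move=> hx /asboolP /(_ m); rewrite hcomp_id.
have lift d c : (forall i, i \notin I -> c i = 0) ->
    exists x, [/\ x \in piece M (j + d.+1%:Z), Z (j + d.+1%:Z) x & psi x =1 c].
  move=> hc; have [x hx xE] := overring_lift d c hu.
  have pE : psi x =1 c.
    by move=> i; rewrite (psiE _ _ _ _ (xE i)); case: ifPn => // /hc.
  exists x; split=> // d' ed' i; rewrite pE.
  by rewrite (_ : d' = d.+1) ?xE //; lia.
have low x : x \in piece M j -> exists y, [/\ y \in piece M j, Z j y & psi y =1 psi x].
  move=> hx; have [y hy yE] := hW _ hx.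
  have pE : psi y =1 psi x.
    move=> i; rewrite (psiE i y (psi x i) 0%N) ?expr0 ?scale1r //.
    by rewrite /psi; case: (i \in I).
  exists y; split=> // d' ed' i; rewrite pE.
  have -> : d' = 0%N by lia.
  by rewrite expr0 scale1r.
have [|||inj Nall] := chart_split R_std H M_ind hN.
- have [y [hy hZ py]] := low _ (hu i0); exists y; first exact: NP hy hZ.
  apply/eqP => y0; have := py i0; rewrite y0 (chart0 H) /psi hi0 Fu //.
  by move/eqP; rewrite eq_sym oner_eq0.
- move=> n x xN xn h; apply/eqP/negPn/negP => nx.
  have [d ed] := deg _ _ xn nx; case/eqP: nx.
  apply: (r_scale_eq0 R_std Hrho r_deg r_ev l_inj) => i.
  by rewrite (NZ _ _ xn xN d ed) h sc0.
- move=> n x xn; have [->|nx] := eqVneq x 0.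
    by exists 0; split; [case: hN => [[]] | exact: piece0 (gm_direct M) _ |].
  have [[|d] ed] := deg _ _ xn nx; rewrite ?addr0 in ed; subst n.
    have [y [hy hZ py]] := low _ xn; exists y; split=> //; exact: NP hy hZ.
  have [|y [hy hZ py]] := lift d (psi x); last first.
    by exists y; split=> //; exact: NP hy hZ.
  by move=> i /negbTE hi; rewrite /psi hi.
exists j, psi; split=> //.
- move=> n x xn nx; have [d ed] := deg _ _ xn nx; exists d; split=> //.
  case: d ed => [|d] ed; last by move=> i /negbTE hi; rewrite /psi hi.
  by apply: T0i; rewrite ed addr0 in xn.
- move=> [|d] c; first by rewrite addr0; exact: T0s.
  by move=> /(lift d) [x [hx _ px]]; exists x.
Qed.

Definition lowest_line (I : {set 'I_e}) (c : 'I_e -> k) :=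
  exists a, forall i, c i = if i \in I then a else 0.

(** In the lowest degree the model is a line, spanned by a vector with support
    [A], or else the plane of vectors with sum zero in [k^3]. *)
Definition over_model (a : option {set 'I_e}) :=
  if a is Some A then step_model A (lowest_line A)
  else step_model [set: 'I_e] (fun c => \sum_i c i = 0).

Definition supp (w : M) := [set i | r i *: w != 0].

Lemma supp0 i w : i \notin supp w -> r i *: w = 0.
Proof. by rewrite inE negbK => /eqP. Qed.

(** A vector [w] of minimal support [I] in the lowest degree [j] generates a
    summand if some functional on [M_j] factors through all components in [I]
    without vanishing on [w].  Otherwise [w] is a sum of vectors [y i] in [M_j],
    for [i] in [I], where the [i]-th component of [y i] vanishes; minimality of the
    support then leaves only two points in the support out of three, and the
    two vectors [y i] generate the summand. *)
Lemma overring_classification j : (e <= 3)%N ->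
  (forall n v, n < j -> v \in piece M n -> v = 0) ->
  (exists2 v, v \in piece M j & v != 0) ->
  exists a, model rho (over_model a) M.
Proof.
move=> e3 hj [v0 hv0 nv0].
(* a vector w of minimal support *)
pose P n := `[< exists w, [/\ w \in piece M j, w != 0 & #|supp w| = n] >].
have : exists n, P n by exists #|supp v0|; apply/asboolP; exists v0.
case/ex_minnP => n0 /asboolP [w [hw nw <-]] wmin'.
have wmin z : z \in piece M j -> z != 0 -> (#|supp w| <= #|supp z|)%N.
  by move=> hz nz; apply: wmin'; apply/asboolP; exists z.
have [i0 hi0] : exists i0, i0 \in supp w.
  apply/set0Pn/eqP => s0; case/eqP: nw.
  apply: (r_scale_eq0 R_std Hrho r_deg r_ev l_inj) => i.
  by apply: supp0; rewrite s0 inE.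
have rd i (x : M) : x \in piece M j -> r i *: x \in piece M (D%:Z + j).
  by move=> hx; apply: gm_scale.
(* A functional that kills U takes the same value on all components in the
   support of w of a vector of degree j. *)
pose U (x : M) := exists z : 'I_e -> M, [/\ forall i, z i \in piece M j,
  \sum_i z i = 0, forall i, i \notin supp w -> z i = 0 & x = \sum_i r i *: z i].
have [[z [hz sz oz ez]]|nU] := pselect (U (r i0 *: w)); last first.
  have [||||||F [hF Fw FU]] := functional_exists l1 l_inj (n := D%:Z + j)
      (U := U) (v := r i0 *: w).
  - exists (fun=> 0); split=> [i||//|]; first exact: piece0 (gm_direct M) _.
      by rewrite big1.
    by rewrite big1 // => i _; rewrite scaler0.
  - move=> _ _ [x [hx sx ox ->]] [y [hy sy oy ->]]; exists (fun i => x i + y i).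
    split=> [i||i hi|]; first exact: (pieceD (gm_direct M)).
    + by rewrite big_split /= sx sy addr0.
    + by rewrite ox // oy // addr0.
    + by rewrite -big_split; apply: eq_bigr => i _; rewrite scalerDr.
  - move=> c _ [x [hx sx ox ->]]; exists (fun i => sc c (x i)).
    split=> [i||i hi|]; first exact: (gm_scaleC R_std).
    + by rewrite -scaler_sumr sx scaler0.
    + by rewrite ox // scaler0.
    + by rewrite scaler_sumr; apply: eq_bigr => i _; rewrite scC.
  - move=> _ [x [hx _ _ ->]]; apply: (piece_sum (gm_direct M)) => i _.
    exact: rd.
  - exact: rd.
  - exact: nU.
  have same x i : x \in piece M j -> i \in supp w -> F (r i *: x) = F (r i0 *: x).
    move=> hx hi; have [->//|nii] := eqVneq i i0.
    apply/eqP; rewrite -subr_eq0 -(functionalB hF); apply/eqP/FU.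
    exists (fun i' => if i' == i then x else if i' == i0 then - x else 0); split.
    + move=> i'; case: ifP => // _; case: ifP => _; last exact: piece0 (gm_direct M) _.
      exact: (pieceN (gm_direct M)).
    + rewrite (bigD1 i) //= (bigD1 i0) /= 1?eq_sym // eqxx eq_sym (negbTE nii) eqxx.
      rewrite big1 ?addr0 ?subrr // => i' /andP [/negbTE -> /negbTE ->] //.
    + move=> i' hi'; case: eqP => [e1|_]; first by rewrite e1 hi in hi'.
      by case: eqP => [e1|//]; rewrite e1 hi0 in hi'.
    + rewrite (bigD1 i) //= (bigD1 i0) /= 1?eq_sym // eqxx eq_sym (negbTE nii) eqxx.
      rewrite big1 ?addr0 ?scalerN // => i' /andP [/negbTE -> /negbTE ->].
      by rewrite scaler0.
  exists (Some (supp w)).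
  apply: (lowest_degree_summand (j := j) (u := fun=> w) (F := F) (i0 := i0)) => //.
  - by move=> i hi; rewrite same.
  - move=> m hm; exists (sc (F (r i0 *: m)) w); first exact: (gm_scaleC R_std).
    move=> i; rewrite scC; case: ifPn => [hi|/supp0 ->]; first by rewrite same.
    by rewrite !scaler0.
  - move=> x hx; exists (F (r i0 *: x)) => i.
    by have [hi|//] := boolP (i \in supp w); rewrite same.
  - move=> c [a ha]; exists (sc a w); first exact: (gm_scaleC R_std).
    move=> i; rewrite ha; have [hi|//] := boolP (i \in supp w).
    by rewrite scC (functionalZ hF) same // Fw mulr1.
have rz m : l ^+ D *: (r m *: z m) = r m *: (r i0 *: w).
  rewrite ez scaler_sumr (bigD1 m) //= big1 ?addr0 => [|i nim].
    by rewrite r_orth_scale eqxx.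
  by rewrite r_orth_scale eq_sym (negbTE nim).
have rz0 m : m != i0 -> r m *: z m = 0.
  by move=> nm; apply: (lX_inj l_inj (n := D)); rewrite rz r_orth_scale (negbTE nm).
have rzi0 : r i0 *: z i0 = r i0 *: w.
  by apply: (lX_inj2 l_inj (n := D)); rewrite rz r_orth_scale eqxx.
pose y i := if i == i0 then w - z i0 else - z i.
have yd i : y i \in piece M j.
  rewrite /y; case: ifP => _; first exact: (pieceB (gm_direct M)).
  exact: (pieceN (gm_direct M)).
have ry i : r i *: y i = 0.
  rewrite /y; case: eqP => [->|/eqP ni]; last by rewrite scalerN rz0 ?oppr0.
  by rewrite scalerBr rzi0 subrr.
have sy : \sum_i y i = w.
  rewrite (bigD1 i0) //= /y eqxx.
  rewrite (eq_bigr (fun i => - z i)) => [|i /negbTE -> //].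
  by have := sz; rewrite (bigD1 i0) //= sumrN -addrA -opprD => ->; rewrite subr0.
have oy i : i \notin supp w -> y i = 0.
  move=> hi; rewrite /y; case: eqP => [ei|_]; first by rewrite ei hi0 in hi.
  by rewrite oz // oppr0.
have [q [hq nq yq]] : exists q, [/\ q \in supp w, q != i0 & y q != 0].
  apply: contrapT => h; have ew : w = y i0.
    rewrite -sy (bigD1 i0) //= big1 ?addr0 // => i ni.
    apply/eqP/negPn/negP => nyi; apply: h; exists i; split=> //.
    by apply: contraR nyi => /oy ->.
  by move: hi0; rewrite inE {1}ew ry eqxx.
have c2 : (#|supp w| <= #|[set~ q]|)%N.
  apply: (leq_trans (wmin _ (yd q) yq)); apply: subset_leq_card.
  by apply/fintype.subsetP => i; rewrite !inE; apply: contra => /eqP ->; rewrite ry.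
have cC : #|[set~ q]| = e.-1 by rewrite cardsC1 card_ord.
rewrite cC in c2.
have [t [eI nt nti ntq tri]] := two_of_three e3 hi0 hq nq c2.
have sum3 (V : nmodType) (f : 'I_e -> V) : \sum_i f i = f i0 + f q + f t.
  rewrite (bigD1 i0) //= (bigD1 q) //= (bigD1 t) /= ?nti ?ntq //.
  rewrite big1 ?addr0 ?addrA // => i /andP [/andP [n1 n2] n3].
  by case: (tri i) => ei; rewrite ei eqxx in n1 n2 n3.
pose a := y i0; pose b := y q.
have yt : y t = 0 by exact: oy.
have ew : w = a + b by rewrite -sy sum3 yt addr0.
have ra : r i0 *: a = 0 by exact: ry.
have rb : r q *: b = 0 by exact: ry.
have rta : r t *: a = - (r t *: b).
  apply/eqP; rewrite -addr_eq0 -scalerDr -ew; exact/eqP/supp0.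
(* Functionals that kill U2 are those for which the coordinates of each vector
   of degree j have sum zero; by minimality of the support of w no vector of
   degree j is supported on a single point. *)
pose U2 (x : M) := exists2 m, m \in piece M j & x = l ^+ D *: m.
have [||||||F [hF Fw FU]] := functional_exists l1 l_inj (n := D%:Z + j)
    (U := U2) (v := r i0 *: w).
- by exists 0; [exact: piece0 (gm_direct M) _ | rewrite scaler0].
- move=> _ _ [m hm ->] [m' hm' ->]; exists (m + m'); last by rewrite scalerDr.
  exact: (pieceD (gm_direct M)).
- move=> c _ [m hm ->]; exists (sc c m); last by rewrite scC.
  exact: (gm_scaleC R_std).
- move=> _ [m hm ->]; apply: gm_scale => //; exact: (lX_deg R_std Hrho).
- exact: rd.
- move=> [m hm em].
  have rm i : i != i0 -> r i *: m = 0.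
    move=> ni; apply: (lX_inj l_inj (n := D)).
    by rewrite scalerA mulrC -scalerA -em r_orth_scale (negbTE ni).
  have : (2 <= 1)%N; last by [].
  have [m0|nm] := eqVneq m 0.
    by move: hi0; rewrite inE em m0 scaler0 eqxx.
  have := wmin m hm nm; rewrite eI cards2 eq_sym nq => /leq_trans; apply.
  rewrite -(cards1 i0); apply: subset_leq_card; apply/fintype.subsetP => i.
  by rewrite !inE; apply: contraR => /rm ->.
have F0 m : m \in piece M j -> F (r i0 *: m) + F (r q *: m) + F (r t *: m) = 0.
  move=> hm; rewrite -(sum3 _ (fun i => F (r i *: m))) -(functional_sum hF).
  rewrite -scaler_suml (r_sum R_std Hrho r_deg r_ev).
  by apply: FU; exists m.
have ad : a \in piece M j := yd i0.
have bd : b \in piece M j := yd q.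
have Fpb : F (r i0 *: b) = 1 by rewrite -Fw ew scalerDr ra add0r.
have Ftb : F (r t *: b) = -1.
  have := F0 b bd; rewrite Fpb rb (functional0 hF) addr0 => /eqP.
  by rewrite addrC addr_eq0 => /eqP.
have Fta : F (r t *: a) = 1.
  by rewrite rta -sub0r (functionalB hF) (functional0 hF) Ftb sub0r opprK.
have Fqa : F (r q *: a) = -1.
  have := F0 a ad; rewrite Fta ra (functional0 hF) add0r => /eqP.
  by rewrite addr_eq0 => /eqP.
have comb (c c' : k) : sc c b - sc c' a \in piece M j.
  by apply: (pieceB (gm_direct M)); exact: (gm_scaleC R_std).
have FN x : F (- x) = - F x.
  by rewrite -sub0r (functionalB hF) (functional0 hF) sub0r.
exists None.
apply: (lowest_degree_summand (j := j) (F := F) (i0 := i0)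
  (u := fun i => if i == i0 then b else if i == q then - a else a)) => //.
- move=> i; case: ifP => // _; case: ifP => // _.
  exact: (pieceN (gm_direct M)).
- move=> i _; case: (tri i) => ->; rewrite ?eqxx //.
    by rewrite (negbTE nq) scalerN FN Fqa opprK.
  by rewrite (negbTE nti) (negbTE ntq).
- move=> m hm; exists (sc (F (r i0 *: m)) b - sc (F (r q *: m)) a) => // i.
  rewrite finset.in_setT scalerBr !scC; case: (tri i) => ->; rewrite ?eqxx.
  + by rewrite ra scaler0 subr0.
  + by rewrite (negbTE nq) rb scaler0 sub0r !scalerN.
  rewrite (negbTE nti) (negbTE ntq) rta !scalerN opprK -scD.
  have /eqP := F0 m hm; rewrite addr_eq0 => /eqP ->.
  by rewrite scaleNr scaleNr.
- by move=> x hx; rewrite sum3 !finset.in_setT F0.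
- move=> c sc0'; exists (sc (c i0) b - sc (c q) a) => // i; rewrite finset.in_setT.
  rewrite scalerBr !scC (functionalB hF) !(functionalZ hF).
  case: (tri i) => ->.
  + by rewrite Fpb ra (functional0 hF) mulr1 mulr0 subr0.
  + by rewrite rb Fqa (functional0 hF) mulr0 mulrN1 opprK add0r.
  rewrite Ftb Fta mulrN1 mulr1; apply/eqP.
  by rewrite -opprD eq_sym -addr_eq0 addrC -(sum3 _ c) sc0'.
Qed.

End Module.
End Classification.

(** ** Reduction to the lowest degree *)

Section MaximalCohenMacaulay.
Variables (k : closedFieldType) (R : comAlgType k) (gR : nat -> {pred R}).
Hypothesis R_std : standard_graded gR.
Hypothesis R_dim1 : krull_dim R 1.
Variables (e : nat) (rho : 'I_e -> {rmorphism R -> {poly k}}) (l : R).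
Hypothesis Hrho : coordinates gR rho l.
Local Notation ev := (ev rho).
Local Notation pr := (hcomp (std_direct R_std)).

Lemma krull_dim_unique n : krull_dim R n -> n = 1%N.
Proof.
have [[p hp] hmax] := R_dim1; move=> [[q hq] hmax'].
by apply/eqP; rewrite eqn_leq (hmax _ _ hq) (hmax' _ _ hp).
Qed.

Lemma seq_smul_nil (M : lmodType R) (v : M) : (v \in seq_smul [::]) = (v == 0).
Proof.
apply/idP/eqP => [/asboolP [c ->]|->]; first by rewrite big_ord0.
by apply/asboolP; exists (fun=> 0); rewrite big_ord0.
Qed.

(** All forms of large degree are multiples of [l], so that a nonzero element
    killed by [l] would be killed by a power of every element of the irrelevant
    ideal, which contains a nonzerodivisor on [M]. *)
Lemma mcm_torsion_free (M : graded_module gR) : graded_MCM M ->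
  forall v : M, l *: v = 0 -> v = 0.
Proof.
move=> [_ [n /krull_dim_unique -> [[[|a [|b s]] // [sub reg _] _] _]]] v lv.
have [r [r_deg r_ev]] := separators R_std Hrho (@inj_id 'I_e).
have ha : ord_ge R_std 1 a.
  have /(irrelevantP R_std) h := sub a (mem_head _ _).
  by case.
have a_inj (u : M) : a *: u = 0 -> u = 0.
  move=> au; have := reg 0%N isT u; rewrite /= !seq_smul_nil au eqxx => /(_ isT).
  by move/eqP.
have big x : ord_ge R_std e.-1.+1 x -> x *: v = 0.
  move=> hx; have [N hN] := hcomp_bounded R_std x.
  rewrite (hcomp_sum_lt hN) scaler_suml big1 // => d _.
  have [lt|ge] := ltnP d e.-1.+1; first by rewrite hx // scale0r.
  have hd := hcomp_in (std_direct R_std) d x.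
  have [|y hy ey] := ev_surj R_std Hrho r_deg r_ev (d := d.-1) (fun i => ev i (pr d x)).
    by lia.
  have -> : pr d x = y * l.
    apply: (ev_inj Hrho hd) => [|i]; last by rewrite (evE Hrho) (ev_l Hrho) mulr1 ey.
    rewrite -[X in gR X](prednK (leq_ltn_trans (leq0n _) ge)) -addn1.
    exact: (std_mul R_std hy (coord_l1 Hrho)).
  by rewrite -scalerA lv scaler0.
have : a ^+ e.-1.+1 *: v = 0 by apply: big; exact: ord_ge_exp.
elim: (e.-1.+1) => [|m IH]; first by rewrite expr0 scale1r.
by rewrite exprS -scalerA => /a_inj.
Qed.

Lemma fin_gen_bounded_below (M : graded_module gR) : fin_gen (predT : {pred M}) ->
  exists B : int, forall n v, n < B -> v \in piece M n -> v = 0.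
Proof.
move=> [s hs].
have bd (i : 'I_(size s)) := cid (co_bounded s`_i).
pose N := \max_(i < size s) sval (bd i).
exists (- N%:Z) => n v nN hv.
have : v \in lspan s by rewrite -hs.
move=> /asboolP [c ev].
rewrite -[v](hcomp_id (gm_direct M) hv) ev hcomp_bigsum big1 // => i _.
have [m hm] := hcomp_bounded R_std (c i).
rewrite (hcomp_sum_lt hm) scaler_suml hcomp_bigsum big1 // => d _.
have hd := hcomp_in (std_direct R_std) d (c i).
have -> : n = d%:Z + (n - d%:Z) by rewrite addrC subrK.
rewrite (co_scale _ _ hd) (svalP (bd i)) ?scaler0 //.
have : (sval (bd i) <= N)%N by exact: leq_bigmax.
by move: nN; clearbody N; lia.
Qed.

(** The reduction to the lowest degree, together with the two ways in which the
    idempotents may act: through [R_1] if it is all of [k^e], and otherwise on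
    every module without a free summand. *)
Lemma finite_type_at_most_three : (e <= 3)%N ->
  (forall c, ring_model gR rho 1 c) \/
  (e = 3%N /\ exists2 tau : 'I_e -> k, forall i, tau i != 0 &
     forall c, \sum_i tau i * c i = 0 <-> ring_model gR rho 1 c) ->
  graded_finite_CM_type gR.
Proof.
move=> e3 hcase.
have [r [r_deg r_ev]] := separators R_std Hrho (@inj_id 'I_e).
pose T (a : option (option {set 'I_e})) :=
  if a is Some b then over_model b else ring_model gR rho.
apply: (finite_type_of_models R_std (T := T)) => M hM iM.
have l_inj := mcm_torsion_free hM.
have [over|nover] := pselect (overring_closed l e.-1 r M); last first.
  exists None; case: hcase => [full|[ee [tau ntau htau]]].
    case: nover => n v i hv.
    have [y hy ey] := full (fun j => (j == i)%:R).
    exists (y *: v); first by rewrite addrC; exact: gm_scale.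
    rewrite scalerA; congr (_ *: _); apply: (ev_inj Hrho (d := e.-1.+1)).
    - rewrite -addn1; apply: (std_mul R_std) => //; exact: (lX_deg R_std Hrho).
    - rewrite -add1n; apply: (std_mul R_std) => //; exact: (coord_l1 Hrho).
    - by move=> j; rewrite !(evE Hrho) ey r_ev.
  apply: (free_summand R_std Hrho r_deg r_ev l_inj iM (tau := tau)) => //.
  by rewrite ee.
have [B hB] := fin_gen_bounded_below hM.1.
have [j hj nz] : exists2 j : int, forall n v, n < j -> v \in piece M n -> v = 0 &
    exists2 v, v \in piece M j & v != 0.
  pose P m := `[< exists2 v, v \in piece M (B + m%:Z) & v != 0 >].
  have exP : exists m, P m.
    have [[v nv] _] := iM.
    have [n nn] : exists n, hcomp (gm_direct M) n v != 0.
      apply: contrapT => h; case/eqP: nv; apply: (hcomp_eq0 (hg := gm_direct M)).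
      by move=> n; apply/eqP/negPn/negP => hn; apply: h; exists n.
    have hn := hcomp_in (gm_direct M) n v.
    have [lt|ge] := boolP ((n : int) < B); first by rewrite (hB _ _ lt hn) eqxx in nn.
    exists (absz (n - B)%R); apply/asboolP; exists (hcomp (gm_direct M) n v) => //.
    by rewrite (_ : B + _ = n) //; lia.
  case: (ex_minnP exP) => m /asboolP hm mmin.
  exists (B + m%:Z) => // n v lt hv; apply/eqP/negPn/negP => nv.
  have [lt'|ge] := boolP ((n : int) < B).
    by rewrite (hB _ _ lt' hv) eqxx in nv.
  have en : n = B + (absz (n - B)%R)%:Z by lia.
  have : (m <= absz (n - B)%R)%N.
    by apply: mmin; apply/asboolP; exists v; rewrite // -en.
  by move: lt ge; clear; lia.
have [a ha] := overring_classification R_std Hrho r_deg r_ev l_inj iM over e3 hj nz.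
by exists (Some a).
Qed.

End MaximalCohenMacaulay.

(** * Four points: a one-parameter family of modules *)

Section Submodule.
Variables (R : comNzRingType) (V : lmodType R) (S : {pred V}).
Hypothesis hS : submod_closed S.

(** Indexed by the proof of closure, which is attached to it as a structure. *)
Definition submodule_pred of submod_closed S : {pred V} := S.

HB.instance Definition _ :=
  GRing.isSubmodClosed.Build R V (submodule_pred hS) (GRing.submod_closed_semi hS).

Definition submodule := {v : V | v \in submodule_pred hS}.

HB.instance Definition _ := [Choice of submodule by <:].
HB.instance Definition _ := SubChoice.on submodule.
HB.instance Definition _ := [SubChoice_isSubZmodule of submodule by <:].
HB.instance Definition _ := [SubZmodule_isSubLmodule of submodule by <:].

End Submodule.

Section PointModule.
Variables (k : fieldType) (R : comNzRingType) (n : nat).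

(** [k[X]^n] as a module over [R] by means of [n] homomorphisms to [k[X]]. *)
Definition point_module of ('I_n -> {rmorphism R -> {poly k}}) :=
  {ffun 'I_n -> {poly k}}.

Variable rho : 'I_n -> {rmorphism R -> {poly k}}.
Local Notation L := (point_module rho).

HB.instance Definition _ := GRing.Zmodule.copy L {ffun 'I_n -> {poly k}}.

Definition point_scale (r : R) (f : L) : L := [ffun i => rho i r * f i].

Fact point_scaleA a b f : point_scale a (point_scale b f) = point_scale (a * b) f.
Proof. by apply/ffunP => i; rewrite !ffunE rmorphM mulrA. Qed.
Fact point_scale1 : left_id 1 point_scale.
Proof. by move=> f; apply/ffunP => i; rewrite ffunE rmorph1 mul1r. Qed.
Fact point_scaleDr : right_distributive point_scale +%R.
Proof. by move=> a f g; apply/ffunP => i; rewrite !ffunE mulrDr. Qed.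
Fact point_scaleDl f : {morph point_scale^~ f : a b / a + b}.
Proof. by move=> a b; apply/ffunP => i; rewrite !ffunE rmorphD mulrDl. Qed.

HB.instance Definition _ := GRing.Zmodule_isLmodule.Build R L
  point_scaleA point_scale1 point_scaleDr point_scaleDl.

End PointModule.

Lemma direct_sum_of_projections (I : choiceType) (V : zmodType) (p : I -> V -> V) :
  (forall i x y, p i (x - y) = p i x - p i y) ->
  (forall i j x, p j (p i x) = if j == i then p i x else 0) ->
  (forall x, exists s : seq I, [/\ uniq s, x = \sum_(i <- s) p i x
     & forall i, i \notin s -> p i x = 0]) ->
  direct_sum (fun i => [pred x | p i x == x]).
Proof.
move=> pB pp fin.
have p0 i : p i 0 = 0 by have := pB i 0 0; rewrite !subrr.
have pD i : {morph p i : x y / x + y}.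
  by move=> x y; rewrite -{1}[y]opprK pB -[- y]sub0r pB p0 sub0r opprK.
have psum i J (s : seq J) (F : J -> V) : p i (\sum_(j <- s) F j) = \sum_(j <- s) p i (F j).
  exact: (big_morph _ (pD i) (p0 i)).
split=> [i|x].
  split; first by rewrite inE p0.
  by move=> x y /eqP hx /eqP hy; rewrite inE pB hx hy.
have [s [us ex hs]] := fin x.
pose f : {fsfun I -> V with 0} := [fsfun i in [fset i | i in s]%fset => p i x].
have fE j : f j = p j x.
  rewrite fsfunE; case: ifPn => // hj; rewrite hs //.
  by apply: contra hj => hj; rewrite !inE.
exists f; split.
  split=> [i|]; first by rewrite fE inE pp eqxx.
  rewrite (eq_bigr (fun j => p j x)) => [|j _]; last by rewrite fE.
  have sub : {subset finsupp f <= s}.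
    move=> j; apply: contraTT => /hs hj; rewrite mem_finsupp fE hj eqxx //.
  rewrite {1}ex (bigID (mem (finsupp f))) /= [X in _ + X]big1 ?addr0 => [|j].
    rewrite -big_filter; apply: perm_big; apply: uniq_perm.
    - exact: filter_uniq.
    - exact: fset_uniq.
    - move=> j; rewrite mem_filter; case hj: (j \in finsupp f) => //=.
      by rewrite sub.
  by rewrite mem_finsupp negbK fE => /eqP.
move=> f' [hf' ex']; apply/fsfunP => j; rewrite fE ex' psum.
have E i : p j (f' i) = if j == i then f' i else 0.
  by have /eqP e := hf' i; rewrite -{1}e pp e.
have [hj|nj] := boolP (j \in finsupp f').
  rewrite (bigD1_seq j) //= ?fset_uniq // E eqxx big1 ?addr0 // => i ni.
  by rewrite E eq_sym (negbTE ni).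
rewrite big_seq big1 => [|i hi]; first by rewrite fsfun_dflt.
by rewrite E; case: eqP => // ej; rewrite ej hi in nj.
Qed.

Section Family.
Variables (k : closedFieldType) (R : comAlgType k) (gR : nat -> {pred R}).
Hypothesis R_std : standard_graded gR.
Hypothesis R_dim1 : krull_dim R 1.
Variables (rho : 'I_4 -> {rmorphism R -> {poly k}}) (l : R) (s : 'I_4 -> R).
Hypothesis l_deg : l \in gR 1%N.
Hypothesis rho_l : forall i, rho i l = 'X.
Hypothesis rhoC : forall i (c : k), rho i c%:A = c%:P.
Hypothesis rho_hom : forall i d r, r \in gR d -> exists c, rho i r = c *: 'X^d.
Hypothesis s_rho : forall i j, rho j (s i) = (j == i)%:R *: 'X^3.

Local Notation pr := (hcomp (std_direct R_std)).

Lemma rho_coef0 i r : pr 0%N r = ((rho i r)`_0)%:A.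
Proof.
elim/(std_ind R_std): r => [c|y hy|u v hu hv|u v hu hv].
- by rewrite hcomp_id ?(scalar_deg0 R_std) // rhoC coefC.
- have [c ->] := rho_hom i hy; rewrite (hcomp_piece _ _ hy) coefZ coefXn.
  by rewrite mulr0 scale0r.
- by rewrite rmorphD coefD scalerDl hcompD hu hv.
by rewrite rmorphM coef0M hcompM big_ord1 hu hv -scalerAl mul1r scalerA.
Qed.

Lemma rho_coef0_eq i j r : (rho i r)`_0 = (rho j r)`_0.
Proof.
have := congr1 (rho i) (rho_coef0 i r); rewrite (rho_coef0 j r) !rhoC.
by move/polyC_inj.
Qed.

Definition at_l (f : {poly k}) : R := (map_poly (in_alg R) f).[l].

Lemma rho_at_l i f : rho i (at_l f) = f.
Proof.
rewrite /at_l -horner_map /= rho_l -map_poly_comp /=.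
rewrite (eq_map_poly (g := polyC)) => [|c] /=; last by rewrite rhoC.
exact: comp_polyXr.
Qed.

Let i0 : 'I_4 := inord 0.
Let i1 : 'I_4 := inord 1.
Let i2 : 'I_4 := inord 2.
Let i3 : 'I_4 := inord 3.

Section Member.
Variable lam : k.

(** On this plane the coordinates restrict to the functionals [a], [b], [a + b]
    and [a + lam b], which are four points of a projective line with cross ratio
    [lam]. *)
Definition in_plane (c : 'I_4 -> k) :=
  (c i2 == c i0 + c i1) && (c i3 == c i0 + lam * c i1).

Definition plane_start : {pred point_module rho} :=
  fun f => in_plane (fun i => (f i)`_0).

Lemma plane_start_closed : submod_closed plane_start.
Proof.
split; first by rewrite unfold_in /in_plane !ffunE !coef0 mulr0 addr0 eqxx.
move=> a u v; rewrite !unfold_in /in_plane => /andP [/eqP hu2 /eqP hu3].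
move=> /andP [/eqP hv2 /eqP hv3]; rewrite !ffunE !coefD !coef0M.
rewrite !(rho_coef0_eq _ i0 a) hu2 hu3 hv2 hv3; apply/andP; split; apply/eqP; ring.
Qed.

Definition fmod := submodule plane_start_closed.

Definition entry (x : fmod) (i : 'I_4) : {poly k} := (val x : {ffun _ -> _}) i.

Lemma entry_eq x y : (forall i, entry x i = entry y i) -> x = y.
Proof. by move=> h; apply/val_inj/ffunP. Qed.
Lemma entryD x y i : entry (x + y) i = entry x i + entry y i.
Proof. by rewrite /entry raddfD ffunE. Qed.
Lemma entry0 i : entry 0 i = 0.
Proof. by rewrite /entry raddf0 ffunE. Qed.
Lemma entryB x y i : entry (x - y) i = entry x i - entry y i.
Proof. by rewrite /entry raddfB !ffunE. Qed.
Lemma entryZ r x i : entry (r *: x) i = rho i r * entry x i.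
Proof. by rewrite /entry linearZ ffunE. Qed.
Lemma entry_sum J (t : seq J) (F : J -> fmod) i :
  entry (\sum_(j <- t) F j) i = \sum_(j <- t) entry (F j) i.
Proof. exact: (big_morph (entry^~ i) (fun x y => entryD x y i) (entry0 i)). Qed.

Lemma entry_plane x : in_plane (fun i => (entry x i)`_0).
Proof. exact: (valP x). Qed.

Lemma entry_make (F : 'I_4 -> {poly k}) : in_plane (fun i => (F i)`_0) ->
  exists x : fmod, forall i, entry x i = F i.
Proof.
move=> hF; have h : (finfun F : point_module rho) \in submodule_pred plane_start_closed.
  by move: hF; rewrite unfold_in /submodule_pred /plane_start /in_plane !ffunE.
by exists (Sub (finfun F : point_module rho) h : fmod) => i; rewrite /entry SubK ffunE.
Qed.

Definition make F hF := sval (cid (@entry_make F hF)).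
Lemma makeE F hF i : entry (@make F hF) i = F i.
Proof. exact: (svalP (cid (entry_make hF))). Qed.

Lemma make_subproof (c : 'I_4 -> {poly k}) : in_plane (fun i => ('X * c i)`_0).
Proof. by rewrite /in_plane !coefXM /= mulr0 addr0 eqxx. Qed.

Definition makeX (c : 'I_4 -> {poly k}) : fmod := make (make_subproof c).
Lemma makeXE c i : entry (makeX c) i = 'X * c i.
Proof. exact: makeE. Qed.

Definition comp_fun (n : int) (x : fmod) (i : 'I_4) : {poly k} :=
  if n is Posz m then (entry x i)`_m *: 'X^m else 0.

Lemma comp_fun_plane n x : in_plane (fun i => (comp_fun n x i)`_0).
Proof.
rewrite /in_plane /comp_fun; case: n => [[|m]|m]; last first.
- by rewrite coef0 mulr0 addr0 eqxx.
- by rewrite !coefZ !coefXn /= !mulr0 addr0 eqxx.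
by rewrite !coefZ !coefXn /= !mulr1; exact: entry_plane.
Qed.

Definition fcomp n x : fmod := make (comp_fun_plane n x).
Lemma fcompE n x i : entry (fcomp n x) i = comp_fun n x i.
Proof. exact: makeE. Qed.

Definition fpiece (n : int) : {pred fmod} := [pred x | fcomp n x == x].

Lemma fpieceP (m : nat) x : reflect (exists c : 'I_4 -> k, forall i, entry x i = c i *: 'X^m)
  (x \in fpiece m%:Z).
Proof.
apply: (iffP eqP) => [<-|[c hc]].
  by exists (fun i => (entry x i)`_m) => i; rewrite fcompE.
by apply: entry_eq => i; rewrite fcompE /= hc coefZ coefXn eqxx mulr1.
Qed.

Lemma fpiece_neg (m : nat) x : x \in fpiece (Negz m) -> x = 0.
Proof. by move=> /eqP <-; apply: entry_eq => i; rewrite fcompE entry0. Qed.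

Lemma fpiece_direct : direct_sum fpiece.
Proof.
apply: direct_sum_of_projections => [n x y|n m x|x].
- apply: entry_eq => i; rewrite entryB !fcompE /comp_fun; case: n => m.
    by rewrite entryB coefB scalerBl.
  by rewrite subrr.
- have [->|nmn] := eqVneq m n.
    apply: entry_eq => i; rewrite !fcompE /comp_fun; case: n => // n.
    by rewrite fcompE coefZ coefXn eqxx mulr1.
  apply: entry_eq => i; rewrite entry0 fcompE /comp_fun; case: m nmn => // m nmn.
  rewrite fcompE /comp_fun; case: n nmn => [n|n] nmn; last by rewrite coef0 scale0r.
  rewrite coefZ coefXn; have -> : (m == n) = false by apply: contraNF nmn => /eqP ->.
  by rewrite mulr0 scale0r.
pose N := (\max_(i < 4) size (entry x i))%N.
exists [seq Posz m | m <- iota 0 N]; split.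
- by rewrite map_inj_uniq ?iota_uniq // => a b [].
- apply: entry_eq => i; rewrite entry_sum big_map.
  rewrite -[LHS]coefK poly_def.
  under [RHS]eq_bigr do rewrite fcompE /=.
  have le : (size (entry x i) <= N)%N by exact: (leq_bigmax i).
  have -> : iota 0 N = index_iota 0 N by rewrite /index_iota subn0.
  rewrite (@big_cat_nat _ _ _ (size (entry x i)) 0 N) //= big_mkord.
  rewrite [X in _ + X]big_nat [X in _ + X]big1 ?addr0 // => m /andP [hm _].
  by rewrite nth_default // scale0r.
case=> [m|m] hm; last by apply: entry_eq => i; rewrite fcompE entry0.
apply: entry_eq => i; rewrite fcompE entry0 /= nth_default ?scale0r //.
rewrite leqNgt; apply: contra hm => hm; apply: map_f; rewrite mem_iota /=.
exact: leq_trans hm (leq_bigmax i).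
Qed.

Lemma fmod_graded : is_graded_module gR fpiece.
Proof.
split=> [|d n r v hr hv]; first exact: fpiece_direct.
case: n hv => [m|m] hv; last first.
  by rewrite (fpiece_neg hv) scaler0; exact: piece0 fpiece_direct _.
have /fpieceP [c hc] := hv; apply/fpieceP.
exists (fun i => (sval (cid (rho_hom i hr))) * c i) => i; rewrite entryZ hc.
case: cid => a /= ->.
by rewrite -scalerAr -scalerAl scalerA mulrC -exprD.
Qed.

Definition family_module : graded_module gR := GradedModule fmod_graded.

Local Notation Mlam := family_module.

(** The vectors [(1, 0, 1, 1)] and [(0, 1, 1, lam)] span the plane. *)
Definition base1 (i : 'I_4) : k := [:: 1; 0; 1; 1]`_i.
Definition base2 (i : 'I_4) : k := [:: 0; 1; 1; lam]`_i.

Lemma base1_plane : in_plane (fun i => ((base1 i)%:P)`_0).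
Proof. by rewrite /in_plane !coefC /= /base1 !inordK //= !(addr0, mulr0) eqxx. Qed.
Lemma base2_plane : in_plane (fun i => ((base2 i)%:P)`_0).
Proof.
by rewrite /in_plane !coefC /= /base2 !inordK //= !(add0r, mulr1) !eqxx.
Qed.

Definition gen1 : fmod := make base1_plane.
Definition gen2 : fmod := make base2_plane.
Lemma gen1E i : entry gen1 i = (base1 i)%:P. Proof. exact: makeE. Qed.
Lemma gen2E i : entry gen2 i = (base2 i)%:P. Proof. exact: makeE. Qed.

Definition axis (i : 'I_4) : fmod := makeX (fun j => (j == i)%:R).
Lemma axisE i j : entry (axis i) j = (j == i)%:R *: 'X.
Proof. by rewrite makeXE; case: eqP => _; rewrite ?mulr1 ?scale1r ?mulr0 ?scale0r. Qed.

Lemma gen1_neq0 : gen1 != 0.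
Proof.
apply/eqP => /(congr1 (fun x => entry x i0)); rewrite gen1E entry0 /base1 inordK //=.
by move/eqP; rewrite oner_eq0.
Qed.

Lemma ord4P (P : 'I_4 -> Prop) : P i0 -> P i1 -> P i2 -> P i3 -> forall i, P i.
Proof.
move=> h0 h1 h2 h3 i; rewrite -[i]inord_val; have := ltn_ord i.
by case: (nat_of_ord i) => [|[|[|[|m]]]].
Qed.

Lemma fmod_fin_gen : fin_gen (predT : {pred Mlam}).
Proof.
exists [:: gen1; gen2; axis i0; axis i1; axis i2; axis i3] => x.
apply/esym/asboolP; rewrite /=.
have dec (p : {poly k}) : exists q, p = (p`_0)%:P + 'X * q.
  exists (\poly_(m < (size p).-1) p`_m.+1); apply/polyP => m.
  rewrite coefD coefC coefXM; case: m => [|m] /=; first by rewrite addr0.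
  rewrite add0r coef_poly; case: ltnP => // h; rewrite nth_default //; lia.
pose q i := sval (cid (dec (entry x i))).
have qE i : entry x i = ((entry x i)`_0)%:P + 'X * q i.
  exact: (svalP (cid (dec (entry x i)))).
exists (fun j => [:: ((entry x i0)`_0)%:A; ((entry x i1)`_0)%:A; at_l (q i0);
                     at_l (q i1); at_l (q i2); at_l (q i3)]`_j).
rewrite !big_ord_recl big_ord0 /= addr0.
apply: entry_eq => i; rewrite !entryD !entryZ !axisE !rho_at_l gen1E gen2E !rhoC.
have /andP [/eqP p2 /eqP p3] := entry_plane x.
have ne a b : (a < 4)%N -> (b < 4)%N -> ((inord a : 'I_4) == inord b) = (a == b).
  by move=> ha hb; rewrite -val_eqE /= !inordK.
rewrite {1}qE; move: i; apply: ord4P; rewrite /base1 /base2 !ne // ?inordK //=;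
  rewrite ?p2 ?p3 ?polyCD ?polyCM -?mul_polyC; ring.
Qed.

Lemma l_fmod_inj (v : Mlam) : l *: v = 0 -> v = 0.
Proof.
move=> lv; apply: entry_eq => i; have := congr1 (fun x => entry x i) lv.
rewrite entryZ rho_l !entry0 => /eqP; rewrite mulf_eq0 polyX_eq0 /=.
by move/eqP.
Qed.

(** The vector [(0, 0, 1, 0)] does not belong to the module, but its multiples
    by elements of the irrelevant ideal do.  For two such elements [a], [b],
    the multiple by [a] shows that [b] is a zerodivisor modulo [a]. *)
Lemma fmod_MCM : graded_MCM Mlam.
Proof.
split; first exact: fmod_fin_gen.
exists 1%N => //.
have irr0 a i : a \in irrelevant_ideal gR -> (rho i a)`_0 = 0.
  move=> /(irrelevantP R_std) h; have := rho_coef0 i a; rewrite h.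
  by move=> /(congr1 (rho i)); rewrite rmorph0 rhoC => /esym/polyC_inj.
split.
  exists [:: l] => //; split.
  - move=> a; rewrite inE => /eqP ->; apply/(irrelevantP R_std).
    by rewrite (hcomp_piece _ _ l_deg).
  - case=> // _ v /=; rewrite !seq_smul_nil => /eqP /l_fmod_inj ->.
    by rewrite eqxx.
  exists gen1; apply/negP => /asboolP [v]; rewrite big_ord1 /=.
  move/(congr1 (fun x => (entry x i0)`_0)); rewrite entryZ gen1E rho_l coefXM coefC /=.
  by rewrite /base1 inordK //= => /eqP; rewrite oner_eq0.
move=> [|a [|b t]] // [sub reg _]; exfalso.
have ha : a \in irrelevant_ideal gR by apply: sub; rewrite inE eqxx.
have hb : b \in irrelevant_ideal gR by apply: sub; rewrite !inE eqxx orbT.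
have a_inj (v : Mlam) : a *: v = 0 -> v = 0.
  move=> av; have := reg 0%N isT v; rewrite /= !seq_smul_nil av eqxx => /(_ isT).
  by move/eqP.
have rho_a i : rho i a != 0.
  apply/eqP => h; have : axis i = 0.
    apply: a_inj; apply: entry_eq => j; rewrite entryZ axisE entry0.
    by case: eqP => [->|_]; rewrite ?h ?mul0r // scale0r mulr0.
  move/(congr1 (fun x => entry x i)); rewrite axisE eqxx scale1r entry0.
  by move/eqP; rewrite polyX_eq0.
(* multiples of the vector (0, 0, 1, 0) outside the module *)
have mem c : c \in irrelevant_ideal gR ->
    exists x : fmod, forall i, entry x i = rho i c * (i == i2)%:R.
  move=> hc; apply: entry_make.
  by rewrite /in_plane !coef0M !(irr0 _ _ hc) !mul0r mulr0 addr0 eqxx.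
have [v hv] := mem a ha; have [w hw] := mem b hb.
have := reg 1%N isT v; rewrite /= => H.
have /asboolP [u] : v \in seq_smul [:: a].
  apply: H; apply/asboolP; exists (fun=> w); rewrite big_ord1 /=.
  by apply: entry_eq => i; rewrite !entryZ hv hw mulrCA.
rewrite big_ord1 /= => ev; pose u0 := u ord0.
have uE i : entry u0 i = (i == i2)%:R.
  apply: (mulfI (rho_a i)); rewrite -hv ev entryZ //.
have := entry_plane u0; rewrite /in_plane !uE eqxx.
have -> : (i0 == i2) = false by apply/eqP => /(congr1 val) /=; rewrite !inordK.
have -> : (i1 == i2) = false by apply/eqP => /(congr1 val) /=; rewrite !inordK.
by rewrite coef0 addr0 coef1 oner_eq0.
Qed.

Definition axis3 (i : 'I_4) : fmod := makeX (fun j => (j == i)%:R *: 'X^2).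
Lemma axis3E i j : entry (axis3 i) j = (j == i)%:R *: 'X^3.
Proof. by rewrite makeXE -scalerAr -exprS. Qed.

Lemma s_scale i (x : fmod) : s i *: x = at_l (entry x i) *: axis3 i.
Proof.
apply: entry_eq => j; rewrite !entryZ s_rho axis3E rho_at_l.
by case: eqP => [->|_]; [rewrite mulrC | rewrite !scale0r mul0r mulr0].
Qed.

Lemma at_l_scale_eq0 f i : at_l f *: axis3 i = 0 -> f = 0.
Proof.
move/(congr1 (fun x => entry x i)); rewrite entryZ rho_at_l axis3E entry0 eqxx scale1r.
by move/eqP; rewrite mulf_eq0 expf_eq0 polyX_eq0 /= orbF => /eqP.
Qed.

(** The summands are spanned by coordinate axes after inverting [l].  The
    corresponding diagonal projection preserves the plane, which is possible
    only if it is trivial. *)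
Lemma fmod_indecomposable : indecomposable Mlam.
Proof.
split; first by exists gen1; exact: gen1_neq0.
move=> N1 N2 [[N10 N1L] _] [[N20 N2L] _] disj cov.
have N1Z r x : x \in N1 -> r *: x \in N1 by move=> h; rewrite -[_ *: _]addr0 N1L.
have N2Z r x : x \in N2 -> r *: x \in N2 by move=> h; rewrite -[_ *: _]addr0 N2L.
have N2N x : x \in N2 -> - x \in N2 by rewrite -scaleN1r; exact: N2Z.
have ax i : axis3 i \in N1 \/ axis3 i \in N2.
  have [n1 [n2 [h1 h2 en]]] := cov (axis3 i).
  have off j : j != i -> entry n1 j = 0.
    move=> nji; have : s j *: n1 = 0.
      apply: disj; first exact: N1Z.
      have -> : s j *: n1 = - (s j *: n2); last by apply/N2N/N2Z.
      apply/eqP; rewrite -addr_eq0 -scalerDr -en s_scale axis3E (negbTE nji) scale0r.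
      by apply/eqP/entry_eq => m; rewrite entryZ rho_at_l mul0r entry0.
    by rewrite s_scale => /at_l_scale_eq0.
  have E1 : 'X^3 = entry n1 i + entry n2 i.
    by rewrite -entryD -en axis3E eqxx scale1r.
  have off2 j : j != i -> entry n2 j = 0.
    move=> nji; have := congr1 (fun x => entry x j) en.
    by rewrite entryD off // add0r axis3E (negbTE nji) scale0r.
  have : at_l (entry n2 i) *: n1 = 0.
    apply: disj; first exact: N1Z.
    have -> : at_l (entry n2 i) *: n1 = at_l (entry n1 i) *: n2; last exact: N2Z.
    apply: entry_eq => j; rewrite !entryZ !rho_at_l.
    by have [->|nji] := eqVneq j i; [rewrite mulrC | rewrite (off j nji) (off2 j nji) !mulr0].
  move/(congr1 (fun x => entry x i)); rewrite entryZ rho_at_l entry0 => /eqP.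
  rewrite mulf_eq0 => /orP [] /eqP z.
    left; suff -> : axis3 i = n1 by [].
    rewrite en; have -> : n2 = 0; last by rewrite addr0.
    apply: entry_eq => j; rewrite entry0.
    by have [->//|] := eqVneq j i; exact: off2.
  right; suff -> : axis3 i = n2 by [].
  rewrite en; have -> : n1 = 0; last by rewrite add0r.
  apply: entry_eq => j; rewrite entry0.
  by have [->//|] := eqVneq j i; exact: off.
have z1 i x : axis3 i \in N1 -> x \in N2 -> entry x i = 0.
  move=> hi hx; apply: (@at_l_scale_eq0 _ i); rewrite -s_scale.
  by apply: disj; [rewrite s_scale; exact: N1Z | exact: N2Z].
have z2 i x : axis3 i \in N2 -> x \in N1 -> entry x i = 0.
  move=> hi hx; apply: (@at_l_scale_eq0 _ i); rewrite -s_scale.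
  by apply: disj; [exact: N1Z | rewrite s_scale; exact: N2Z].
(* the diagonal projection onto N1 *)
pose beta i : k := (axis3 i \in N1)%:R.
have split_base (x : fmod) : in_plane (fun i => beta i * (entry x i)`_0).
  have [u1 [u2 [h1 h2 eu]]] := cov x.
  have := entry_plane u1; rewrite /in_plane.
  have E i : (entry u1 i)`_0 = beta i * (entry x i)`_0.
    rewrite /beta; case hi: (axis3 i \in N1).
      by rewrite mul1r eu entryD (z1 i u2) // addr0.
    by case: (ax i) => [|h]; rewrite ?hi // (z2 i u1) // coef0 mul0r.
  by rewrite !E.
have := split_base gen1; have := split_base gen2.
rewrite /in_plane !gen1E !gen2E !coefC /= /base1 /base2 !inordK //=.
rewrite !mulr0 !mulr1 !(addr0, add0r) => /andP [/eqP b21 _] /andP [/eqP b20 /eqP b30].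
have ball i : beta i = beta i0.
  by move: i; apply: ord4P; rewrite ?b21 ?b20 ?b30 // -b20.
have [h|h] := boolP (axis3 i0 \in N1).
  right=> v hv; apply: entry_eq => i; rewrite entry0 (z1 i) //.
  have := ball i; rewrite /beta h; case: (_ \in N1) => // /eqP.
  by rewrite eq_sym oner_eq0.
left=> v hv; apply: entry_eq => i; rewrite entry0 (z2 i) //.
case: (ax i) => // hi; have := ball i; rewrite /beta hi (negbTE h) => /eqP.
by rewrite oner_eq0.
Qed.

End Member.

(** Isomorphisms act on the coordinates by diagonal matrices, and such a matrix
    maps one plane onto another one only if the cross ratios are equal. *)
Lemma family_separated lam mu (h : fmod lam -> fmod mu) (g : fmod mu -> fmod lam)
    (delta : int) :
  (forall r x, h (r *: x) = r *: h x) -> (forall r x, g (r *: x) = r *: g x) ->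
  cancel h g -> cancel g h ->
  (forall n x, x \in fpiece n -> h x \in fpiece (n + delta)) ->
  (forall n x, x \in fpiece n -> g x \in fpiece (n - delta)) ->
  lam = mu.
Proof.
move=> hZ gZ hg gh hdeg gdeg.
have h0 : h 0 = 0 by rewrite -(scale0r (0 : fmod lam)) hZ scale0r.
have g0 : g 0 = 0 by rewrite -(scale0r (0 : fmod mu)) gZ scale0r.
have gen_deg nu : gen1 nu \in fpiece 0.
  apply/(fpieceP 0); exists base1 => i; rewrite gen1E expr0.
  by rewrite -[RHS]mul_polyC mulr1.
have d0 : delta = 0.
  have h1 := hdeg _ _ (gen_deg lam); have h2 := gdeg _ _ (gen_deg mu).
  rewrite sub0r in h2; rewrite add0r in h1.
  case: (delta) h1 h2 => [[|m]|m] // h1 h2.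
    have := gen1_neq0 mu; rewrite -(gh (gen1 mu)).
    by rewrite (fpiece_neg (m := m) h2) h0 eqxx.
  have := gen1_neq0 lam; rewrite -(hg (gen1 lam)).
  by rewrite (fpiece_neg h1) g0 eqxx.
have ex i : exists c : k, c != 0 /\ forall x, entry (h x) i = c *: entry x i.
  have a3 : axis3 lam i \in fpiece 3%:Z.
    by apply/fpieceP; exists (fun j => (j == i)%:R) => j; exact: axis3E.
  have := hdeg _ _ a3; rewrite d0 addr0 => /fpieceP [c hc].
  have E x : entry (h x) i = c i *: entry x i.
    have := hZ (s i) x; rewrite s_scale hZ => /(congr1 (fun y => entry y i)).
    rewrite !entryZ rho_at_l s_rho hc eqxx scale1r -scalerAr mulrC scalerAr.
    have X3 : ('X^3 : {poly k}) != 0 by rewrite expf_eq0 polyX_eq0.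
    by move/(mulfI X3) => <-.
  exists (c i); split=> //; apply/eqP => ci.
  have : axis3 lam i = 0.
    rewrite -[axis3 lam i]hg (_ : h _ = 0) ?g0 //; apply: entry_eq => j.
    rewrite entry0 hc; have [->|nji] := eqVneq j i; first by rewrite ci scale0r.
    have := hZ (s j) (axis3 lam i); rewrite s_scale axis3E (negbTE nji) scale0r.
    have -> : at_l 0 *: axis3 lam j = 0.
      by apply: entry_eq => m; rewrite entryZ rho_at_l mul0r entry0.
    rewrite h0 => /(congr1 (fun y => entry y j)); rewrite entryZ entry0 s_rho eqxx.
    rewrite scale1r -hc => /esym /eqP.
    by rewrite mulf_eq0 expf_eq0 polyX_eq0 /= => /eqP.
  move/(congr1 (fun y => entry y i)); rewrite axis3E eqxx scale1r entry0.
  by move/eqP; rewrite expf_eq0 polyX_eq0.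
pose c i := sval (cid (ex i)).
have cn i : c i != 0 by have [] := svalP (cid (ex i)).
have cE i x : entry (h x) i = c i *: entry x i by have [_] := svalP (cid (ex i)); exact.
have := entry_plane (h (gen1 lam)); have := entry_plane (h (gen2 lam)).
rewrite /in_plane !cE !gen1E !gen2E !coefZ !coefC /= /base1 /base2 !inordK //=.
rewrite !mulr0 !mulr1 !(addr0, add0r) => /andP [/eqP c21 /eqP c3l] /andP [/eqP c20 /eqP c30].
apply: (mulfI (cn i3)); rewrite c3l mulrC; congr (_ * _).
by rewrite -c21 c20 c30.
Qed.

(** The modules of the family are pairwise nonisomorphic, even up to shift. *)
Theorem family_uncountable : graded_countable_CM_type gR -> countable [set: k].
Proof.
move=> [F hF].
have ex lam : exists i, iso_up_to_shift (family_module lam) (F i).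
  by apply: hF; [exact: fmod_MCM | exact: fmod_indecomposable].
pose idx lam := sval (cid (ex lam)).
apply/countable_injP; exists idx => lam mu _ _ e.
have [d [f [[f' ff' f'f] fd]]] := svalP (cid (ex lam)).
have := svalP (cid (ex mu)); rewrite -/(idx mu) -e.
move=> [d' [g [[g' gg' g'g] gd]]].
apply: (@family_separated lam mu (fun x => g' (f x)) (fun x => f' (g x)) (d - d')).
- by move=> r x /=; apply: (can_inj gg'); rewrite linearZ g'g linearZ g'g.
- by move=> r x /=; apply: (can_inj ff'); rewrite linearZ f'f linearZ f'f.
- by move=> x /=; rewrite g'g ff'.
- by move=> x /=; rewrite f'f gg'.
- move=> /= n x hx; have := gd (n + (d - d')) (g' (f x)).
  by rewrite g'g addrA subrK fd => E; exact: (etrans (esym E) hx).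
- move=> /= n x hx; have := fd (n - (d - d')) (f' (g x)).
  by rewrite f'f opprB addrA subrK gd => E; exact: (etrans (esym E) hx).
Qed.

End Family.

(** * Presentations *)

Section Presentation.
Variables (k : closedFieldType) (R : comAlgType k) (gR : nat -> {pred R}).
Hypothesis R_std : standard_graded gR.
Variables (n : nat) (y : 'I_n -> R).
Hypothesis y_deg : forall i, y i \in gR 1%N.
Hypothesis y_span : forall r, r \in gR 1%N ->
  exists c : 'I_n -> k, r = \sum_i c i *: y i.

Local Notation P := {mpoly k[n]}.
Local Notation pr := (hcomp (std_direct R_std)).

Definition subst (p : P) : R := mmap (in_alg R) y p.
HB.instance Definition _ := GRing.RMorphism.copy subst (mmap (in_alg R) y).

Lemma substC c : subst c%:MP = c%:A. Proof. exact: mmapC. Qed.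
Lemma substX i : subst 'X_i = y i.
Proof. by rewrite /subst mmapX mmap1U. Qed.
Lemma substZ c p : subst (c *: p) = c *: subst p.
Proof. by rewrite /subst mmapZ /= -scalerAl mul1r. Qed.

Lemma substB p q : subst (p - q) = subst p - subst q.
Proof. exact: rmorphB. Qed.
Lemma substD p q : subst (p + q) = subst p + subst q.
Proof. exact: rmorphD. Qed.
Lemma substM p q : subst (p * q) = subst p * subst q.
Proof. exact: rmorphM. Qed.

Lemma mpoly_mul_ind (Q : P -> Prop) :
  (forall c, Q c%:MP) -> (forall u v, Q u -> Q v -> Q (u + v)) ->
  (forall i u, Q u -> Q ('X_i * u)) -> forall p, Q p.
Proof.
move=> QC QD QX; have Q0 : Q 0 by rewrite -mpolyC0.
elim/mpolyind => [//|c m p _ _ Qp]; apply: (QD) => //.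
have QZ u : Q u -> forall i e, Q ('X_i ^+ e * u).
  move=> Qu i; elim=> [|e IH]; first by rewrite expr0 mul1r.
  by rewrite exprS -mulrA; exact: QX.
rewrite -mul_mpolyC mulrC mpolyXE_id.
elim: (index_enum _) => [|i s IH]; first by rewrite big_nil mul1r.
by rewrite big_cons -mulrA; exact: QZ.
Qed.

Lemma subst_surj r : exists p, subst p = r.
Proof.
elim/(std_ind R_std): r => [c|r /y_span [c ->]|u v [p <-] [q <-]|u v [p <-] [q <-]].
- by exists c%:MP; rewrite substC.
- exists (\sum_i c i *: 'X_i); rewrite rmorph_sum; apply: eq_bigr => i _.
  by rewrite /= substZ substX.
- by exists (p + q); rewrite rmorphD.
- by exists (p * q); rewrite rmorphM.
Qed.

Lemma subst_monomial m : subst 'X_[m] \in gR (mdeg m).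
Proof.
rewrite /subst mmapX /mmap1 mdegE.
elim/big_ind2: _ => [|a d b e ha hb|i _]; first exact: one_deg0 R_std.
  exact: (std_mul R_std).
exact: (std_exp1 R_std).
Qed.

Lemma subst_homog d p : p \is d.-homog -> subst p \in gR d.
Proof.
move=> /dhomogP hp; rewrite [p]mpolyE rmorph_sum /= big_seq.
apply: (piece_sum (std_direct R_std)) => m hm; rewrite substZ.
by apply: (std_scale R_std _); rewrite -(hp m hm); exact: subst_monomial.
Qed.

Lemma subst_homog_surj d r : r \in gR d -> exists2 p, p \is d.-homog & subst p = r.
Proof.
move=> hr; have [p ep] := subst_surj r.
pose q d' := pihomog [measure of mdeg] d' p.
have hq d' : q d' \is d'.-homog by exact: pihomogP.
have eq : p = \sum_(d' < maxn (mmeasure [measure of mdeg] p) d.+1) q d'.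
  exact: pihomog_partitionE (leq_maxl _ _).
exists (q d) => //; have hd d' := subst_homog (hq d'); clearbody q.
rewrite -(hcomp_id (std_direct R_std) hr) -ep eq rmorph_sum hcomp_bigsum.
rewrite (bigD1 (Ordinal (leq_maxr _ _))) //= hcomp_id // big1 ?addr0 // => i ni.
rewrite (hcomp_piece _ _ (hd i)).
by case: eqP => // e; case/eqP: ni; apply: val_inj.
Qed.

(** [R] and [B] are quotients of the polynomial ring by the same ideal. *)
Lemma presentation_iso (B : comAlgType k) (gB : nat -> {pred B})
    (pi : {rmorphism P -> B}) :
  (forall c p, pi (c *: p) = c *: pi p) -> (forall b, exists p, pi p = b) ->
  (forall p, pi p = 0 <-> subst p = 0) ->
  (forall d b, b \in gB d <-> exists2 p, p \is d.-homog & b = pi p) ->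
  graded_alg_iso gR gB.
Proof.
move=> piZ pi_surj ker gBP.
have same p q : pi p = pi q <-> subst p = subst q.
  split=> h; apply/subr0_eq.
    by rewrite -substB; apply/ker; rewrite rmorphB h subrr.
  by rewrite -rmorphB; apply/ker; rewrite substB h subrr.
pose f r := pi (sval (cid (subst_surj r))).
have fE p : f (subst p) = pi p.
  by apply/same; exact: (svalP (cid (subst_surj (subst p)))).
pose g b := subst (sval (cid (pi_surj b))).
have gE p : g (pi p) = subst p.
  by apply/same; exact: (svalP (cid (pi_surj (pi p)))).
have fB : zmod_morphism f.
  move=> u v; have [p <-] := subst_surj u; have [q <-] := subst_surj v.
  by rewrite -substB !fE rmorphB.
have fM : monoid_morphism f.
  split; first by rewrite -(rmorph1 subst) fE rmorph1.
  move=> u v; have [p <-] := subst_surj u; have [q <-] := subst_surj v.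
  by rewrite -substM !fE rmorphM.
have fZ : scalable f.
  by move=> c u; have [p <-] := subst_surj u; rewrite -substZ !fE piZ.
pose F : {lrmorphism R -> B} := HB.pack f (GRing.isZmodMorphism.Build _ _ f fB)
  (GRing.isMonoidMorphism.Build _ _ f fM) (GRing.isScalable.Build _ _ _ _ f fZ).
exists F; split.
  exists g => [u|b]; first by have [p <-] := subst_surj u; rewrite /= fE gE.
  by have [p <-] := pi_surj b; rewrite /= gE fE.
move=> d x; have [p <-] := subst_surj x.
apply/idP/idP => [/gBP [q hq]|/subst_homog_surj [q hq <-]].
  by rewrite /= fE => /same ->; exact: subst_homog.
by apply/gBP; exists q; rewrite //= fE.
Qed.

Lemma quot_pi_eq0 (s : seq P) hs p :
  (@quot_pi k n s hs p == 0) = (p \in gen_ideal hs).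
Proof.
rewrite -[RHS]/(p \in (gen_ideal hs : {pred _})) -[X in _ = (X \in _)]subr0.
by rewrite Quotient.idealrBE -(rmorph0 (@quot_pi k n s hs)).
Qed.

Lemma gen_ideal_mem (s : seq P) hs p : p \in s -> p \in @gen_ideal k n s hs.
Proof.
move=> /(nthP 0) [i hi <-]; apply/asboolP.
exists (fun j => (j == Ordinal hi)%:R); rewrite (bigD1 (Ordinal hi)) //= eqxx scale1r.
by rewrite big1 ?addr0 // => j /negbTE ->; rewrite scale0r.
Qed.

Lemma subst_gen_ideal (s : seq P) hs : (forall p, p \in s -> subst p = 0) ->
  forall p, p \in @gen_ideal k n s hs -> subst p = 0.
Proof.
move=> hsub p /asboolP [c ->]; rewrite rmorph_sum big1 // => i _.
by rewrite -[c i *: _]/(c i * _) rmorphM /= (hsub s`_i) ?mulr0 ?mem_nth.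
Qed.

Lemma quotient_iso (s : seq P) (hs : all (fun p => p@_0%MM == 0) s) :
  (forall p, p \in s -> subst p = 0) ->
  (forall p, subst p = 0 -> p \in gen_ideal hs) ->
  graded_alg_iso gR (@quot_piece k n s hs).
Proof.
move=> hsub hker.
apply: (presentation_iso (pi := @quot_pi k n s hs)).
- by move=> c p; rewrite -mul_mpolyC rmorphM.
- move=> b; elim/quotW: b => p; by exists p.
- move=> p; split=> [/eqP|/hker h]; last by apply/eqP; rewrite quot_pi_eq0.
  by rewrite quot_pi_eq0; exact: subst_gen_ideal.
- by move=> d b; split=> [/asboolP //|h]; apply/asboolP.
Qed.

End Presentation.

(** ** Kernels *)

Section Kernel.
Variables (k : closedFieldType) (R : comAlgType k) (gR : nat -> {pred R}).
Variables (n : nat) (y : 'I_n -> R) (rho : {rmorphism R -> {poly k}}).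
Hypothesis rhoC : forall c : k, rho c%:A = c%:P.
Local Notation P := {mpoly k[n]}.

Definition at_form (z : P) (f : {poly k}) : P := (map_poly (@mpolyC n k) f).[z].

Lemma at_formM z f g : at_form z (f * g) = at_form z f * at_form z g.
Proof. by rewrite /at_form rmorphM hornerM. Qed.
Lemma at_formD z f g : at_form z (f + g) = at_form z f + at_form z g.
Proof. by rewrite /at_form rmorphD hornerD. Qed.
Lemma at_formC z c : at_form z c%:P = c%:MP.
Proof. by rewrite /at_form map_polyC hornerC. Qed.
Lemma at_formX z : at_form z 'X = z.
Proof. by rewrite /at_form map_polyX hornerX. Qed.
Lemma at_form0 z : at_form z 0 = 0.
Proof. by rewrite /at_form rmorph0 horner0. Qed.

(** Restriction to a point followed by substitution of [z] for [X] is a ring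
    endomorphism of the polynomial ring.  It is the identity modulo [w] as soon
    as it is so on the variables; hence polynomials that vanish at the point are
    multiples of the linear form [w]. *)
Lemma restrict_modulo (w z : P) :
  (forall j, exists b, 'X_j - at_form z (rho (y j)) = b * w) ->
  forall p, rho (subst y p) = 0 -> exists b, p = b * w.
Proof.
move=> hX p hp.
suff [b eb] : exists b, p - at_form z (rho (subst y p)) = b * w.
  by exists b; rewrite -eb hp at_form0 subr0.
elim/mpoly_mul_ind: p {hp} => [c|u v [a ea] [b eb]|i u [a ea]].
- by exists 0; rewrite substC rhoC at_formC subrr mul0r.
- exists (a + b); rewrite substD rmorphD at_formD mulrDl -ea -eb opprD addrACA //.
have [b eb] := hX i; exists (b * u + at_form z (rho (y i)) * a).
rewrite substM rmorphM substX at_formM mulrDl -mulrA [u * w]mulrC mulrA -eb -mulrA -ea.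
by ring.
Qed.

End Kernel.

(** ** The coordinate rings of at most three points *)

Section SmallCases.
Variables (k : closedFieldType) (R : comAlgType k) (gR : nat -> {pred R}).
Hypothesis R_std : standard_graded gR.

Lemma one_point (rho : 'I_1 -> {rmorphism R -> {poly k}}) l :
  coordinates gR rho l -> graded_alg_iso gR (@mpoly_piece k 1).
Proof.
move=> H; pose y := fun _ : 'I_1 => l.
have y_deg i : y i \in gR 1%N by exact: coord_l1 H.
have y_span r : r \in gR 1%N -> exists c : 'I_1 -> k, r = \sum_i c i *: y i.
  move=> hr; exists (fun i => ev rho i r); rewrite big_ord1.
  apply: (ev_inj H hr); first exact: (std_scale R_std _ (y_deg ord0)).
  by move=> i; rewrite !(evE H) mulr1 (ord1 i).
apply: (presentation_iso R_std y_deg y_span (pi := idfun)) => //.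
- by move=> b; exists b.
- move=> p; split=> [/= ->|hp]; first exact: rmorph0.
  have [||b ->] := restrict_modulo (y := y) (rho := rho ord0) (w := 0)
    (z := 'X_ord0) (coordC H ord0) _ (p := p).
  + by move=> j; exists 0; rewrite (coord_l H) at_formX (ord1 j) subrr mul0r.
  + by rewrite hp rmorph0.
  by rewrite mulr0.
- move=> d b; split=> [hb|[p hp ->] //]; by exists b.
Qed.

Lemma two_points (rho : 'I_2 -> {rmorphism R -> {poly k}}) l :
  coordinates gR rho l ->
  graded_alg_iso gR (@quot_piece k 2 [:: 'X_0 * 'X_1] (xy_no_const k)).
Proof.
move=> H; have [y [y_deg y_ev]] := separators R_std H (@inj_id 'I_2).
have y_span r : r \in gR 1%N -> exists c : 'I_2 -> k, r = \sum_i c i *: y i.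
  move=> hr; exists (fun i => ev rho i r); apply: (ev_inj H hr).
    by apply: (piece_sum (std_direct R_std)) => i _; exact: (std_scale R_std _).
  move=> j; rewrite ev_sum (bigD1 j) //= (evZ H) y_ev eqxx mulr1 big1 ?addr0 //.
  by move=> i ni; rewrite (evZ H) y_ev eq_sym (negbTE ni) mulr0.
have rhoy i j : rho j (y i) = (j == i)%:R *: 'X.
  by rewrite (rho_homog H j (y_deg i)) y_ev expr1.
apply: (quotient_iso R_std y_deg y_span) => [p|p hp].
  rewrite inE => /eqP ->; rewrite substM !substX; apply: (coord_inj H) => i.
  rewrite rmorphM !rhoy -scalerAl -scalerAr scalerA.
  by case: i => [[|[|//]]] hi; rewrite ?mul0r ?mulr0 scale0r.
have [||b eb] := restrict_modulo (y := y) (rho := rho 0) (w := 'X_1)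
    (z := 'X_0) (coordC H 0) _ (p := p).
- move=> j; rewrite rhoy; case: j => [[|[|//]]] hj.
    by exists 0; rewrite scale1r at_formX mul0r (_ : Ordinal hj = 0) ?subrr //; exact: val_inj.
  by exists 1; rewrite scale0r at_form0 mul1r subr0 (_ : Ordinal hj = 1) //; exact: val_inj.
- by rewrite hp rmorph0.
have [||c ec] := restrict_modulo (y := y) (rho := rho 1) (w := 'X_0)
    (z := 'X_1) (coordC H 1) _ (p := b).
- move=> j; rewrite rhoy; case: j => [[|[|//]]] hj.
    by exists 1; rewrite scale0r at_form0 mul1r subr0 (_ : Ordinal hj = 0) //; exact: val_inj.
  by exists 0; rewrite scale1r at_formX mul0r (_ : Ordinal hj = 1) ?subrr //; exact: val_inj.
- have := congr1 (fun q => rho 1 (subst y q)) eb; rewrite hp rmorph0 substM substX.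
  rewrite rmorphM rhoy scale1r => /esym /eqP; rewrite mulf_eq0 polyX_eq0 orbF.
  by move/eqP.
rewrite eb ec -mulrA; apply/asboolP; exists (fun=> c).
by rewrite big_ord1.
Qed.

Section ThreePoints.
Variables (rho : 'I_3 -> {rmorphism R -> {poly k}}) (l : R).
Hypothesis H : coordinates gR rho l.
Local Notation A := (ring_model gR rho 1).

Let i0 : 'I_3 := ord0.
Let i1 : 'I_3 := lift ord0 ord0.
Let i2 : 'I_3 := ord_max.

Lemma ord3P (P : 'I_3 -> Prop) : P i0 -> P i1 -> P i2 -> forall i, P i.
Proof.
move=> h0 h1 h2 [[|[|[|//]]] hi].
- by rewrite (_ : Ordinal hi = i0) //; exact: val_inj.
- by rewrite (_ : Ordinal hi = i1) //; exact: val_inj.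
- by rewrite (_ : Ordinal hi = i2) //; exact: val_inj.
Qed.

Lemma sum3 (V : nmodType) (f : 'I_3 -> V) : \sum_i f i = f i0 + f i1 + f i2.
Proof.
rewrite !big_ord_recl big_ord0 addr0 addrA; congr (_ + f _ + f _); exact: val_inj.
Qed.

Let A_ext c d : A c -> c =1 d -> A d.
Proof. by move=> [s hs es] cd; exists s => // i; rewrite es. Qed.

Let A_lin a b c d : A c -> A d -> A (fun i => a * c i + b * d i).
Proof.
move=> [s hs es] [t ht et]; exists (a *: s + b *: t).
  by apply: (pieceD (std_direct R_std)); exact: (std_scale R_std _).
by move=> i; rewrite !(evE H) es et.
Qed.

(** If some linear form takes values at the three points outside the span of
    those of [l] and of another form [y], all vectors occur as values; otherwise
    the points are collinear. *)
Lemma three_points_dichotomy : (forall c, A c) \/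
  exists p q, [/\ p != 0, q != 0 & forall c, A c <-> c i2 = p * c i0 + q * c i1].
Proof.
have sep i j : i != j -> exists2 c, A c & c i != c j.
  move=> nij; have [y hy ny] := coord_sep H nij; exists (fun i => ev rho i y).
    by exists y.
  by apply: contra ny => /eqP h; rewrite (rho_homog H i hy) (rho_homog H j hy) h.
have Al : A (fun=> 1) by exists l; [exact: coord_l1 H | move=> i; exact: ev_l H i].
have [y Ay ny] := sep i0 i1 isT.
have n01 : y i0 - y i1 != 0 by rewrite subr_eq0.
pose p := (y i2 - y i1) / (y i0 - y i1); pose q := (y i0 - y i2) / (y i0 - y i1).
(* the basis of the span of 1 and y dual to the first two coordinates *)
pose f0 := fun i : 'I_3 => [:: 1; 0; p]`_i.
pose f1 := fun i : 'I_3 => [:: 0; 1; q]`_i.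
have Af0 : A f0.
  apply: (A_ext (A_lin (y i0 - y i1)^-1 (- y i1 / (y i0 - y i1)) Ay Al)).
  by apply: ord3P; rewrite /f0 /p /=; field.
have Af1 : A f1.
  apply: (A_ext (A_lin (- (y i0 - y i1)^-1) (y i0 / (y i0 - y i1)) Ay Al)).
  by apply: ord3P; rewrite /f1 /q /=; field.
have [on_line|/existsNP [c /not_implyP [Ac nc]]] :=
    pselect (forall c, A c -> c i2 = p * c i0 + q * c i1); last first.
  left=> d; pose s := c i2 - p * c i0 - q * c i1.
  have ns : s != 0.
    by apply/eqP => s0; apply: nc; apply/subr0_eq; rewrite -s0 /s; ring.
  have Ae := A_lin s^-1 (- s^-1) Ac (A_lin (c i0) (c i1) Af0 Af1).
  have := A_lin 1 (d i2 - p * d i0 - q * d i1) (A_lin (d i0) (d i1) Af0 Af1) Ae.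
  move/A_ext; apply; apply: ord3P; rewrite /f0 /f1 /=; first by ring.
    by ring.
  have -> : c i2 = s + p * c i0 + q * c i1 by rewrite /s; ring.
  by field.
right; exists p, q; split.
- apply/eqP => p0; have [c Ac /eqP] := sep i1 i2 isT; apply.
  have := on_line _ Al; rewrite (on_line _ Ac) p0 !mul0r !add0r mulr1 => <-.
  by rewrite mul1r.
- apply/eqP => q0; have [c Ac /eqP] := sep i0 i2 isT; apply.
  have := on_line _ Al; rewrite (on_line _ Ac) q0 !mul0r !addr0 mulr1 => <-.
  by rewrite mul1r.
move=> c; split; first exact: on_line.
move=> hc; apply: (A_ext (A_lin (c i0) (c i1) Af0 Af1)).
by apply: ord3P; rewrite /f0 /f1 /= ?hc; ring.
Qed.

(** The linear forms are chosen such that the first one vanishes at the first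
    point, the second one at the second point, and their sum at the third point.
    A polynomial that vanishes at the three points is divisible by the three
    forms, one after the other. *)
Lemma three_collinear p q : p != 0 -> q != 0 ->
  (forall c, A c <-> c i2 = p * c i0 + q * c i1) ->
  graded_alg_iso gR
    (@quot_piece k 2 [:: 'X_0 * 'X_1 * ('X_0 + 'X_1)] (xyxy_no_const k)).
Proof.
move=> np nq hA.
have [y0 y0d y0e] : A (fun i => [:: 0; q^-1; 1]`_i).
  by apply/hA; rewrite /= mulr0 add0r mulfV.
have [y1 y1d y1e] : A (fun i => [:: - p^-1; 0; -1]`_i).
  by apply/hA; rewrite /= mulr0 addr0 mulrN mulfV.
pose y (i : 'I_2) := if i == 0 then y0 else y1.
have y_deg i : y i \in gR 1%N by rewrite /y; case: ifP.
have y_span r : r \in gR 1%N -> exists c : 'I_2 -> k, r = \sum_i c i *: y i.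
  move=> hr; exists (fun i => if i == 0 then q * ev rho i1 r else - p * ev rho i0 r).
  rewrite big_ord_recl big_ord1 /=; apply: (ev_inj H hr).
    by apply: (pieceD (std_direct R_std)); exact: (std_scale R_std _).
  have e2 : ev rho i2 r = p * ev rho i0 r + q * ev rho i1 r.
    by apply/(hA (fun i => ev rho i r)); exists r.
  by apply: ord3P; rewrite !(evE H) /y /= y0e y1e /= ?e2; field.
have rho0 i : rho i y0 = [:: 0; q^-1; 1]`_i *: 'X.
  by rewrite (rho_homog H i y0d) y0e expr1.
have rho1 i : rho i y1 = [:: - p^-1; 0; -1]`_i *: 'X.
  by rewrite (rho_homog H i y1d) y1e expr1.
have C i := coordC H i.
apply: (quotient_iso R_std y_deg y_span) => [P|P hP].
  rewrite inE => /eqP ->; rewrite !substM substD !substX; apply: (coord_inj H).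
  by apply: ord3P; rewrite !rmorphM rmorphD !rho0 !rho1 /= ?scale0r ?scaleN1r ?scale1r
    ?mul0r ?mulr0 ?mul0r ?subrr ?mulr0.
have ord2P (Q : 'I_2 -> Prop) : Q 0 -> Q 1 -> forall j, Q j.
  move=> h0 h1 [[|[|//]]] hj.
    by rewrite (_ : Ordinal hj = 0) //; exact: val_inj.
  by rewrite (_ : Ordinal hj = 1) //; exact: val_inj.
have at_formZ z (c : k) f : at_form z (c *: f) = c%:MP * at_form z f :> {mpoly k[2]}.
  by rewrite -mul_polyC at_formM at_formC.
have [||b eb] := restrict_modulo (y := y) (rho := rho i0) (w := 'X_0)
    (z := (- p)%:MP * 'X_1) (C i0) _ (p := P).
- apply: ord2P; rewrite /y /= ?rho0 ?rho1 /= at_formZ at_formX.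
    by exists 1; rewrite mpolyC0 mul0r subr0 mul1r.
  by exists 0; rewrite mulrA -mpolyCM mulrNN mulVf // mpolyC1 mul1r subrr mul0r.
- by rewrite hP rmorph0.
have [||c ec] := restrict_modulo (y := y) (rho := rho i1) (w := 'X_1)
    (z := q%:MP * 'X_0) (C i1) _ (p := b).
- apply: ord2P; rewrite /y /= ?rho0 ?rho1 /= at_formZ at_formX.
    by exists 0; rewrite mulrA -mpolyCM mulVf // mpolyC1 mul1r subrr mul0r.
  by exists 1; rewrite mpolyC0 mul0r subr0 mul1r.
- have := congr1 (fun Q => rho i1 (subst y Q)) eb.
  rewrite hP rmorph0 substM substX /y /= rmorphM rho0 /= => /esym /eqP.
  by rewrite mulf_eq0 scaler_eq0 polyX_eq0 invr_eq0 (negbTE nq) !orbF => /eqP.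
have [||d ed] := restrict_modulo (y := y) (rho := rho i2) (w := 'X_0 + 'X_1)
    (z := 'X_0) (C i2) _ (p := c).
- apply: ord2P; rewrite /y /= ?rho0 ?rho1 /= at_formZ at_formX.
    by exists 0; rewrite mpolyC1 mul1r subrr mul0r.
  by exists 1; rewrite mpolyCN mpolyC1; ring.
- have := congr1 (fun Q => rho i2 (subst y Q)) eb.
  rewrite hP rmorph0 ec !substM !substX /y /= !rmorphM rho0 rho1 /= => /esym /eqP.
  by rewrite !mulf_eq0 !scaler_eq0 polyX_eq0 oppr_eq0 oner_eq0 !orbF => /eqP.
apply/asboolP; exists (fun=> d); rewrite big_ord1 /= eb ec ed.
by rewrite -[RHS]/(d * ('X_0 * 'X_1 * ('X_0 + 'X_1))); ring.
Qed.

End ThreePoints.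
End SmallCases.

Lemma det2 (A : comNzRingType) (M : 'M[A]_2) :
  \det M = M ord0 ord0 * M ord_max ord_max - M ord0 ord_max * M ord_max ord0.
Proof.
rewrite (expand_det_row _ ord0) !big_ord_recl big_ord0 addr0 /cofactor !det_mx11 !mxE /=.
rewrite expr0 expr1 mul1r mulN1r mulrN.
by congr (_ * M _ _ - M _ _ * M _ _); exact: val_inj.
Qed.

Section GeneralPosition.
Variables (k : closedFieldType) (R : comAlgType k) (gR : nat -> {pred R}).
Hypothesis R_std : standard_graded gR.
Hypothesis k_char0 : [pchar k] =i pred0.
Variables (rho : 'I_3 -> {rmorphism R -> {poly k}}) (l : R).
Hypothesis H : coordinates gR rho l.
Hypothesis A_full : forall c, ring_model gR rho 1 c.

Let n3 : (3%:R : k) != 0.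
Proof.
by apply/negP => h; have := k_char0 3; rewrite !inE /= h.
Qed.

(** The matrix with rows [x y z] and [y z x] has rank one at the points
    [(1, v, v^2)] with [v^3 = 1], which span the plane.  Conversely, modulo its
    minors each polynomial is of the form [u(x) + y f(x) + z g(x)], and vanishing
    at the three points means [u + v X f + v^2 X g = 0] for the three cube roots
    of unity [v], so that [u], [f] and [g] are zero. *)
Lemma three_general : graded_alg_iso gR
  (@quot_piece k 3 (minors2 (cyclic_mx k)) (cyclic_minors_no_const k)).
Proof.
have [w w_root] : exists w : k, w ^+ 2 + w + 1 = 0.
  have [w hw] : exists w, root ('X^2 + 'X + 1%:P : {poly k}) w.
    apply/closed_rootP; rewrite size_polyDl ?size_polyDl ?size_polyXn ?size_polyX //.
    by rewrite size_polyC oner_eq0.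
  by exists w; move: hw; rewrite rootE !hornerE => /eqP.
have w2E : w * w = - 1 - w.
  by apply/eqP; rewrite -subr_eq0; apply/eqP; rewrite -[RHS]w_root; ring.
have w22 : (-1 - w) ^+ 2 = w.
  by transitivity (w * w + w + 1 + w); [ring | rewrite w2E; ring].
have w1 : 1 - w != 0.
  apply/eqP => h; have w1 : w = 1 by apply/esym/subr0_eq.
  move: w_root; rewrite w1 expr1n => e3; case/eqP: n3; rewrite -e3; ring.
have w0 : w != 0.
  apply/eqP => h; move: w_root; rewrite h expr0n /= !add0r => /eqP.
  by rewrite oner_eq0.
pose v (i : 'I_3) := [:: 1; w; -1 - w]`_i.
have v3 i : v i ^+ 3 = 1.
  have w3 : w ^+ 3 = 1.
    apply/eqP; rewrite -subr_eq0; apply/eqP.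
    by transitivity ((w - 1) * (w ^+ 2 + w + 1)); [ring | rewrite w_root mulr0].
  move: i; apply: ord3P; rewrite /v /= ?expr1n // -w2E exprMn w3 mulr1 //.
pose y (j : 'I_3) : R := s2val (cid2 (A_full (fun i => v i ^+ j))).
have y_deg j : y j \in gR 1%N := s2valP (cid2 (A_full (fun i => v i ^+ j))).
have y_ev j i : ev rho i (y j) = v i ^+ j.
  exact: (s2valP' (cid2 (A_full (fun i => v i ^+ j)))).
have rhoy i j : rho i (y j) = v i ^+ j *: 'X.
  by rewrite (rho_homog H i (y_deg j)) y_ev expr1.
have y_span r : r \in gR 1%N -> exists c : 'I_3 -> k, r = \sum_i c i *: y i.
  move=> hr; pose a := ev rho ord0 r; pose b := ev rho (lift ord0 ord0) r.
  pose c := ev rho ord_max r.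
  (* the inverse discrete Fourier transform *)
  exists (fun j => 3%:R^-1 * [:: a + b + c; a + (-1 - w) * b + w * c;
                                 a + w * b + (-1 - w) * c]`_j).
  apply: (ev_inj H hr).
    by apply: (piece_sum (std_direct R_std)) => i _; exact: (std_scale R_std _).
  move=> i; rewrite sum3 !(evE H) !y_ev; move: i; apply: ord3P.
  - rewrite /v /= !expr1n -/a; field; exact: n3.
  - rewrite /v /= expr0 expr1 -/b [w ^+ _]w2E; apply/eqP; rewrite -subr_eq0; apply/eqP.
    transitivity ((w ^+ 2 + w + 1) * (3%:R^-1 * (2%:R * b - 2%:R * c))).
      by field; exact: n3.
    by rewrite w_root mul0r.
  rewrite /v /= expr0 expr1 -/c [(-1 - w) ^+ _]w22; apply/eqP; rewrite -subr_eq0; apply/eqP.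
  transitivity ((w ^+ 2 + w + 1) * (3%:R^-1 * (2%:R * c - 2%:R * b))).
    by field; exact: n3.
  by rewrite w_root mul0r.
have M_E a b : cyclic_mx k a b = 'X_(inZp (a + b)).
  rewrite mxE; move: (a + b)%N => m; have := ltn_pmod m (isT : (0 < 3)%N).
  have -> : inZp m = inZp (m %% 3) :> 'I_3 by apply: val_inj; rewrite /= modn_mod.
  case: (m %% 3)%N => [|[|[|//]]] _ /=; congr 'X_ _; exact: val_inj.
have rhoM i a b : rho i (subst y (cyclic_mx k a b)) = v i ^+ (a + b) *: 'X.
  by rewrite M_E substX rhoy /= expr_mod.
have kill p : p \in minors2 (cyclic_mx k) -> subst y p = 0.
  move=> /allpairsP [[f g] [_ _ ->]]; apply: (coord_inj H) => i.
  rewrite det2 ![mxsub _ _ _ _ _]mxE substB !substM rmorphB !rmorphM.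
  rewrite !rhoM -!scalerAl -!scalerAr !scalerA -!exprD -scalerBl.
  by rewrite addnACA [X in _ - _ ^+ X]addnACA [(g ord_max + g ord0)%N]addnC subrr scale0r.
apply: (quotient_iso R_std y_deg y_span kill) => p hp.
pose hs := cyclic_minors_no_const k.
have [I0 _ IMD] := gen_ideal_closed hs.
have IM a p0 : p0 \in gen_ideal hs -> a * p0 \in gen_ideal hs.
  by move=> hp0; rewrite -[_ * _]addr0; exact: IMD.
have ID p0 q0 : p0 \in gen_ideal hs -> q0 \in gen_ideal hs -> p0 + q0 \in gen_ideal hs.
  by move=> hp0 hq0; rewrite -[p0]mul1r; exact: IMD.
have minor (a b : 'I_3) : (a < b)%N ->
    'X_(inZp a) * 'X_(inZp b.+1) - 'X_(inZp b) * 'X_(inZp a.+1) \in gen_ideal hs.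
  move=> ab; apply: gen_ideal_mem; apply/allpairsP.
  pose f := [ffun i : 'I_2 => i]; pose g := [ffun i : 'I_2 => if i == ord0 then a else b].
  exists (f, g); split=> /=.
  - by rewrite mem_filter mem_enum !ffunE.
  - by rewrite mem_filter mem_enum !ffunE /= ab.
  rewrite det2 ![mxsub _ _ _ _ _]mxE !M_E !ffunE /= !add0n !add1n //.
pose x0 : {mpoly k[3]} := 'X_(inZp 0); pose x1 : {mpoly k[3]} := 'X_(inZp 1).
pose x2 : {mpoly k[3]} := 'X_(inZp 2).
have ix3 : inZp 3 = inZp 0 :> 'I_3 by exact: val_inj.
have r1 : x0 * x2 - x1 * x1 \in gen_ideal hs.
  by have := minor (inZp 0) (inZp 1) isT.
have r2 : x0 * x0 - x2 * x1 \in gen_ideal hs.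
  by have := minor (inZp 0) (inZp 2) isT; rewrite /= ix3.
have r3 : x1 * x0 - x2 * x2 \in gen_ideal hs.
  by have := minor (inZp 1) (inZp 2) isT; rewrite /= ix3.
have xE (Q : {mpoly k[3]} -> Prop) : Q x0 -> Q x1 -> Q x2 -> forall i, Q 'X_i.
  move=> h0 h1 h2; apply: ord3P.
  - by rewrite (_ : ord0 = inZp 0 :> 'I_3) //; exact: val_inj.
  - by rewrite (_ : lift ord0 ord0 = inZp 1 :> 'I_3) //; exact: val_inj.
  - by rewrite (_ : ord_max = inZp 2 :> 'I_3) //; exact: val_inj.
pose nf (u f g : {poly k}) := at_form x0 u + x1 * at_form x0 f + x2 * at_form x0 g.
(* Modulo the minors, x1 and x2 satisfy x1^2 = x0 x2, x1 x2 = x0^2 and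
   x2^2 = x0 x1, so that 1, x1, x2 generate the quotient over k[x0]. *)
have normal : forall p, exists u f g, p - nf u f g \in gen_ideal hs.
  apply: mpoly_mul_ind => [c|p1 p2 [u1 [f1 [g1 h1]]] [u2 [f2 [g2 h2]]]|i q [u [f [g h]]]].
  - exists c%:P, 0, 0; rewrite /nf at_formC !at_form0 !mulr0 !addr0 subrr; exact: I0.
  - exists (u1 + u2), (f1 + f2), (g1 + g2); have := ID _ _ h1 h2.
    by congr (_ \in gen_ideal hs); rewrite /nf !at_formD; ring.
  move: i; apply: (xE (fun z => exists u0 f0 g0 : {poly k},
    z * q - nf u0 f0 g0 \in gen_ideal hs)).
  - exists ('X * u), ('X * f), ('X * g); have := IM x0 _ h.
    by congr (_ \in gen_ideal hs); rewrite /nf !at_formM !at_formX; ring.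
  - exists ('X * ('X * g)), u, ('X * f).
    have := ID _ _ (IM x1 _ h) (ID _ _ (IM (- at_form x0 f) _ r1) (IM (- at_form x0 g) _ r2)).
    by congr (_ \in gen_ideal hs); rewrite /nf !at_formM !at_formX; ring.
  - exists ('X * ('X * f)), ('X * g), u.
    have := ID _ _ (IM x2 _ h) (ID _ _ (IM (- at_form x0 f) _ r2) (IM (- at_form x0 g) _ r3)).
    by congr (_ \in gen_ideal hs); rewrite /nf !at_formM !at_formX; ring.
have [u [f [g hpn]]] := normal p.
have rho_x i (m : nat) : (m < 3)%N -> rho i (subst y 'X_(inZp m)) = v i ^+ m *: 'X.
  by move=> hm; rewrite substX rhoy /= modn_small.
have rho_form i q : rho i (subst y (at_form x0 q)) = q.
  elim/poly_ind: q => [|q c IH]; first by rewrite at_form0 /subst mmap0 rmorph0.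
  rewrite at_formD at_formM at_formX at_formC substD substM substC.
  by rewrite rmorphD rmorphM IH rho_x // scale1r (coordC H).
have vanish i : u + (v i *: 'X) * f + (v i ^+ 2 *: 'X) * g = 0.
  have -> : u + v i *: 'X * f + v i ^+ 2 *: 'X * g = rho i (subst y (nf u f g)).
    by rewrite !substD !substM !rmorphD !rmorphM !rho_form !rho_x // expr1.
  have -> : nf u f g = p - (p - nf u f g) by rewrite opprB addrC subrK.
  by rewrite substB hp sub0r (subst_gen_ideal kill hpn) oppr0 rmorph0.
have := vanish ord0; have := vanish (lift ord0 ord0); have := vanish ord_max.
rewrite /v /= w22 expr1n expr2 w2E scale1r !scalerBl !scaleN1r.
set B := 'X * f; set C := 'X * g => e2 e1 e0.
have XB h : (- 'X - w *: 'X) * h = - ('X * h) - w *: ('X * h).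
  by rewrite mulrBl mulNr scalerAl.
rewrite !XB -!scalerAl -/B -/C in e0 e1 e2.
have u0 : u = 0.
  have : 3%:R *: u = 0.
    transitivity (u + B + C + (u + w *: B + (- C - w *: C) + (u + (- B - w *: B) + w *: C))).
      by rewrite -!mul_polyC; ring.
    by rewrite e0 e1 e2 !addr0.
  by move/eqP; rewrite scaler_eq0 (negbTE n3) => /eqP.
have CB : C = - B.
  by apply/eqP; rewrite -addr_eq0 addrC; move: e0; rewrite u0 add0r => ->; rewrite eqxx.
have B0 : B = 0.
  have : (w * (1 - w)) *: B = 0.
    rewrite (_ : w * (1 - w) = w - w * w); last by ring.
    by rewrite w2E -[RHS]e1 u0 CB -!mul_polyC; ring.
  by move/eqP; rewrite scaler_eq0 mulf_eq0 (negbTE w0) (negbTE w1) => /eqP.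
have Xz h : 'X * h = 0 -> h = 0 :> {poly k}.
  by move/eqP; rewrite mulf_eq0 polyX_eq0 => /eqP.
have f0 : f = 0 := Xz _ B0.
have g0 : g = 0 by apply: Xz; rewrite -/C CB B0 oppr0.
by move: hpn; rewrite u0 f0 g0 /nf !at_form0 !mulr0 !addr0 subr0.
Qed.

End GeneralPosition.

(** * The classification *)

Lemma uncountable_avoid (k : closedFieldType) : ~ countable [set: k] ->
  forall s : seq k, exists c, c \notin s.
Proof.
move=> unc s; apply: contrapT => h; apply: unc; apply/countable_injP.
have mem c : c \in s by apply/negPn/negP => hc; apply: h; exists c.
exists (fun c => index c s) => a b _ _ e.
by rewrite -(nth_index a (mem a)) e nth_index.
Qed.

(** Four of the points suffice for a family of modules indexed by [k]. *)
Lemma at_most_three_points (k : closedFieldType) (R : comAlgType k)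
    (gR : nat -> {pred R}) (R_std : standard_graded gR) (R_dim1 : krull_dim R 1)
    e (rho : 'I_e -> {rmorphism R -> {poly k}}) l :
  coordinates gR rho l -> graded_countable_CM_type gR ->
  ~ countable [set: k] -> (e <= 3)%N.
Proof.
move=> H cnt unc; rewrite leqNgt; apply/negP => e4; apply: unc.
pose sigma := widen_ord (e4 : (4 <= e)%N).
have sinj : injective sigma by move=> i j ij; apply: val_inj; exact: (congr1 val ij).
have [s [s_deg s_ev]] := separators R_std H sinj.
apply: (family_uncountable R_std R_dim1 (rho := rho \o sigma) (l := l) (s := s)) => //.
- exact: coord_l1 H.
- by move=> i; exact: coord_l H _.
- by move=> i c; exact: coordC H _ _.
- by move=> i d r; exact: coord_homog H _ _ _.
- by move=> i j; rewrite /= (rho_homog H _ (s_deg i)) s_ev.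
Qed.

Theorem corollary3p7 (k : closedFieldType)
    (k_uncountable : ~ countable [set: k])
    (k_char0 : [pchar k] =i pred0)
    (R : comAlgType k) (gR : nat -> {pred R})
    (R_std : standard_graded gR)
    (R_dim1 : krull_dim R 1)
    (R_red : reduced R)
    (R_CM : graded_CM_ring gR)
    (R_fin : finite_integral_closure R)
    (R_ctbl : graded_countable_CM_type gR) :
  graded_finite_CM_type gR /\
  [\/ graded_alg_iso gR (@mpoly_piece k 1),
      graded_alg_iso gR (@quot_piece k 2 [:: 'X_0 * 'X_1] (xy_no_const k)),
      graded_alg_iso gR
        (@quot_piece k 2 [:: 'X_0 * 'X_1 * ('X_0 + 'X_1)] (xyxy_no_const k))
    | graded_alg_iso gR
        (@quot_piece k 3 (minors2 (cyclic_mx k)) (cyclic_minors_no_const k))].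
Proof.
have [e [rho [l [e0 H]]]] :=
  coordinates_exist R_std R_dim1 R_red (uncountable_avoid k_uncountable).
have e3 := at_most_three_points R_std R_dim1 H R_ctbl k_uncountable.
have fin := finite_type_at_most_three R_std R_dim1 H e3.
have full : (e <= 2)%N -> forall c, ring_model gR rho 1 c.
  move=> e2 c; have [r [r_deg r_ev]] := separators R_std H (@inj_id 'I_e).
  by apply: (ev_surj R_std H r_deg r_ev); lia.
case: e e0 e3 rho H fin full => [//|[|[|[|//]]]] _ _ rho H fin full.
- split; first by apply: fin; left; exact: full.
  by constructor 1; exact: (one_point R_std H).
- split; first by apply: fin; left; exact: full.
  by constructor 2; exact: (two_points R_std H).
have [gen|[p [q [np nq line]]]] := three_points_dichotomy R_std H.
  split; first by apply: fin; left.
  by constructor 4; exact: (three_general R_std k_char0 H gen).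
split; last by constructor 3; exact: (three_collinear R_std H np nq line).
apply: fin; right; split=> //.
exists (fun i : 'I_3 => [:: p; q; -1]`_i).
  by apply: ord3P; rewrite /= ?oppr_eq0 ?oner_eq0.
move=> c; rewrite line sum3 /= mulN1r.
by split=> [/eqP|->]; rewrite ?subrr // subr_eq0 => /eqP.
Qed.
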